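(* Let $X_1,\dots,X_n$ be i.i.d. random vectors in $\mathbb{R}^p$ with mean $\mu$ and covariance matrix $\Sigma\ne0$, in the regime $n\to\infty$, $p=p_n$. Let $0<\delta\le1$, $q=2+\delta$, and assume $K_\delta,D_\delta<\infty$ (computed for $X_i-\mu$). Let $m=m_n\to\infty$ with $m=o(n)$ and assume $$\frac{\tilde K_0^2}{m}+\frac{\tilde K_\delta^q}{m^{q-1}}+\frac{\mathbb{E}((X_1-\mu)^T\Sigma (X_1-\mu))^{q/2}}{m^{\delta/2}f^q}+\frac{\tilde D_\delta^q}{m^\delta}\to0.$$ Let $L=\lfloor n/m\rfloor$, $B_j=\{l\in\mathbb Z:(j-1)m<l\le jm\}$ for $j=1,\dots,L$, $\bar X=n^{-1}\sum_{i=1}^nX_i$, $\bar X_B=|B|^{-1}\sum_{b\in B}X_b$, and $$\hat F(t)=\frac1L\sum_{j=1}^L\mathbf 1\{m|\bar X_{B_j}-\bar X|_2^2\le t(1-m/n)\}.$$ (i) Then $\sup_t|\hat F(t)-\mathbb{P}(n|\bar X-\mu|_2^2\le t)|\to0$ in probability. (ii) Let $A_1,\dots,A_J$ be i.i.d. uniformly distributed on $\{A\subset\{1,\dots,n\}:|A|=m\}$, independent of $(X_i)$, and $\check F(t)=\frac1J\sum_{j=1}^J\mathbf 1\{m|\bar X_{A_j}-\bar X|_2^2\le t(1-m/n)\}$. If $J=J_n\to\infty$, then $\sup_t|\check F(t)-\mathbb{P}(n|\bar X-\mu|_2^2\le t)|\to0$ in probability.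
   Context: $f_k=[\mathrm{tr}(\Sigma^k)]^{1/k}$, $f=f_2$. With $X=X_1-\mu$, $X'=X_2-\mu$: $K_\delta^{2+\delta}=\mathbb{E}|(X^TX-f_1)/f|^{2+\delta}$, $D_\delta^{2+\delta}=\mathbb{E}|X^TX'/f|^{2+\delta}$. $\tilde K_\delta=K_\delta+c_\delta$, $\tilde D_\delta=D_\delta+d_\delta$ with $c_\delta=(1+\delta)^{1/2}\|\xi^2-1\|_{2+\delta}$, $d_\delta=(1+\delta)^{1/2}\|\xi\|^2_{2+\delta}$, $\xi\sim N(0,1)$, $\|Z\|_q=(\mathbb{E}|Z|^q)^{1/q}$. *)

(* Defs.v *)
From HB Require Import structures.
From mathcomp Require Import all_boot all_order all_algebra.
From mathcomp Require Import all_classical all_reals all_analysis.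
Set Implicit Arguments. Unset Strict Implicit. Unset Printing Implicit Defensive.
Import Order.TTheory GRing.Theory Num.Theory.
Import numFieldNormedType.Exports.
Local Open Scope classical_set_scope.
Local Open Scope ring_scope.

Section Defs.
Context {R : realType}.

Definition dotv (p : nat) (x y : 'rV[R]_p) : R := \sum_(k < p) x 0 k * y 0 k.
Definition sqnorm (p : nat) (x : 'rV[R]_p) : R := dotv x x.

Definition vec_meas (p : nat) : set (set 'rV[R]_p) :=
  <<s [set A | exists (k : 'I_p) (B : set R),
               measurable B /\ A = (fun v : 'rV[R]_p => v 0 k) @^-1` B] >>.

Definition rvec_measurable d (T : measurableType d) (p : nat)
  (X : T -> 'rV[R]_p) : Prop :=
  forall A, vec_meas A -> measurable (X @^-1` A).

Definition iid_sample d (T : measurableType d) (P : probability T R)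
  (n p : nat) (X : nat -> T -> 'rV[R]_p) : Prop :=
  [/\ forall i, (i < n)%N -> rvec_measurable (X i),
      forall A : nat -> set 'rV[R]_p, (forall i, vec_meas (A i)) ->
        P (\bigcap_(i in `I_n) (X i @^-1` A i)) =
        (\prod_(i < n) P (X i @^-1` A i))%E
    & forall i A, (i < n)%N -> vec_meas A ->
        P (X i @^-1` A) = P (X 0%N @^-1` A)].

(* S 0, ..., S (J-1) are i.i.d. uniform random m-subsets of {0,..,n-1}
   (= {1,..,n} shifted), and the family (X_0,..,X_{n-1},S_0,..,S_{J-1}) is
   mutually independent (so the S_j are independent of the X_i). *)
Definition iid_uniform_subsets d (T : measurableType d) (P : probability T R)
  (n p m J : nat) (X : nat -> T -> 'rV[R]_p) (S : nat -> T -> {set 'I_n}) : Prop :=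
  [/\ forall j (Q : set {set 'I_n}), (j < J)%N -> measurable (S j @^-1` Q),
      forall j (a : {set 'I_n}), (j < J)%N ->
        P (S j @^-1` [set a]) =
        (if #|a| == m then ((('C(n, m))%:R : R)^-1)%:E else 0%E)
    & forall (A : nat -> set 'rV[R]_p) (Q : nat -> set {set 'I_n}),
        (forall i, vec_meas (A i)) ->
        P ((\bigcap_(i in `I_n) (X i @^-1` A i)) `&`
           (\bigcap_(j in `I_J) (S j @^-1` Q j))) =
        ((\prod_(i < n) P (X i @^-1` A i)) *
         (\prod_(j < J) P (S j @^-1` Q j)))%E].

Definition mean_cov d (T : measurableType d) (P : probability T R)
  (n p : nat) (X : nat -> T -> 'rV[R]_p) (mu : 'rV[R]_p) (Sigma : 'M[R]_p) : Prop :=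
  forall i, (i < n)%N -> forall k l : 'I_p,
    [/\ P.-integrable setT (fun w => (X i w 0 k)%:E),
        P.-integrable setT (fun w => ((X i w 0 k) ^+ 2)%:E),
        (\int[P]_w (X i w 0 k)%:E = (mu 0 k)%:E)%E
      & (\int[P]_w ((X i w 0 k - mu 0 k) * (X i w 0 l - mu 0 l))%:E
           = (Sigma k l)%:E)%E].

Definition fk (p : nat) (k : nat) (Sigma : 'M[R]_p) : R :=
  (\tr (Sigma ^+ k)) `^ (k%:R^-1).

(* K_delta^(2+delta) and D_delta^(2+delta) as extended reals, computed for
   X = X_1 - mu (= X 0 - mu) and X' = X_2 - mu (= X 1 - mu). *)
Definition Kpow d (T : measurableType d) (P : probability T R) (p : nat)
  (X : nat -> T -> 'rV[R]_p) (mu : 'rV[R]_p) (Sigma : 'M[R]_p) (delta : R) : \bar R :=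
  (\int[P]_w (`| (sqnorm (X 0%N w - mu) - fk 1 Sigma) / fk 2 Sigma | `^ (2 + delta))%:E)%E.

Definition Dpow d (T : measurableType d) (P : probability T R) (p : nat)
  (X : nat -> T -> 'rV[R]_p) (mu : 'rV[R]_p) (Sigma : 'M[R]_p) (delta : R) : \bar R :=
  (\int[P]_w (`| dotv (X 0%N w - mu) (X 1%N w - mu) / fk 2 Sigma | `^ (2 + delta))%:E)%E.

Definition Kd d T P p X mu Sigma (delta : R) : R :=
  (fine (@Kpow d T P p X mu Sigma delta)) `^ ((2 + delta)^-1).
Definition Dd d T P p X mu Sigma (delta : R) : R :=
  (fine (@Dpow d T P p X mu Sigma delta)) `^ ((2 + delta)^-1).

Definition gauss_norm (g : R -> R) (q : R) : R :=
  (fine (\int[normal_prob 0 1]_x (`| g x | `^ q)%:E)%E) `^ (q^-1).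

Definition c_delta (delta : R) : R :=
  Num.sqrt (1 + delta) * gauss_norm (fun x => x ^+ 2 - 1) (2 + delta).
Definition d_delta (delta : R) : R :=
  Num.sqrt (1 + delta) * (gauss_norm id (2 + delta)) ^+ 2.

Definition Ktilde d T P p X mu Sigma (delta : R) : R :=
  @Kd d T P p X mu Sigma delta + c_delta delta.
Definition Dtilde d T P p X mu Sigma (delta : R) : R :=
  @Dd d T P p X mu Sigma delta + d_delta delta.

Definition quad_moment d (T : measurableType d) (P : probability T R) (p : nat)
  (X : nat -> T -> 'rV[R]_p) (mu : 'rV[R]_p) (Sigma : 'M[R]_p) (q : R) : R :=
  fine (\int[P]_w ((dotv (X 0%N w - mu) ((X 0%N w - mu) *m Sigma)) `^ (q / 2))%:E)%E.

Definition sample_mean T (n p : nat) (X : nat -> T -> 'rV[R]_p) (w : T) : 'rV[R]_p :=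
  (n%:R)^-1 *: \sum_(i < n) X i w.

(* mean over block B_{j+1} = {j m + 1, ..., (j+1) m} (1-based), i.e. the
   0-based indices j*m + l, l < m *)
Definition block_mean T (m p : nat) (X : nat -> T -> 'rV[R]_p) (j : nat) (w : T)
  : 'rV[R]_p :=
  (m%:R)^-1 *: \sum_(l < m) X (j * m + l)%N w.

Definition subset_mean T (n p : nat) (X : nat -> T -> 'rV[R]_p) (A : {set 'I_n})
  (w : T) : 'rV[R]_p :=
  (#|A|%:R)^-1 *: \sum_(i in A) X (nat_of_ord i) w.

Definition ind (b : bool) : R := if b then 1 else 0.

Definition Fhat T (n m p : nat) (X : nat -> T -> 'rV[R]_p) (w : T) (t : R) : R :=
  ((n %/ m)%:R)^-1 * \sum_(j < n %/ m)
    ind (m%:R * sqnorm (block_mean m X j w - sample_mean n X w)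
           <= t * (1 - m%:R / n%:R)).

Definition Fcheck T (n m p J : nat) (X : nat -> T -> 'rV[R]_p)
  (S : nat -> T -> {set 'I_n}) (w : T) (t : R) : R :=
  (J%:R)^-1 * \sum_(j < J)
    ind (m%:R * sqnorm (subset_mean X (S j w) w - sample_mean n X w)
           <= t * (1 - m%:R / n%:R)).

Definition Ftrue d (T : measurableType d) (P : probability T R) (n p : nat)
  (X : nat -> T -> 'rV[R]_p) (mu : 'rV[R]_p) (t : R) : R :=
  fine (P [set w | n%:R * sqnorm (sample_mean n X w - mu) <= t]).

End Defs.

(* Main.v *)
Require Import Defs.
From HB Require Import structures.
From mathcomp Require Import all_boot all_order all_algebra.
From mathcomp Require Import all_classical all_reals all_analysis.
From mathcomp Require Import measurable_realfun.
From mathcomp Require Import zify ring lra.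
Import Order.TTheory GRing.Theory Num.Theory.
Import numFieldNormedType.Exports.
Local Open Scope classical_set_scope.
Local Open Scope ring_scope.
Set Implicit Arguments. Unset Strict Implicit. Unset Printing Implicit Defensive.

(** Let [z = (X - mu) / sqrt f], so that [E (z . z')^2 = 1] for an independent copy [z'] of [z]; the
    hypotheses say that a Lyapunov quantity [theta m] tends to zero. All estimates are proved for
    finitely supported laws, uniformly in the law and in the dimension, and are carried over to the
    sample by discretising its coordinates, recentring, rescaling and dominated convergence.

    For smooth [G], Lindeberg's exchange of each summand of a block for a normalised sum of
    independent copies shows that [G (|S_m|^2 / m)] and [G (|S_n|^2 / n)] have nearly the same mean.
    For two subsets [a], [b] of size [m] the statistics of [a] and [b] differ in L^2 only slightly
    from functions of the disjoint sets [a \ b] and [b \ a], up to an error of order [|a /\ b| / m].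
    Hence the second moment of the average of [G (R_j) - E G (|S_n|^2 / n)] over blocks or random
    subsets is small. No Gaussian comparison is made: logistic functions [G] approximate indicators
    because the law of [|S_n|^2 / n] has no atoms in the limit, which follows from a Fejer kernel
    estimate after decoupling [cos (th |S|^2)] into a bilinear form of symmetrised sums. Since the
    increments of the distribution function are small, finitely many quantiles suffice for uniformity
    in [t]. *)

(** * Truncated powers *)

Section Psi.
Context {R : realType}.
Implicit Types a b c u v : R.

(** The Lyapunov terms are truncated: for [u >= 0] and [0 < delta <= 1], [cut1 u] is below
    [u^delta], so [psi] stands in for powers of order [2 + delta], and [delta] disappears until the
    moment conditions are converted. The obstacle is that the normalised [|S_n|^2 / n] has centre
    [f_1 / f], which may be unbounded, and that no limit law is available, the spectrum of [Sigma]
    changing with [n]. Hence neither tightness nor a limit distribution can be used: quantiles are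
    taken from the true distribution function itself, and only its increments are estimated.
    Finitely supported laws turn Fubini, independence and conditioning into manipulations of finite
    sums; every constant is free of the number of atoms and of the dimension, so only integrability
    matters when the mesh tends to zero. That integrability is the fourth moment of [|X_1 - mu|],
    which finiteness of [K_delta] supplies. Mixed errors are split with a free weight [lam], which
    avoids square roots of expectations; it is fixed before the threshold on [theta]. *)

Definition cut1 u : R := Num.min 1 `|u|.
Definition psi u : R := u ^+ 2 * cut1 u.
(** Equals [|u|^3] on [-1, 1] and [3 u^2 - 3 |u| + 1] outside, in one formula through [cut1];
    [dhpsi] is its derivative. It is a smoother function comparable with [psi], whose own derivative
    jumps at 1. *)
Definition hpsi u : R := 3 * u ^+ 2 * cut1 u - 3 * `|u| * cut1 u ^+ 2 + cut1 u ^+ 3.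
Definition dhpsi u : R := 6 * u * cut1 u - 3 * Num.sg u * cut1 u ^+ 2.

Lemma cut1_ge0 u : 0 <= cut1 u.
Proof. by rewrite /cut1 le_min ler01 normr_ge0. Qed.

Lemma cut1_le1 u : cut1 u <= 1.
Proof. by rewrite /cut1 ge_min lexx. Qed.

Lemma cut1_le u : cut1 u <= `|u|.
Proof. by rewrite /cut1 ge_min lexx orbT. Qed.

Lemma cut1N u : cut1 (- u) = cut1 u.
Proof. by rewrite /cut1 normrN. Qed.

Lemma cut1_norm u : cut1 `|u| = cut1 u.
Proof. by rewrite /cut1 normr_id. Qed.

Lemma psi_ge0 u : 0 <= psi u.
Proof. by rewrite mulr_ge0 ?sqr_ge0 ?cut1_ge0. Qed.

Lemma psiN u : psi (- u) = psi u.
Proof. by rewrite /psi sqrrN cut1N. Qed.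

Lemma cut1P u : (`|u| <= 1 /\ cut1 u = `|u|) \/ (1 <= `|u| /\ cut1 u = 1).
Proof.
rewrite /cut1; case: (leP 1 `|u|) => h; first by right.
by left; split=> //; exact: ltW.
Qed.

Lemma psi_le_hpsi u : psi u <= hpsi u.
Proof.
rewrite /psi /hpsi; have := normr_ge0 u.
have <- : `|u| ^+ 2 = u ^+ 2 by rewrite real_normK// num_real.
case: (cut1P u) => -[]; set y := `|u|; move=> h -> y0; nra.
Qed.

Lemma hpsi_le_psi u : hpsi u <= 3 * psi u.
Proof.
rewrite /psi /hpsi; have := normr_ge0 u.
have <- : `|u| ^+ 2 = u ^+ 2 by rewrite real_normK// num_real.
case: (cut1P u) => -[]; set y := `|u|; move=> h -> y0; nra.
Qed.

Lemma hpsiN u : hpsi (- u) = hpsi u.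
Proof. by rewrite /hpsi cut1N normrN sqrrN. Qed.

Lemma dhpsiN u : dhpsi (- u) = - dhpsi u.
Proof. rewrite /dhpsi cut1N sgrN; ring. Qed.

(* [hpsi] is of class C^2 with [hpsi'' = 6 cut1], so this is its second-order Taylor bound. *)
Lemma hpsi_taylor a b :
  hpsi (a + b) <= hpsi a + dhpsi a * b + 3 * b ^+ 2 * (cut1 a + cut1 b).
Proof.
wlog a0 : a b / 0 <= a.
  move=> H; case: (leP 0 a) => a0; first exact: H.
  have := H (- a) (- b); rewrite oppr_ge0 (ltW a0) => /(_ isT).
  by rewrite -opprD !hpsiN dhpsiN mulrNN sqrrN !cut1N.
rewrite /dhpsi.
have sga : (a = 0) \/ (0 < a /\ Num.sg a = 1).
  move: a0; rewrite le_eqVlt => /orP[/eqP <-|h]; first by left.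
  by right; split=> //; rewrite gtr0_sg.
have na : `|a| = a by rewrite ger0_norm.
rewrite /hpsi.
have E (u : R) : (0 <= u /\ `|u| = u) \/ (u <= 0 /\ `|u| = - u).
  case: (leP 0 u) => u0; first by left; rewrite ger0_norm.
  by right; rewrite ltr0_norm// ltW.
set u := a + b.
have -> : b = u - a by rewrite /u; ring.
have hb3 : 0 <= (u - a) ^+ 2 * `|u - a| by rewrite mulr_ge0 ?sqr_ge0.
have hu3 : 1 <= u -> 0 <= (u - 1) ^+ 2 * (u - 1).
  by move=> ?; rewrite mulr_ge0 ?sqr_ge0 ?subr_ge0.
have hu3' : u <= 1 -> 0 <= (u - 1) ^+ 2 * (1 - u).
  by move=> ?; rewrite mulr_ge0 ?sqr_ge0 ?subr_ge0.
have ha3 : 0 <= a * (u - a) ^+ 2 by rewrite mulr_ge0 ?sqr_ge0.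
have ha4 : 1 <= u -> 0 <= (a - 1) ^+ 2 * (u - 1).
  by move=> ?; rewrite mulr_ge0 ?sqr_ge0 ?subr_ge0.
have ha5 : 1 <= u - a -> 0 <= (a - 1) ^+ 2 * (u - a).
  by move=> ?; rewrite mulr_ge0 ?sqr_ge0//; lra.
case: (cut1P a) => -[]; rewrite na => ha ->;
case: (cut1P u) => -[hu ->];
case: (cut1P (u - a)) => -[hb ->];
case: (E u) => -[u0 eu]; rewrite eu in hu *;
case: (E (u - a)) => -[ua0 eua]; rewrite eua in hb hb3 *;
case: sga => [h|[h ->]]; subst; rewrite ?sgr0;
try (have {}hu3 := hu3 hu); try (have {}hu3' := hu3' hu);
try (have {}ha4 := ha4 hu); try (have {}ha5 := ha5 hb);
first [lra | nra].
Qed.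
End Psi.

Section PsiMore.
Context {R : realType}.
Implicit Types a b c u v : R.

Lemma le_cut1 u v : `|u| <= `|v| -> cut1 u <= cut1 v.
Proof.
by move=> h; rewrite /cut1 le_min ge_min lexx/= ge_min h orbT.
Qed.

Lemma le_psi u v : `|u| <= `|v| -> psi u <= psi v.
Proof.
move=> h; rewrite /psi; apply: ler_pM; rewrite ?sqr_ge0 ?cut1_ge0 ?le_cut1//.
by rewrite -[u ^+ 2]real_normK ?num_real// -[v ^+ 2]real_normK ?num_real// ler_pXn2r ?nnegrE.
Qed.

Lemma cut1_scale c u : 1 <= c -> cut1 (c * u) <= c * cut1 u.
Proof.
move=> c1; have := normr_ge0 u.
by case: (cut1P u) => -[hu ->]; have := cut1_le (c * u);
  rewrite normrM [`|c|]ger0_norm; try lra; have := cut1_le1 (c * u); nra.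
Qed.

Lemma psi_scale c u : 1 <= c -> psi (c * u) <= c ^+ 3 * psi u.
Proof.
move=> c1; rewrite /psi exprMn.
have -> : c ^+ 3 * (u ^+ 2 * cut1 u) = c ^+ 2 * u ^+ 2 * (c * cut1 u) by ring.
by rewrite ler_wpM2l ?cut1_scale// mulr_ge0 ?sqr_ge0.
Qed.

Lemma psi_shrink t u : 0 <= t <= 1 -> psi (t * u) <= t ^+ 2 * psi u.
Proof.
move=> /andP[t0 t1]; rewrite /psi exprMn -mulrA ler_wpM2l ?sqr_ge0//.
rewrite ler_wpM2l ?sqr_ge0// le_cut1// normrM ger0_norm//.
by rewrite ler_piMl.
Qed.

Lemma psiD a b : psi (a + b) <= 8 * (psi a + psi b).
Proof.
wlog ab : a b / `|a| <= `|b|.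
  move=> H; case: (leP `|a| `|b|) => h; first exact: H.
  by rewrite addrC [X in 8 * X]addrC H// ltW.
have h2 : psi (a + b) <= psi (2 * b).
  apply: le_psi; rewrite (le_trans (ler_normD _ _))// normrM ger0_norm//.
  lra.
have := @psi_scale 2 b; have := psi_ge0 a; have := psi_ge0 b.
by move=> ? ? /(_ _) h; have := h ltac:(lra); lra.
Qed.

(** [hpsi] is a convex function of [u^2], so it has a supporting line in that variable; [c] is the
    slope at [u0^2], namely [3/2 u0] for [u0 <= 1] and [3 - 3 / (2 u0)] beyond. This makes Jensen's
    inequality work at the level of second moments. *)
Lemma hpsi_tangent u0 : 0 <= u0 ->
  exists c, forall u, hpsi u0 + c * (u ^+ 2 - u0 ^+ 2) <= hpsi u.
Proof.
move=> u00.
case: (leP u0 1) => u01.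
- exists (3 / 2 * u0) => u.
  have -> : hpsi u0 = u0 ^+ 3.
    rewrite /hpsi; case: (cut1P u0) => -[h ->]; rewrite ger0_norm//; first ring.
    rewrite ger0_norm// in h; have -> : u0 = 1 by lra.
    ring.
  have <- : `|u| ^+ 2 = u ^+ 2 by rewrite real_normK// num_real.
  have y0 := normr_ge0 u.
  rewrite /hpsi; have <- : `|u| ^+ 2 = u ^+ 2 by rewrite real_normK// num_real.
  case: (cut1P u) => -[]; move: y0; set y := `|u| => y0 hy ->.
    have : 0 <= (y - u0) ^+ 2 * (y + u0 / 2) by rewrite mulr_ge0 ?sqr_ge0//; lra.
    nra.
  have : 0 <= (1 - u0) * ((y - 1) ^+ 2) by rewrite mulr_ge0 ?sqr_ge0//; lra.
  have : 0 <= (1 - u0) ^+ 2 * u0 by rewrite mulr_ge0 ?sqr_ge0//; lra.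
  have : 0 <= (1 - u0) ^+ 2  by rewrite sqr_ge0.
  have : 0 <= (1 - u0) * (y - 1) by rewrite mulr_ge0//; lra.
  nra.
- exists (3 - 3 / (2 * u0)) => u.
  have hu0 : hpsi u0 = 3 * u0 ^+ 2 - 3 * u0 + 1.
    rewrite /hpsi; case: (cut1P u0) => -[h ->]; rewrite ger0_norm// in h *; last ring.
    by exfalso; lra.
  have u0p : 0 < u0 by lra.
  rewrite hu0.
  have <- : `|u| ^+ 2 = u ^+ 2 by rewrite real_normK// num_real.
  have y0 := normr_ge0 u.
  rewrite /hpsi; have <- : `|u| ^+ 2 = u ^+ 2 by rewrite real_normK// num_real.
  rewrite -subr_ge0.
  rewrite -(pmulr_rge0 _ (_ : 0 < 2 * u0)); last lra.
  have E (X Z : R) : 2 * u0 * (X - (3 * u0 ^+ 2 - 3 * u0 + 1 + (3 - 3 / (2 * u0)) * (Z - u0 ^+ 2)))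
     = 2 * u0 * X - (2 * u0 * (3 * u0 ^+ 2 - 3 * u0 + 1) + (6 * u0 - 3) * (Z - u0 ^+ 2)).
    by field; lra.
  rewrite E.
  case: (cut1P u) => -[]; move: y0; set y := `|u| => y0 hy ->.
    have : 0 <= (u0 - 1) * (1 - y) ^+ 2 * y by rewrite mulr_ge0 ?mulr_ge0 ?sqr_ge0//; lra.
    have : 0 <= (u0 - 1) * (1 - y) ^+ 2 by rewrite mulr_ge0 ?sqr_ge0//; lra.
    have : 0 <= (1 - y) ^+ 2 * y by rewrite mulr_ge0 ?sqr_ge0//; lra.
    have : 0 <= (u0 - y) ^+ 2  by rewrite sqr_ge0.
    have : 0 <= (u0 - 1) ^+ 2  by rewrite sqr_ge0.
    have : 0 <= (1 - y) ^+ 2  by rewrite sqr_ge0.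
    nra.
  have : 0 <= (y - u0) ^+ 2  by rewrite sqr_ge0.
  nra.
Qed.
End PsiMore.

Section Dot.
Context {R : realType} {p : nat}.
Implicit Types x y z : 'rV[R]_p.

Lemma dotvC x y : dotv x y = dotv y x.
Proof. by apply: eq_bigr => k _; rewrite mulrC. Qed.
Lemma dotvDl x y z : dotv (x + y) z = dotv x z + dotv y z.
Proof. by rewrite -big_split; apply: eq_bigr => k _; rewrite mxE mulrDl. Qed.
Lemma dotvDr x y z : dotv z (x + y) = dotv z x + dotv z y.
Proof. by rewrite dotvC dotvDl !(dotvC _ z). Qed.
Lemma dotvZl c x z : dotv (c *: x) z = c * dotv x z.
Proof. by rewrite mulr_sumr; apply: eq_bigr => k _; rewrite mxE mulrA. Qed.
Lemma dotvZr c x z : dotv z (c *: x) = c * dotv z x.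
Proof. by rewrite dotvC dotvZl dotvC. Qed.
Lemma dotv0l x : dotv 0 x = 0.
Proof. by rewrite -(scale0r 0) dotvZl mul0r. Qed.
Lemma dotv0r x : dotv x 0 = 0.
Proof. by rewrite dotvC dotv0l. Qed.
Lemma dotvNl x z : dotv (- x) z = - dotv x z.
Proof. by rewrite -scaleN1r dotvZl mulN1r. Qed.
Lemma dotvNr x z : dotv z (- x) = - dotv z x.
Proof. by rewrite dotvC dotvNl dotvC. Qed.
Lemma sqnormD x y : sqnorm (x + y) = sqnorm x + sqnorm y + 2 * dotv x y.
Proof. rewrite /sqnorm !dotvDl !dotvDr (dotvC y x); ring. Qed.
Lemma sqnormZ c x : sqnorm (c *: x) = c ^+ 2 * sqnorm x.
Proof. by rewrite /sqnorm dotvZl dotvZr mulrA. Qed.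
Lemma sqnorm_ge0 x : 0 <= sqnorm x.
Proof. by apply: sumr_ge0 => k _; rewrite -expr2 sqr_ge0. Qed.
Lemma sqnorm0 : sqnorm (0 : 'rV[R]_p) = 0.
Proof. exact: dotv0l. Qed.
End Dot.

(** * Finitely supported laws *)

Lemma eq_ler (R : numDomainType) (x y : R) : x = y -> x <= y.
Proof. by move=> ->. Qed.

Lemma hpsi0 (R : realType) : hpsi (0 : R) = 0.
Proof. by apply/eqP; rewrite /hpsi /cut1 normr0 min_r//; apply/eqP; ring. Qed.

Section Law.
Context {R : realType} {p : nat}.
Local Notation V := 'rV[R]_p.
Local Notation law := (seq (R * V)).
Implicit Types (l : law) (f g : V -> R) (v x : V).

(* A law is a list of weighted points; [Ex] is the expectation, [lconv] the law of an independent
   sum, [cpow k] that of a sum of [k] independent copies, [sg2 l v] the second moment along [v]. *)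
Definition Ex (l : law) (f : V -> R) : R := \sum_(c <- l) c.1 * f c.2.
Definition is_law (l : law) : Prop :=
  (forall c, c \in l -> 0 <= c.1) /\ \sum_(c <- l) c.1 = 1.
Definition lconv (l l' : law) : law :=
  [seq (c.1 * d.1, c.2 + d.2) | c <- l, d <- l'].
Definition scl (t : R) (l : law) : law := [seq (c.1, t *: c.2) | c <- l].
Definition cpow (k : nat) (l : law) : law := iter k (lconv l) [:: (1, 0)].
Definition centered l := forall v, Ex l (fun x => dotv x v) = 0.
Definition sg2 l v := Ex l (fun x => dotv x v ^+ 2).

Lemma eq_Ex l f g : f =1 g -> Ex l f = Ex l g.
Proof. by move=> fg; apply: eq_bigr => c _; rewrite fg. Qed.

Lemma ExD l f g : Ex l (fun x => f x + g x) = Ex l f + Ex l g.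
Proof. by rewrite /Ex -big_split; apply: eq_bigr => c _; rewrite mulrDr. Qed.

Lemma ExZ l a f : Ex l (fun x => a * f x) = a * Ex l f.
Proof. by rewrite /Ex mulr_sumr; apply: eq_bigr => c _; rewrite mulrCA. Qed.

Lemma ExZr l a f : Ex l (fun x => f x * a) = Ex l f * a.
Proof. by rewrite mulrC -ExZ; apply: eq_Ex => x; rewrite mulrC. Qed.

Lemma ExN l f : Ex l (fun x => - f x) = - Ex l f.
Proof. by rewrite -mulN1r -ExZ; apply: eq_Ex => x; rewrite mulN1r. Qed.

Lemma ExB l f g : Ex l (fun x => f x - g x) = Ex l f - Ex l g.
Proof. by rewrite ExD ExN. Qed.

Lemma Ex_sum l (J : Type) (r : seq J) (P : pred J) (F : J -> V -> R) :
  Ex l (fun x => \sum_(j <- r | P j) F j x) = \sum_(j <- r | P j) Ex l (F j).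
Proof. by rewrite /Ex exchange_big; apply: eq_bigr => c _; rewrite mulr_sumr. Qed.

Lemma Ex_cst l a : is_law l -> Ex l (fun=> a) = a.
Proof. by move=> [_ h]; rewrite /Ex -mulr_suml h mul1r. Qed.

Lemma le_Ex l f g : is_law l -> (forall x, f x <= g x) -> Ex l f <= Ex l g.
Proof.
move=> [h _] fg; rewrite /Ex big_seq [leRHS]big_seq; apply: ler_sum => c cl.
by rewrite ler_wpM2l ?h.
Qed.

Lemma Ex_ge0 l f : is_law l -> (forall x, 0 <= f x) -> 0 <= Ex l f.
Proof. by move=> hl h; rewrite -(Ex_cst 0 hl); exact: le_Ex. Qed.

Lemma Ex_le_cst l f a : is_law l -> (forall x, f x <= a) -> Ex l f <= a.
Proof. by move=> hl h; rewrite -(Ex_cst a hl); exact: le_Ex. Qed.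

Lemma Ex_norm l f : is_law l -> `|Ex l f| <= Ex l (fun x => `|f x|).
Proof.
move=> hl; rewrite ler_norml -ExN !le_Ex// => x; rewrite ?ler_norm// lerNl.
by rewrite -normrN ler_norm.
Qed.

Lemma Ex_exch l l' (F : V -> V -> R) :
  Ex l (fun x => Ex l' (fun y => F x y)) = Ex l' (fun y => Ex l (fun x => F x y)).
Proof.
rewrite /Ex.
under eq_bigr do rewrite mulr_sumr.
rewrite exchange_big; apply: eq_bigr => d _; rewrite mulr_sumr.
by apply: eq_bigr => c _; rewrite mulrCA.
Qed.

Lemma Ex_sqr l f : is_law l -> (Ex l f) ^+ 2 <= Ex l (fun x => f x ^+ 2).
Proof.
move=> hl; have h : 0 <= Ex l (fun x => (f x - Ex l f) ^+ 2).
  by apply: Ex_ge0 => // x; rewrite sqr_ge0.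
move: h; under eq_Ex => x.
  rewrite (_ : _ ^+ 2 = f x ^+ 2 - 2 * Ex l f * f x + (Ex l f) ^+ 2); last ring.
  over.
rewrite ExD ExB ExZ Ex_cst//; lra.
Qed.

Lemma Ex_lconv l l' f : Ex (lconv l l') f = Ex l (fun x => Ex l' (fun y => f (x + y))).
Proof.
rewrite /Ex /lconv big_allpairs_dep; apply: eq_bigr => c _ /=; rewrite mulr_sumr.
by apply: eq_bigr => d _; rewrite mulrA.
Qed.

Lemma Ex_scl t l f : Ex (scl t l) f = Ex l (fun x => f (t *: x)).
Proof. by rewrite /Ex big_map. Qed.

Lemma Ex_cpow0 l f : Ex (cpow 0 l) f = f 0.
Proof. by rewrite /Ex big_seq1 mul1r. Qed.

Lemma Ex_cpowS k l f :
  Ex (cpow k.+1 l) f = Ex l (fun x => Ex (cpow k l) (fun y => f (x + y))).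
Proof. by rewrite -Ex_lconv. Qed.

Lemma Ex_cpow1 l f : Ex (cpow 1 l) f = Ex l f.
Proof. by rewrite Ex_cpowS; apply: eq_Ex => x; rewrite Ex_cpow0 addr0. Qed.

Lemma Ex1 l : Ex l (fun=> 1) = \sum_(c <- l) c.1.
Proof. by apply: eq_bigr => c _; rewrite mulr1. Qed.

Lemma law_lconv l l' : is_law l -> is_law l' -> is_law (lconv l l').
Proof.
move=> [h1 h2] [h1' h2']; split.
  move=> c; rewrite /lconv => /allpairsP[[a b] /= [ha hb ->]] /=.
  by apply: mulr_ge0; [exact: h1 | exact: h1'].

rewrite -[RHS]h2 -[LHS]Ex1 Ex_lconv -Ex1; apply: eq_Ex => x.
by rewrite Ex1.
Qed.

Lemma law_scl t l : is_law l -> is_law (scl t l).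
Proof.
move=> [h1 h2]; split; first by move=> c /mapP[a /h1 ? ->].
by rewrite big_map.
Qed.

Lemma law_dirac : is_law [:: (1, 0)].
Proof. by split; [move=> c; rewrite inE => /eqP -> /= | rewrite big_seq1]. Qed.

Lemma law_cpow k l : is_law l -> is_law (cpow k l).
Proof. by move=> hl; elim: k => [|k ih]; [exact: law_dirac | exact: law_lconv]. Qed.

Lemma Ex_cpowD a b l f :
  Ex (cpow (a + b) l) f =
  Ex (cpow a l) (fun x => Ex (cpow b l) (fun y => f (x + y))).
Proof.
elim: a f => [|a ih] f.
  by rewrite Ex_cpow0; apply: eq_Ex => y; rewrite add0r.
rewrite addSn !Ex_cpowS; apply: eq_Ex => x; rewrite ih.
by apply: eq_Ex => y; apply: eq_Ex => z; rewrite addrA.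
Qed.

(** Grouping: [k] independent blocks of [M] copies are [k * M] copies. With [t = M^(-1/2)] it turns
    a fully exchanged sum back into a sum of the original law. *)
Lemma Ex_cpow_block k M t l f :
  Ex (cpow k (scl t (cpow M l))) f = Ex (cpow (k * M) l) (fun x => f (t *: x)).
Proof.
elim: k f => [|k ih] f; first by rewrite !Ex_cpow0 scaler0.
rewrite Ex_cpowS Ex_scl mulSn Ex_cpowD; apply: eq_Ex => x.
by rewrite ih; apply: eq_Ex => y; rewrite scalerDr.
Qed.

Lemma centered_lconv l l' : is_law l -> is_law l' ->
  centered l -> centered l' -> centered (lconv l l').
Proof.
move=> hl hl' cl cl' v; rewrite Ex_lconv.
under eq_Ex => x do under eq_Ex => y do rewrite dotvDl.
under eq_Ex => x do rewrite ExD cl' Ex_cst// addr0.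
exact: cl.
Qed.

Lemma centered_scl t l : centered l -> centered (scl t l).
Proof.
by move=> cl v; rewrite Ex_scl; under eq_Ex do rewrite dotvZl; rewrite ExZ cl mulr0.
Qed.

Lemma centered_cpow k l : is_law l -> centered l -> centered (cpow k l).
Proof.
move=> hl cl; elim: k => [|k ih]; first by move=> v; rewrite Ex_cpow0 dotv0l.
by apply: centered_lconv => //; exact: law_cpow.
Qed.

Lemma sg2_ge0 l v : is_law l -> 0 <= sg2 l v.
Proof. by move=> hl; apply: Ex_ge0 => // x; rewrite sqr_ge0. Qed.

Lemma sg2_lconv l l' v : is_law l -> is_law l' -> centered l ->
  sg2 (lconv l l') v = sg2 l v + sg2 l' v.
Proof.
move=> hl hl' cl; rewrite /sg2 Ex_lconv.
have H x : Ex l' (fun y => dotv (x + y) v ^+ 2) =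
    dotv x v ^+ 2 + 2 * Ex l' (fun y => dotv y v) * dotv x v + sg2 l' v.
  under eq_Ex => y.
    rewrite dotvDl (_ : _ ^+ 2 = dotv x v ^+ 2 + 2 * dotv x v * dotv y v + dotv y v ^+ 2); last ring.
    over.
  by rewrite !ExD ExZ Ex_cst// /sg2; ring.
by rewrite (eq_Ex _ H) !ExD ExZ cl mulr0 addr0 Ex_cst.
Qed.

Lemma sg2_scl t l v : sg2 (scl t l) v = t ^+ 2 * sg2 l v.
Proof. by rewrite /sg2 Ex_scl -ExZ; apply: eq_Ex => x; rewrite dotvZl exprMn. Qed.

Lemma sg2Z t l v : sg2 l (t *: v) = t ^+ 2 * sg2 l v.
Proof. by rewrite /sg2 -ExZ; apply: eq_Ex => x; rewrite dotvZr exprMn. Qed.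

Lemma sg2_cpow k l v : is_law l -> centered l -> sg2 (cpow k l) v = k%:R * sg2 l v.
Proof.
move=> hl cl; elim: k => [|k ih].
  by rewrite /sg2 Ex_cpow0 dotv0l expr0n mul0r.
rewrite sg2_lconv//; last exact: law_cpow.
rewrite ih -(natr1 k); ring.
Qed.

(* [E_s (E_x (x.s)^2) = E_x (E_s (x.s)^2)], the quadratic form being symmetric in the two laws. *)
Lemma Ex_sg2C l l' : Ex l (sg2 l') = Ex l' (sg2 l).
Proof.
rewrite /sg2 Ex_exch; apply: eq_Ex => y.
by apply: eq_Ex => x; rewrite dotvC.
Qed.

Lemma Ex_abs l f : is_law l ->
  Ex l (fun x => `|f x|) <= Num.sqrt (Ex l (fun x => f x ^+ 2)).
Proof.
move=> hl; rewrite -[leLHS]ger0_norm; last exact: Ex_ge0.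
rewrite -sqrtr_sqr ler_wsqrtr//; apply: le_trans (Ex_sqr _ hl) _.
by apply: le_Ex => // x; rewrite real_normK// num_real.
Qed.

Lemma Ex_cut1 l f : is_law l ->
  Ex l (fun x => cut1 (f x)) <= cut1 (Num.sqrt (Ex l (fun x => f x ^+ 2))).
Proof.
move=> hl; rewrite [leRHS]/cut1 le_min Ex_le_cst//=; last by move=> x; exact: cut1_le1.
rewrite [leRHS]ger0_norm ?sqrtr_ge0//; apply: le_trans (Ex_abs _ hl).
by apply: le_Ex => // x; exact: cut1_le.
Qed.

(** The tangent line of [hpsi_tangent] is averaged at the root mean square of [f], where its linear
    term has mean zero. *)
Lemma jensen_hpsi l f : is_law l ->
  hpsi (Num.sqrt (Ex l (fun x => f x ^+ 2))) <= Ex l (fun x => hpsi (f x)).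
Proof.
move=> hl; set u0 := Num.sqrt _.
have [c hc] := hpsi_tangent (sqrtr_ge0 (Ex l (fun x => f x ^+ 2))).
have := @le_Ex l _ _ hl (fun x => hc (f x)).
rewrite ExD ExZ ExB !Ex_cst// sqr_sqrtr; last by apply: Ex_ge0 => // x; rewrite sqr_ge0.
by rewrite subrr mulr0 addr0.
Qed.

(* A truncated Rosenthal inequality, one increment at a time. *)
Lemma hpsi_step l l' v : is_law l -> is_law l' -> centered l ->
  Ex (lconv l l') (fun s => hpsi (dotv s v)) <=
  Ex l' (fun s => hpsi (dotv s v)) +
  3 * (sg2 l v * cut1 (Num.sqrt (sg2 l' v)) + Ex l (fun x => psi (dotv x v))).
Proof.
move=> hl hl' cl; rewrite Ex_lconv Ex_exch -lerBlDl.
have H s : Ex l (fun x => hpsi (dotv (x + s) v)) <= hpsi (dotv s v) +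
   3 * (sg2 l v * cut1 (dotv s v) + Ex l (fun x => psi (dotv x v))).
  apply: (@le_trans _ _ (Ex l (fun x => hpsi (dotv s v) + dhpsi (dotv s v) * dotv x v
     + (3 * cut1 (dotv s v) * (dotv x v) ^+ 2 + 3 * psi (dotv x v))))).
    apply: le_Ex => // x; rewrite dotvDl addrC (le_trans (hpsi_taylor _ _))// /psi.
    by apply: eq_ler; ring.
  move: (hpsi _) (dhpsi _) (cut1 _) => a1 a2 a3; rewrite !ExD !ExZ cl Ex_cst// /sg2; apply: eq_ler; ring.
rewrite lerBlDl; apply: le_trans (le_Ex hl' H) _.
rewrite ExD lerD2l ExZ ler_wpM2l// ExD Ex_cst// lerD2r ExZ ler_wpM2l ?sg2_ge0//.
exact: Ex_cut1.
Qed.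

Lemma hpsi_cpow k l v : is_law l -> centered l ->
  Ex (cpow k l) (fun s => hpsi (dotv s v)) <=
  3 * k%:R * (sg2 l v * cut1 (Num.sqrt (k%:R * sg2 l v)) + Ex l (fun x => psi (dotv x v))).
Proof.
(* The truncation level stays at [k] while [n] grows, so every increment is bounded by the same
   quantity. *)
move=> hl cl; have B n : (n <= k)%N -> Ex (cpow n l) (fun s => hpsi (dotv s v)) <=
  3 * n%:R * (sg2 l v * cut1 (Num.sqrt (k%:R * sg2 l v)) + Ex l (fun x => psi (dotv x v))).
  elim: n => [_|n ih nk].
    by rewrite Ex_cpow0 dotv0l hpsi0 mulr0 mul0r.
  apply: le_trans (hpsi_step v hl (law_cpow n hl) cl) _.
  set D := (X in _ <= 3 * n.+1%:R * X); have -> : 3 * n.+1%:R * D = 3 * n%:R * D + 3 * D.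
    by rewrite -(natr1 n); ring.
  rewrite lerD ?ih ?(ltnW nk)//.
  rewrite ler_wpM2l// lerD2r ler_wpM2l ?sg2_ge0// le_cut1//.
  rewrite !ger0_norm ?sqrtr_ge0// ler_wsqrtr// sg2_cpow// ler_wpM2r ?sg2_ge0//.
  by rewrite ler_nat ltnW.
exact: B.
Qed.

Lemma psi_cpow k l v : is_law l -> centered l ->
  Ex (cpow k l) (fun s => psi (dotv s v)) <=
  3 * k%:R * (sg2 l v * cut1 (Num.sqrt (k%:R * sg2 l v)) + Ex l (fun x => psi (dotv x v))).
Proof.
move=> hl cl; apply: le_trans (hpsi_cpow _ _ hl cl).
by apply: le_Ex; [exact: law_cpow | move=> x; exact: psi_le_hpsi].
Qed.

End Law.

(** * Lyapunov quantities of a normalised law *)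

Section Model.
Context {R : realType} {p : nat}.
Local Notation V := 'rV[R]_p.
Local Notation law := (seq (R * V)).
Implicit Types (l : law) (f g : V -> R) (v x : V).

Definition mean_sq l : R := Ex l (fun x => sqnorm x).
Definition var_sq l : R := Ex l (fun x => (sqnorm x - mean_sq l) ^+ 2).
(** Truncated forms of [E (X^T Sigma X)^(q/2) / (m^(delta/2) f^q)] and, for [lyap2], of
    [D_delta^q / m^delta], after normalisation. They arise as the third-order error of [S_m . x / m]
    averaged over [x]; see [mean_beta]. *)
Definition lyap1 l (m : R) : R :=
  Ex l (fun x => sg2 l x * cut1 (Num.sqrt (sg2 l x / m))).
Definition lyap2 l (m : R) : R :=
  Ex l (fun x => Ex l (fun y => dotv x y ^+ 2 * cut1 (dotv x y / m))).
(** [var_sq l / m] is the counterpart of [K_0^2 / m]. The summand [m^-1] absorbs errors of order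
    [1 / m] and makes a small [theta] force a large [m]. *)
Definition theta l (m : R) : R := var_sq l / m + lyap1 l m + lyap2 l m + m^-1.

(* Since [Ex l (sg2 l)] is the squared Frobenius norm of the covariance, [model] is the normalisation [f = 1]. *)
Definition model l := [/\ is_law l, centered l & Ex l (sg2 l) = 1].

Lemma var_sq_ge0 l : is_law l -> 0 <= var_sq l.
Proof. by move=> hl; apply: Ex_ge0 => // x; rewrite sqr_ge0. Qed.

Lemma lyap1_ge0 l m : is_law l -> 0 <= lyap1 l m.
Proof.
by move=> hl; apply: Ex_ge0 => // x; rewrite mulr_ge0 ?cut1_ge0 ?sg2_ge0.
Qed.

Lemma lyap2_ge0 l m : is_law l -> 0 <= lyap2 l m.
Proof.
move=> hl; apply: Ex_ge0 => // x; apply: Ex_ge0 => // y.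
by rewrite mulr_ge0 ?cut1_ge0 ?sqr_ge0.
Qed.

Lemma le_theta l (m n : R) : is_law l -> 0 < m -> m <= n -> theta l n <= theta l m.
Proof.
move=> hl m0 mn; have n0 := lt_le_trans m0 mn.
have i : n^-1 <= m^-1 by rewrite lef_pV2.
rewrite /theta !lerD//.
- by rewrite ler_wpM2l ?var_sq_ge0.
- apply: le_Ex => // x; rewrite ler_wpM2l ?sg2_ge0 ?le_cut1//.
  by rewrite !ger0_norm ?sqrtr_ge0 ?ler_wsqrtr ?ler_wpM2l ?sg2_ge0.
- apply: le_Ex => // x; apply: le_Ex => // y; rewrite ler_wpM2l ?sqr_ge0 ?le_cut1//.
  by rewrite !normrM ler_wpM2l// !ger0_norm// invr_ge0 ltW.
Qed.

Lemma mean_sg2_cpow k l : model l -> Ex (cpow k l) (sg2 l) = k%:R.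
Proof.
move=> [hl cl h1]; rewrite Ex_sg2C.
have -> : k%:R = k%:R * Ex l (sg2 l) by rewrite h1 mulr1.
by rewrite -ExZ; apply: eq_Ex => x; rewrite sg2_cpow.
Qed.

(** The [k (k - 1) / 2] cross terms [2 x_i . x_j] are uncorrelated with each other and with the
    squared norms, by centring, and each has variance 4 under the normalisation. *)
Lemma var_cpow k l : model l ->
  Ex (cpow k l) (fun s => (sqnorm s - k%:R * mean_sq l) ^+ 2) =
  k%:R * var_sq l + 2 * (k%:R ^+ 2 - k%:R).
Proof.
move=> hm; have [hl cl h1] := hm; elim: k => [|k ih].
  by rewrite Ex_cpow0 sqnorm0; ring.
rewrite Ex_cpowS Ex_exch.
pose A := mean_sq l.
have H s : Ex l (fun x => (sqnorm (x + s) - k.+1%:R * A) ^+ 2) =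
    (sqnorm s - k%:R * A) ^+ 2 + (var_sq l + 4 * sg2 l s)
    + 4 * Ex l (fun x => (sqnorm x - A) * dotv x s).
  under eq_Ex => x.
    rewrite sqnormD -(natr1 k).
    rewrite (_ : _ ^+ 2 = (sqnorm s - k%:R * A) ^+ 2 + (sqnorm x - A) ^+ 2
       + 4 * (dotv x s) ^+ 2 + 2 * (sqnorm s - k%:R * A) * (sqnorm x - A)
       + 4 * (sqnorm s - k%:R * A) * dotv x s
       + 4 * ((sqnorm x - A) * dotv x s)); last ring.
    over.
  rewrite !ExD !ExZ cl !Ex_cst// /var_sq /sg2 -/A.
  have -> : Ex l (fun x => sqnorm x - A) = 0 by rewrite ExB Ex_cst// subrr.
  by ring.
rewrite (eq_Ex _ H) ExD ExD ih ExD Ex_cst; last exact: law_cpow.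
rewrite !ExZ mean_sg2_cpow// Ex_exch.
have -> : Ex l (fun y => Ex (cpow k l) (fun x => (sqnorm y - A) * dotv y x)) = 0.
  rewrite -[RHS](Ex_cst 0 hl); apply: eq_Ex => y; rewrite ExZ.
  under eq_Ex do rewrite dotvC.
  by rewrite (centered_cpow k hl cl) mulr0.
by rewrite -(natr1 k); ring.
Qed.

(* The quantity controlling all Lyapunov errors along a direction [v]. *)
Definition beta l (m : R) v : R :=
  sg2 l v * cut1 (Num.sqrt (m * sg2 l v)) + Ex l (fun x => psi (dotv x v)).

Lemma beta_ge0 l m v : is_law l -> 0 <= beta l m v.
Proof.
move=> hl; rewrite addr_ge0 ?mulr_ge0 ?sg2_ge0 ?cut1_ge0//.
by apply: Ex_ge0 => // x; exact: psi_ge0.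
Qed.

(** Along the direction [x / m] with [x] random, the powers of [m] in [beta] collect into [m^-2]:
    this identity dictates the form of [lyap1] and [lyap2]. *)
Lemma mean_beta l (m : R) : is_law l -> 0 < m ->
  Ex l (fun x => beta l m (m^-1 *: x)) = (lyap1 l m + lyap2 l m) / m ^+ 2.
Proof.
move=> hl m0; have m1 : m != 0 by rewrite gt_eqF.
rewrite mulrDl /lyap1 /lyap2 -!ExZr -ExD; apply: eq_Ex => x.
rewrite /beta sg2Z; congr (_ + _).
  have -> : m * (m^-1 ^+ 2 * sg2 l x) = sg2 l x / m by field.
  by field.
rewrite -ExZr; apply: eq_Ex => y; rewrite /psi dotvZr (dotvC y x) [_ / m]mulrC.
by field.
Qed.

Lemma le_cut1_sqrt (a b : R) : a <= b -> cut1 (Num.sqrt a) <= cut1 (Num.sqrt b).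
Proof. by move=> ab; rewrite le_cut1// !ger0_norm ?sqrtr_ge0 ?ler_wsqrtr. Qed.

Lemma psi_cpow_beta k l (m : R) v : is_law l -> centered l -> k%:R <= m ->
  Ex (cpow k l) (fun s => psi (dotv s v)) <= 3 * k%:R * beta l m v.
Proof.
move=> hl cl km; apply: le_trans (psi_cpow _ _ hl cl) _.
rewrite ler_wpM2l ?mulr_ge0// lerD2r ler_wpM2l ?sg2_ge0// le_cut1_sqrt//.
by rewrite ler_wpM2r ?sg2_ge0.
Qed.

Lemma psi_pair k l (m : R) : is_law l -> centered l -> 0 < m -> k%:R <= m ->
  m * Ex l (fun x => Ex (cpow k l) (fun s => psi (dotv s x / m))) <=
  3 * (lyap1 l m + lyap2 l m).
Proof.
move=> hl cl m0 km.
apply: (@le_trans _ _ (m * (3 * m * ((lyap1 l m + lyap2 l m) / m ^+ 2)))).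
  rewrite ler_pM2l// -mean_beta// -ExZ; apply: le_Ex => // x.
  apply: (@le_trans _ _ (3 * k%:R * beta l m (m^-1 *: x))).
    apply: le_trans (psi_cpow_beta _ hl cl km); apply/eq_ler/eq_Ex => s.
    by rewrite dotvZr mulrC.
  by rewrite ler_wpM2r ?beta_ge0// ler_wpM2l.
by apply: eq_ler; field; rewrite gt_eqF.
Qed.

Definition avg_law (M : nat) l := scl (Num.sqrt M%:R)^-1 (cpow M l).

Lemma law_avg M l : is_law l -> is_law (avg_law M l).
Proof. by move=> hl; apply/law_scl/law_cpow. Qed.

Lemma centered_avg M l : is_law l -> centered l -> centered (avg_law M l).
Proof. by move=> hl cl; apply/centered_scl/centered_cpow. Qed.

Lemma sg2_avg M l v : (0 < M)%N -> is_law l -> centered l ->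
  sg2 (avg_law M l) v = sg2 l v.
Proof.
move=> M0 hl cl; rewrite sg2_scl sg2_cpow// exprVn sqr_sqrtr// mulKf//.
by rewrite pnatr_eq0 -lt0n.
Qed.

Lemma psi_avg M l v : (0 < M)%N -> is_law l -> centered l ->
  Ex (avg_law M l) (fun y => psi (dotv y v)) <=
  3 * (sg2 l v * cut1 (Num.sqrt (sg2 l v)) + Ex l (fun x => psi (dotv x v))).
Proof.
move=> M0 hl cl; have M0' : M%:R != 0 :> R by rewrite pnatr_eq0 -lt0n.
set t : R := (Num.sqrt M%:R)^-1.
have t2 : t ^+ 2 = M%:R^-1 by rewrite exprVn sqr_sqrtr.
have t01 : 0 <= t <= 1.
  rewrite invr_ge0 sqrtr_ge0 invf_le1 ?sqrtr_gt0 ?ltr0n//=.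
  by rewrite -[leLHS]sqrtr1 ler_wsqrtr// ler1n.
have -> : Ex (avg_law M l) (fun y => psi (dotv y v)) =
   Ex (cpow M l) (fun y => psi (dotv y (t *: v))).
  by rewrite Ex_scl; apply: eq_Ex => x; rewrite dotvZl dotvZr.
apply: le_trans (psi_cpow _ _ hl cl) _.
rewrite sg2Z t2 mulVKf// -mulrA ler_wpM2l// mulrDr.
rewrite -mulrA mulVKf// lerD2l -ExZ; apply: le_Ex => // x.
rewrite dotvZr; apply: le_trans (_ : M%:R * (t ^+ 2 * psi (dotv x v)) <= _).
  by rewrite ler_wpM2l// psi_shrink.
by rewrite t2 mulVKf.
Qed.

(** The variance term equals [psi] at the standard deviation, which Jensen's inequality bounds by
    three times the mean of [psi]; hence [12 = 3 * (3 + 1)], uniformly in [M]. *)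
Lemma psi_avg4 M l v : (0 < M)%N -> is_law l -> centered l ->
  Ex (avg_law M l) (fun y => psi (dotv y v)) <= 12 * Ex l (fun x => psi (dotv x v)).
Proof.
move=> M0 hl cl; apply: le_trans (psi_avg _ M0 hl cl) _.
set B := Ex l _.
have : sg2 l v * cut1 (Num.sqrt (sg2 l v)) <= 3 * B.
  have -> : sg2 l v * cut1 (Num.sqrt (sg2 l v)) = psi (Num.sqrt (sg2 l v)).
    by rewrite /psi sqr_sqrtr// sg2_ge0.
  apply: le_trans (psi_le_hpsi _) _.
  apply: le_trans (jensen_hpsi _ hl) _.
  by rewrite /B -ExZ; apply: le_Ex => // x; exact: hpsi_le_psi.
lra.
Qed.

Lemma var_avg M l : (0 < M)%N -> model l ->
  Ex (avg_law M l) (fun y => (sqnorm y - mean_sq l) ^+ 2) <= var_sq l + 2.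
Proof.
move=> M0 hm; have [hl cl h1] := hm.
have M1 : M%:R != 0 :> R by rewrite pnatr_eq0 -lt0n.
have M2 : 1 <= M%:R :> R by rewrite ler1n.
rewrite Ex_scl.
have -> : Ex (cpow M l) (fun x => (sqnorm ((Num.sqrt M%:R)^-1 *: x) - mean_sq l) ^+ 2)
   = M%:R^-2 * Ex (cpow M l) (fun s => (sqnorm s - M%:R * mean_sq l) ^+ 2).
  rewrite -ExZ; apply: eq_Ex => x; rewrite sqnormZ exprVn sqr_sqrtr//.
  by field.
rewrite var_cpow//.
have i0 : 0 <= M%:R^-1 :> R by rewrite invr_ge0.
have i1 : M%:R^-1 <= 1 :> R by rewrite invf_le1// (lt_le_trans ltr01).
have -> : M%:R^-2 * (M%:R * var_sq l + 2 * (M%:R ^+ 2 - M%:R)) =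
  var_sq l * M%:R^-1 + 2 * (1 - M%:R^-1) by field.
have := var_sq_ge0 hl; nra.
Qed.

(** The sum seen by one exchange: [i] summands already averaged, [j] still original. *)
Definition hyb M l i j := lconv (cpow i (avg_law M l)) (cpow j l).

Lemma law_hyb M l i j : is_law l -> is_law (hyb M l i j).
Proof. by move=> hl; apply: law_lconv; apply: law_cpow => //; exact: law_avg. Qed.

Lemma sg2_hyb M l i j v : (0 < M)%N -> is_law l -> centered l ->
  sg2 (hyb M l i j) v = (i + j)%:R * sg2 l v.
Proof.
move=> M0 hl cl; have hl' := law_avg M hl; have cl' := centered_avg M hl cl.
rewrite sg2_lconv ?sg2_cpow ?sg2_avg//; try exact: law_cpow; last exact: centered_cpow.
by rewrite natrD mulrDl.
Qed.

(** An original increment costs [3 beta], an averaged one [3 * (1 + 3) beta], the inner 3 coming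
    from [psi_avg]. The induction runs on [hpsi], the function to which [hpsi_step] applies. *)
Lemma psi_hyb M l i j (m : nat) v : (0 < M)%N -> (i + j <= m)%N -> (0 < m)%N ->
  is_law l -> centered l ->
  Ex (hyb M l i j) (fun s => psi (dotv s v)) <= 12 * m%:R * beta l m%:R v.
Proof.
move=> M0 ijm m0 hl cl; have hl' := law_avg M hl; have cl' := centered_avg M hl cl.
have b0 := beta_ge0 m%:R v hl.
apply: (@le_trans _ _ (Ex (hyb M l i j) (fun s => hpsi (dotv s v)))).
  by apply: le_Ex; [exact: law_hyb | move=> x; exact: psi_le_hpsi].
apply: (@le_trans _ _ (12 * (i + j)%:R * beta l m%:R v)); last first.
  by rewrite ler_wpM2r// ler_wpM2l// ler_nat.
elim: i ijm => [|i ih] ijm.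
  rewrite Ex_lconv Ex_cpow0; under eq_Ex do rewrite add0r.
  apply: le_trans (hpsi_cpow _ _ hl cl) _; rewrite add0n.
  apply: (@le_trans _ _ (3 * j%:R * beta l m%:R v)).
    rewrite ler_wpM2l ?mulr_ge0// lerD2r ler_wpM2l ?sg2_ge0// le_cut1_sqrt//.
    by rewrite ler_wpM2r ?sg2_ge0// ler_nat.
  by rewrite ler_wpM2r// ler_wpM2r//; lra.
have E f : Ex (hyb M l i.+1 j) f = Ex (lconv (avg_law M l) (hyb M l i j)) f.
  rewrite /hyb !Ex_lconv; apply: eq_Ex => x; rewrite Ex_lconv.
  by apply: eq_Ex => y; apply: eq_Ex => z; rewrite addrA.
rewrite E; apply: le_trans (hpsi_step v hl' (law_hyb M i j hl) cl') _.
have -> : 12 * (i.+1 + j)%:R * beta l m%:R v =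
   12 * (i + j)%:R * beta l m%:R v + 3 * (4 * beta l m%:R v).
  by rewrite addSn -(natr1 (i + j)); ring.
apply: lerD; first by apply: ih; rewrite ltnW.
rewrite ler_wpM2l// sg2_avg// sg2_hyb//.
apply: (@le_trans _ _ (beta l m%:R v + 3 * beta l m%:R v)); last lra.
have hs := sg2_ge0 v hl.
apply: lerD.
  apply: (@le_trans _ _ (sg2 l v * cut1 (Num.sqrt (m%:R * sg2 l v)))).
    by rewrite ler_wpM2l// le_cut1_sqrt// ler_wpM2r// ler_nat ltnW.
  by rewrite lerDl; apply: Ex_ge0 => // x; exact: psi_ge0.
apply: le_trans (psi_avg _ M0 hl cl) _.
rewrite ler_wpM2l// lerD2r ler_wpM2l// le_cut1_sqrt//.
by rewrite ler_peMl// ler1n.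
Qed.

End Model.

(** * Lindeberg replacement for smooth functions of squared norms *)

Section Lindeberg.
Context {R : realType} {p : nat}.
Local Notation V := 'rV[R]_p.
Local Notation law := (seq (R * V)).
Implicit Types (l : law) (v x : V).

(** Bounds on three derivatives in finite-difference form. The last field uses [psi] because only
    truncated third moments are available: cubic for small increments, quadratic for large ones. *)
Record smooth3 (G dG ddG : R -> R) (C : R) : Prop := Smooth3 {
  smooth3_range : forall z, 0 <= G z <= 1;
  smooth3_lip : forall z a, `|G (z + a) - G z| <= C * `|a|;
  smooth3_t1 : forall z a, `|G (z + a) - G z - dG z * a| <= C * a ^+ 2;
  smooth3_dlip : forall z a, `|dG (z + a) - dG z| <= C * `|a|;
  smooth3_t2 : forall z a, `|G (z + a) - G z - dG z * a - ddG z / 2 * a ^+ 2| <= C * psi a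
}.

Variables (G dG ddG : R -> R) (C : R).
Hypothesis hG : smooth3 G dG ddG C.

Lemma smooth3_C : 0 <= C.
Proof.
have := smooth3_lip hG 0 1; rewrite normr1 mulr1; exact: le_trans (normr_ge0 _).
Qed.

(** Only [a] is expanded to second order; for [b] two moments suffice, and the mixed term [a b] is
    split with weight [lam]. *)
Lemma taylor_split (z a b lam : R) : 0 < lam ->
  `|G (z + a + b) - G z - dG z * (a + b) - ddG z / 2 * a ^+ 2| <=
  C * ((1 + lam^-1) * b ^+ 2 + lam * a ^+ 2 + psi a).
Proof.
move=> lam0; have C0 := smooth3_C.
have -> : G (z + a + b) - G z - dG z * (a + b) - ddG z / 2 * a ^+ 2 =
  (G (z + a + b) - G (z + a) - dG (z + a) * b) + (dG (z + a) - dG z) * b +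
  (G (z + a) - G z - dG z * a - ddG z / 2 * a ^+ 2) by ring.
apply: le_trans (ler_normD _ _) _; rewrite [leRHS]mulrDr; apply: lerD; last exact: smooth3_t2 hG _ _.
apply: le_trans (ler_normD _ _) _.
have -> : C * ((1 + lam^-1) * b ^+ 2 + lam * a ^+ 2) =
   C * b ^+ 2 + C * (lam^-1 * b ^+ 2 + lam * a ^+ 2) by ring.
apply: lerD; first exact: smooth3_t1 hG _ _.
rewrite normrM; apply: le_trans (ler_wpM2r (normr_ge0 b) (smooth3_dlip hG z a)) _.
rewrite -mulrA ler_wpM2l//.
have ha : `|a| ^+ 2 = a ^+ 2 by rewrite real_normK// num_real.
have hb : `|b| ^+ 2 = b ^+ 2 by rewrite real_normK// num_real.
rewrite -ha -hb -subr_ge0.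
have h : 0 <= lam * (`|a| - lam^-1 * `|b|) ^+ 2 by rewrite mulr_ge0 ?sqr_ge0 ?ltW.
have E : lam * (`|a| - lam^-1 * `|b|) ^+ 2 =
   lam^-1 * `|b| ^+ 2 + lam * `|a| ^+ 2 - 2 * (`|a| * `|b|) by field; rewrite gt_eqF.
have := mulr_ge0 (normr_ge0 a) (normr_ge0 b); rewrite E in h; lra.
Qed.

Lemma psi2 (u : R) : psi (2 * u) <= 8 * psi u.
Proof.
have := @psi_scale _ 2 u; rewrite (_ : 2 ^+ 3 = 8 :> R); last ring.
by apply; lra.
Qed.

Definition lind_err l (A m lam : R) (s : V) : R :=
  C * ((1 + lam^-1) * (Ex l (fun x => (sqnorm x - A) ^+ 2) / m ^+ 2)
       + 4 * lam * (sg2 l s / m ^+ 2)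
       + 8 * Ex l (fun x => psi (dotv x (m^-1 *: s)))).

(** The increment of [|s + x|^2 / m] is [a + b] up to a constant, with [a = 2 x . s / m] and [b] the
    fluctuation of [|x|^2 / m], both of mean zero. The subtracted main term depends on the law only
    through [A] and [sg2 l], so it cancels between two laws sharing them. *)
Lemma lind_step l (A m lam : R) s : is_law l -> centered l -> mean_sq l = A ->
  0 < lam -> 0 < m ->
  `|Ex l (fun x => G (sqnorm (s + x) / m)) -
    (G ((sqnorm s + A) / m) + ddG ((sqnorm s + A) / m) * 2 * sg2 l s / m ^+ 2)|
  <= lind_err l A m lam s.
Proof.
move=> hl cl hA lam0 m0; set z := (sqnorm s + A) / m.
have m1 : m != 0 by rewrite gt_eqF.
pose a x := 2 * dotv x (m^-1 *: s).
pose b x := (sqnorm x - A) / m.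
have E x : sqnorm (s + x) / m = z + a x + b x.
  by rewrite /z /a /b sqnormD dotvZr (dotvC s); field.
have E0 : Ex l (fun x => G (sqnorm (s + x) / m)) -
    (G z + ddG z * 2 * sg2 l s / m ^+ 2) =
  Ex l (fun x => G (z + a x + b x) - G z - dG z * (a x + b x) - ddG z / 2 * a x ^+ 2).
  have ea : Ex l a = 0.
    by rewrite /a ExZ cl mulr0.
  have eb : Ex l b = 0.
    by rewrite /b ExZr ExB Ex_cst// -/(mean_sq l) hA subrr mul0r.
  have ea2 : Ex l (fun x => a x ^+ 2) = 4 * sg2 l s / m ^+ 2.
    rewrite /a; under eq_Ex do rewrite exprMn.
    by rewrite ExZ -/(sg2 l _) sg2Z; field.
  rewrite !ExB Ex_cst// !ExZ ExD ea eb ea2 (eq_Ex _ (fun x => congr1 G (E x))).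
  by field.
rewrite E0; apply: le_trans (Ex_norm _ hl) _.
apply: (@le_trans _ _ (Ex l (fun x =>
   C * ((1 + lam^-1) * b x ^+ 2 + lam * a x ^+ 2 + 8 * psi (dotv x (m^-1 *: s)))))).
  apply: le_Ex => // x; apply: le_trans (taylor_split _ _ _ lam0) _.
  by rewrite ler_wpM2l ?smooth3_C// lerD2l psi2.
rewrite ExZ !ExD !ExZ /lind_err ler_wpM2l ?smooth3_C// lerD2r.
apply: eq_ler; congr (_ + _).
  by congr (_ * _); rewrite -ExZr; apply: eq_Ex => x; rewrite /b expr_div_n.
rewrite [in RHS]mulrAC -mulrA -!ExZr -!ExZ; apply: eq_Ex => x.
by rewrite /a dotvZr; field.
Qed.

Lemma telescope_swap l l' (m : nat) (f : V -> R) :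
  Ex (cpow m l) f - Ex (cpow m l') f =
  \sum_(i < m) Ex (lconv (cpow i l') (cpow (m - i.+1) l))
     (fun s => Ex l (fun x => f (s + x)) - Ex l' (fun x => f (s + x))).
Proof.
pose D i := Ex (lconv (cpow i l') (cpow (m - i) l)) f.
have D0 : D 0%N = Ex (cpow m l) f.
  by rewrite /D Ex_lconv Ex_cpow0 subn0; apply: eq_Ex => x; rewrite add0r.
have Dm : D m = Ex (cpow m l') f.
  by rewrite /D Ex_lconv subnn; apply: eq_Ex => x; rewrite Ex_cpow0 addr0.
rewrite -D0 -Dm -[LHS]opprB -(telescope_sumr D (leq0n m)) big_mkord -sumrN.
apply: eq_bigr => -[i im] _ /=; rewrite opprB ExB; congr (_ - _).
  rewrite /D !Ex_lconv; apply: eq_Ex => x.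
  rewrite -[(m - i)%N]prednK ?subn_gt0// -subnS Ex_cpowS Ex_exch.
  by apply: eq_Ex => y; apply: eq_Ex => z; rewrite addrCA addrC addrAC.
rewrite /D Ex_lconv Ex_cpowS Ex_exch [RHS]Ex_lconv; apply: eq_Ex => x; rewrite Ex_exch.
by apply: eq_Ex => y; apply: eq_Ex => z; rewrite -addrA addrC.
Qed.

(* Each summand of the block of size [m] is exchanged for [M^(-1/2)] times a sum of [M] copies: the
   first two moments of the increment of [|S|^2 / m] agree up to the Lyapunov errors. *)
Lemma lindeberg l (m M : nat) (lam : R) : model l -> (0 < m)%N -> (0 < M)%N -> 0 < lam ->
  `|Ex (cpow m l) (fun s => G (sqnorm s / m%:R)) -
    Ex (cpow (m * M) l) (fun s => G (sqnorm s / (m * M)%:R))| <=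
  C * ((1 + lam^-1) * (2 * (var_sq l + 1) / m%:R) + 8 * lam +
       1248 * (lyap1 l m%:R + lyap2 l m%:R)).
Proof.
move=> hm m0 M0 lam0; have [hl cl h1] := hm.
have hl' := law_avg M hl; have cl' := centered_avg M hl cl.
have m0' : 0 < m%:R :> R by rewrite ltr0n.
have M0' : 0 < M%:R :> R by rewrite ltr0n.
have m1' : m%:R != 0 :> R by rewrite gt_eqF.
have M1' : M%:R != 0 :> R by rewrite gt_eqF.
have C0 := smooth3_C.
(* The averaged law has the same mean squared norm, so both laws are expanded around the same
   point. *)
have hA' : mean_sq (avg_law M l) = mean_sq l.
  rewrite /mean_sq Ex_scl.
  have E k : Ex (cpow k l) (fun x => sqnorm x) = k%:R * Ex l (fun x => sqnorm x).
    elim: k => [|k ih]; first by rewrite Ex_cpow0 sqnorm0 mul0r.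
    rewrite Ex_cpowS -(natr1 k) mulrDl mul1r -ih.
    under eq_Ex => x.
      under eq_Ex => y do rewrite sqnormD -dotvZl.
      rewrite ExD ExD Ex_cst; last exact: law_cpow.
      under [X in _ + X]eq_Ex => y do rewrite dotvC.
      rewrite (centered_cpow k hl cl) addr0 addrC; over.
    by rewrite ExD Ex_cst.
  under eq_Ex do rewrite sqnormZ.
  by rewrite ExZ E exprVn sqr_sqrtr ?ltW// mulKf.
have E2 : Ex (cpow (m * M) l) (fun s => G (sqnorm s / (m * M)%:R)) =
   Ex (cpow m (avg_law M l)) (fun s => G (sqnorm s / m%:R)).
  rewrite Ex_cpow_block; apply: eq_Ex => s; congr G.
  by rewrite sqnormZ exprVn sqr_sqrtr ?ltW// natrM; field; rewrite m1' M1'.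
rewrite E2 telescope_swap.
apply: le_trans (ler_norm_sum _ _ _) _.
set B := (X in _ <= X).
(* Each of the [m] exchanges is allowed an equal share of the bound. *)
have -> : B = \sum_(i < m) (B / m%:R).
  by rewrite sumr_const card_ord -[RHS]mulr_natr mulfVK.
apply: ler_sum => -[i im] _ /=.
have hH := law_hyb M i (m - i.+1) hl; rewrite -/(hyb M l i (m - i.+1)).
set H := hyb M l i (m - i.+1) in hH *.
have ijm : (i + (m - i.+1) <= m)%N by rewrite -ltnS -addSn subnKC.
apply: le_trans (Ex_norm _ hH) _.
apply: (@le_trans _ _ (Ex H (fun s => lind_err l (mean_sq l) m%:R lam s +
   lind_err (avg_law M l) (mean_sq l) m%:R lam s))).
  apply: le_Ex => // s.
  have h2 := @lind_step _ _ _ _ s hl cl erefl lam0 m0'.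
  have h3 := @lind_step _ _ _ _ s hl' cl' hA' lam0 m0'.
  rewrite sg2_avg// in h3.
  by apply: le_trans (ler_distD _ _ _) (lerD h2 _); rewrite distrC.
have HS : Ex H (sg2 l) <= m%:R.
  rewrite Ex_sg2C; apply: (@le_trans _ _ (Ex l (fun x => m%:R * sg2 l x))); last by rewrite ExZ h1 mulr1.
  apply: le_Ex => // x.
  by rewrite sg2_hyb// ler_wpM2r ?sg2_ge0// ler_nat.
have hL0 := addr_ge0 (lyap1_ge0 m%:R hl) (lyap2_ge0 m%:R hl).
have HP : Ex H (fun s => Ex l (fun x => psi (dotv x (m%:R^-1 *: s)))) <=
     12 * m%:R * ((lyap1 l m%:R + lyap2 l m%:R) / m%:R ^+ 2).
  rewrite -mean_beta// -ExZ Ex_exch; apply: le_Ex => // x.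
  apply: le_trans (psi_hyb _ M0 ijm m0 hl cl).
  by apply/eq_ler/eq_Ex => s; rewrite dotvZr dotvZr dotvC.
(* [144 = 12 * 12], one factor from [psi_avg4] and one from the hybrid sum; together with [HP] this
   gives [1248 = 8 * (12 + 144)]. *)
have HP' : Ex H (fun s => Ex (avg_law M l) (fun x => psi (dotv x (m%:R^-1 *: s)))) <=
     144 * m%:R * ((lyap1 l m%:R + lyap2 l m%:R) / m%:R ^+ 2).
  apply: (@le_trans _ _ (12 * Ex H (fun s => Ex l (fun x => psi (dotv x (m%:R^-1 *: s)))))).
    by rewrite -ExZ; apply: le_Ex => // s; exact: psi_avg4.
  lra.
have HV : Ex l (fun x => (sqnorm x - mean_sq l) ^+ 2) = var_sq l by [].
have HV' := var_avg M0 hm.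
have S' : sg2 (avg_law M l) = sg2 l by apply/funext => s; rewrite sg2_avg.
rewrite ExD /lind_err ExZ [X in _ + X]ExZ !ExD !ExZ !ExZr !Ex_cst// HV S'.
rewrite -mulrDr /B -[leRHS]mulrA ler_wpM2l//.
set P1 := Ex H _ in HP *; set P2 := Ex H _ in HP' *; set S := Ex H (sg2 l) in HS *.
set V2 := Ex _ _ in HV' *; set L := (lyap1 _ _ + _) in HP HP' *.
have i2 : 0 <= m%:R ^- 2 :> R by rewrite invr_ge0 sqr_ge0.
have l0 : 0 <= 1 + lam^-1 by rewrite addr_ge0 ?invr_ge0 ?ltW.
have -> : ((1 + lam^-1) * (2 * (var_sq l + 1) / m%:R) + 8 * lam + 1248 * L) / m%:R =
  (1 + lam^-1) * ((var_sq l + (var_sq l + 2)) * m%:R ^- 2) + 8 * lam * (m%:R * m%:R ^- 2)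
  + 8 * (12 * m%:R * (L / m%:R ^+ 2) + 144 * m%:R * (L / m%:R ^+ 2)).
  by field; rewrite (gt_eqF lam0) m1'.
have -> : (1 + lam^-1) * (var_sq l / m%:R ^+ 2) + 4 * lam * (S / m%:R ^+ 2) + 8 * P1 +
  ((1 + lam^-1) * (V2 / m%:R ^+ 2) + 4 * lam * (S / m%:R ^+ 2) + 8 * P2) =
  (1 + lam^-1) * ((var_sq l + V2) * m%:R ^- 2) + 8 * lam * (S * m%:R ^- 2) + 8 * (P1 + P2).
  by ring.
apply: lerD; last by rewrite ler_wpM2l// lerD.
apply: lerD.
  by rewrite ler_wpM2l// ler_wpM2r// lerD2l.
rewrite ler_wpM2l ?ler_wpM2r//; apply: mulr_ge0 => //; exact: ltW.
Qed.

End Lindeberg.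

(** * Smooth approximation of indicators *)

Section Calculus.
Context {R : realType}.
Implicit Types (f df : R -> R) (x y a b : R).

Lemma mvt f df a b : (forall x : R, is_derive x (1 : R) f (df x)) ->
  exists c, [/\ `|c - a| <= `|b - a|, (a <= b -> a <= c) & f b - f a = df c * (b - a)].
Proof.
move=> hf.
have cf : continuous f.
  move=> x; apply: differentiable_continuous; apply/derivable1_diffP.
  by have := hf x => ?; apply: ex_derive.
case: (leP a b) => ab.
  have [c] := MVT_segment ab (fun x _ => hf x) (continuous_subspaceT cf).
  rewrite in_itv/= => /andP[ac cb] e; exists c; split => //.
  by rewrite !ger0_norm ?subr_ge0// lerD2r.
have [c] := MVT_segment (ltW ab) (fun x _ => hf x) (continuous_subspaceT cf).
rewrite in_itv/= => /andP[ac cb] e; exists c; split.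
- rewrite !ler0_norm ?subr_le0// ?lerN2 ?lerD2r//; exact: ltW.
- by [].
- by rewrite -opprB e -mulrN opprB.
Qed.

Lemma mono0 f df : (forall x : R, is_derive x (1 : R) f (df x)) ->
  (forall x, 0 <= x -> 0 <= df x) -> forall x, 0 <= x -> f 0 <= f x.
Proof.
move=> hf h x x0; have [c [_ /(_ x0) c0 e]] := mvt 0 x hf.
by rewrite -subr_ge0 e mulr_ge0 ?h// subr0.
Qed.

Lemma sin_le x : 0 <= x -> sin x <= x.
Proof.
move=> x0; rewrite -subr_ge0.
have := @mono0 (fun x => x - sin x) (fun x => 1 - cos x).
by rewrite sin0 subr0; apply => // y _; rewrite subr_ge0 cos_le1.
Qed.

Lemma cos_ge x : 1 - x ^+ 2 / 2 <= cos x.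
Proof.
wlog x0 : x / 0 <= x.
  move=> H; case: (leP 0 x) => h; first exact: H.
  by rewrite -cosN -sqrrN H// oppr_ge0 ltW.
have H : forall x, 0 <= x -> (cos 0 - 1) + 2^-1 * 0 ^+ 2 <= cos x - 1 + 2^-1 * x ^+ 2.
  apply: (@mono0 (fun x => cos x - 1 + 2^-1 * x ^+ 2) (fun x => x - sin x)).
    move=> y; apply: trigger_derive.
    by rewrite /GRing.scale/=; field.
  by move=> y y0; rewrite subr_ge0; exact: sin_le.
have := H _ x0; rewrite cos0; lra.
Qed.

Lemma sin_ge x : 0 <= x -> x - x ^+ 3 / 6 <= sin x.
Proof.
move=> x0.
have H : forall x, 0 <= x -> (sin 0 - 0) + 6^-1 * 0 ^+ 3 <= sin x - x + 6^-1 * x ^+ 3.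
  apply: (@mono0 (fun x => sin x - x + 6^-1 * x ^+ 3) (fun x => cos x - 1 + x ^+ 2 / 2)).
    move=> y; apply: trigger_derive.
    by rewrite /GRing.scale/=; field.
  by move=> y y0; have := cos_ge y; lra.
have := H _ x0; rewrite sin0; lra.
Qed.

(** On [-1, 1] the fourth-order Taylor bound leaves [x^4 / 24 <= |x|^3]; beyond, [cos x <= 1] and
    [psi x = x^2]. An error of the form [psi] is what the Lyapunov terms control. *)
Lemma cos_le x : cos x <= 1 - x ^+ 2 / 2 + psi x.
Proof.
wlog x0 : x / 0 <= x.
  move=> H; case: (leP 0 x) => h; first exact: H.
  by rewrite -cosN -sqrrN -psiN H// oppr_ge0 ltW.
have := cos_le1 x; rewrite /psi; case: (cut1P x) => -[].
  rewrite ger0_norm// => x1 -> _.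
  have H : forall x, 0 <= x -> - cos 0 + 1 - 2^-1 * 0 ^+ 2 + 24^-1 * 0 ^+ 4 <=
     - cos x + 1 - 2^-1 * x ^+ 2 + 24^-1 * x ^+ 4.
    apply: (@mono0 (fun x => - cos x + 1 - 2^-1 * x ^+ 2 + 24^-1 * x ^+ 4)
        (fun x => sin x - x + x ^+ 3 / 6)).
      move=> y; apply: trigger_derive.
      by rewrite /GRing.scale/=; field.
    by move=> y y0; have := sin_ge y0; lra.
  have := H _ x0; rewrite cos0.
  have : 0 <= x ^+ 3 * (1 - x) by rewrite mulr_ge0 ?exprn_ge0 ?subr_ge0.
  have : 0 <= x ^+ 3 by rewrite exprn_ge0.
  have -> : x ^+ 3 * (1 - x) = x ^+ 3 - x ^+ 4 by ring.
  have -> : x ^+ 2 * x = x ^+ 3 by ring.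
  lra.
move=> _ -> ?; have := sqr_ge0 x; lra.
Qed.

(** Only the last field needs more than one or two mean value steps: for [|a| <= 1] the remainder
    has a derivative bounded by [C a^2], and for [|a| >= 1] the first-order bound plus the quadratic
    term costs at most [2 C a^2]. *)
Lemma taylor_smooth3 (g dg ddg dddg : R -> R) (C : R) :
  (forall x, is_derive x (1 : R) g (dg x)) ->
  (forall x, is_derive x (1 : R) dg (ddg x)) ->
  (forall x, is_derive x (1 : R) ddg (dddg x)) ->
  (forall x, 0 <= g x <= 1) ->
  (forall x, `|dg x| <= C) -> (forall x, `|ddg x| <= C) -> (forall x, `|dddg x| <= C) ->
  smooth3 g dg ddg (2 * C).
Proof.
move=> h1 h2 h3 h01 b1 b2 b3.
have C0 : 0 <= C by apply: le_trans (b1 0).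
have lip (f df : R -> R) z a : (forall x : R, is_derive x (1 : R) f (df x)) ->
    (forall x, `|df x| <= C) -> `|f (z + a) - f z| <= C * `|a|.
  move=> hf bf; have [c [_ _ ->]] := mvt z (z + a) hf.
  by rewrite normrM (addrC z) addrK ler_wpM2r.
have t1 (f df ddf : R -> R) z a : (forall x : R, is_derive x (1 : R) f (df x)) ->
    (forall x : R, is_derive x (1 : R) df (ddf x)) ->
    (forall x, `|ddf x| <= C) -> `|f (z + a) - f z - df z * a| <= C * a ^+ 2.
  move=> hf hdf bf; have [c [ca _ ->]] := mvt z (z + a) hf.
  rewrite (addrC z) addrK in ca *; rewrite -mulrBl normrM.
  have := lip df ddf z (c - z) hdf bf; rewrite (addrC z) subrK => h.
  rewrite -[a ^+ 2]real_normK ?num_real// expr2 mulrA ler_wpM2r//.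
  by apply: le_trans h _; rewrite ler_wpM2l.
have C2 (u v : R) : 0 <= v -> u <= C * v -> u <= 2 * C * v.
  move=> v0 /le_trans; apply; rewrite ler_wpM2r//; lra.
split=> //.
- by move=> z a; apply: C2 => //; exact: lip h1 b1.
- by move=> z a; apply: C2; [exact: sqr_ge0 | exact: t1 h1 h2 b2].
- by move=> z a; apply: C2 => //; exact: lip h2 b2.
- move=> z a; rewrite /psi; case: (cut1P a) => -[ha ->].
    pose k t := g (z + t) - g z - dg z * t - ddg z / 2 * t ^+ 2.
    have k0 : k 0 = 0 by rewrite /k addr0; ring.
    have hk (x : R) : is_derive x (1 : R) k (dg (z + x) - dg z - ddg z * x).
      have hc : is_derive x (1 : R) (fun t => g (z + t)) (dg (z + x)).
        have := @is_derive1_comp _ g (fun t => z + t) x (dg (z + x)) 1 (h1 _).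
        by rewrite mulr1; apply; apply: trigger_derive; rewrite add0r mulr1.
      apply: trigger_derive.
      by rewrite /GRing.scale/=; field.
    rewrite -/(k a); have := mvt 0 a hk; rewrite k0 !subr0 => -[c [ca _ ->]].
    rewrite normrM mulrA ler_wpM2r//; apply: C2; first exact: sqr_ge0.
    apply: le_trans (t1 _ _ _ z c h2 h3 b3) _; rewrite ler_wpM2l//.
    rewrite subr0 in ca.
    by rewrite -[c ^+ 2]real_normK ?num_real// -[a ^+ 2]real_normK ?num_real// ler_pXn2r ?nnegrE.
  rewrite mulr1; apply: le_trans (ler_normB _ _) _.
  have := t1 _ _ _ z a h1 h2 b2.
  have : `|ddg z / 2 * a ^+ 2| <= C * a ^+ 2.
    rewrite normrM (ger0_norm (sqr_ge0 a)) ler_wpM2r ?sqr_ge0//.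
    by rewrite normrM [`|2^-1|]ger0_norm//; have := b2 z; have := normr_ge0 (ddg z); lra.
  lra.
Qed.

(** The logistic function: its derivatives are polynomials in itself, so the required bounds reduce
    to polynomial inequalities on [0, 1]. *)
Definition logi x : R := 1 - (1 + expR x)^-1.

Lemma logi_bounds x : 0 < logi x < 1.
Proof.
have e0 := expR_gt0 x; have e1 : 1 + expR x > 0 by lra.
rewrite /logi subr_gt0 invf_lt1//; apply/andP; split; first by lra.
by rewrite ltrBlDr ltrDl invr_gt0.
Qed.

Lemma is_derive_logi x : is_derive x (1 : R) logi (logi x * (1 - logi x)).
Proof.
have e0 : 1 + expR x != 0 by have := expR_gt0 x; lra.
have h : is_derive x (1 : R) (fun y => (1 + expR y)^-1) (- (1 + expR x) ^- 2 *: expR x).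
  by apply: is_deriveV => //; apply: trigger_derive; rewrite add0r mul1r.
apply: trigger_derive; rewrite /GRing.scale/= /logi.
by field.
Qed.

Lemma logi_smooth : smooth3 logi (fun x => logi x * (1 - logi x))
  (fun x => logi x * (1 - logi x) * (1 - 2 * logi x)) 2.
Proof.
have := @taylor_smooth3 logi (fun x => logi x * (1 - logi x))
  (fun x => logi x * (1 - logi x) * (1 - 2 * logi x))
  (fun x => logi x * (1 - logi x) * (1 - 6 * logi x + 6 * logi x ^+ 2)) 1.
rewrite mulr1; apply.
- exact: is_derive_logi.
- move=> x; have h := is_derive_logi x; apply: trigger_derive.
  by rewrite /GRing.scale/=; ring.
- move=> x; have h := is_derive_logi x; apply: trigger_derive.
  by rewrite /GRing.scale/=; ring.
- by move=> x; have /andP[/ltW -> /ltW ->] := logi_bounds x.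
- by move=> x; have /andP[] := logi_bounds x; set s := logi x => ? ?; rewrite ler_norml; nra.
- move=> x; have /andP[] := logi_bounds x; set s := logi x => ? ?; rewrite normrM.
  have h1 : `|s * (1 - s)| <= 1 by rewrite ler_norml; nra.
  have h2 : `|1 - 2 * s| <= 1 by rewrite ler_norml; lra.
  by rewrite -[leRHS]mulr1 ler_pM.
- move=> x; have /andP[] := logi_bounds x; set s := logi x => ? ?; rewrite normrM.
  have h1 : `|s * (1 - s)| <= 1 by rewrite ler_norml; nra.
  have h2 : `|1 - 6 * s + 6 * s ^+ 2| <= 1 by rewrite ler_norml; nra.
  by rewrite -[leRHS]mulr1 ler_pM.
Qed.

(* A smooth nonincreasing approximation of the indicator of [x <= tau]. *)
Definition step (tau e x : R) : R := logi ((tau - x) / e).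

(** Three derivatives cost [e^-3], which dominates the lower powers because [e <= 1]. The constant
    is free of [tau], so one threshold serves all levels. *)
Lemma step_smooth tau e : 0 < e <= 1 ->
  exists dG ddG, smooth3 (step tau e) dG ddG (2 / e ^+ 3).
Proof.
move=> /andP[e0 e1]; have [r l t1 dl t2] := logi_smooth.
pose dG x := - e^-1 * (logi ((tau - x) / e) * (1 - logi ((tau - x) / e))).
pose ddG x := e^-1 ^+ 2 * (logi ((tau - x) / e) * (1 - logi ((tau - x) / e)) * (1 - 2 * logi ((tau - x) / e))).
exists dG, ddG.
have i1 : 1 <= e^-1 by rewrite invf_ge1.
have E z a : (tau - (z + a)) / e = (tau - z) / e + (- (a / e)) by field; rewrite gt_eqF.
have i0 : 0 <= e^-1 by lra.
have i4 : e^-1 <= e^-1 ^+ 2 by rewrite expr2 ler_peMl//; lra.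
have i2 : 1 <= e^-1 ^+ 2 by lra.
have i3 : e^-1 ^+ 2 <= e^-1 ^+ 3 by rewrite (exprS _ 2) ler_peMl ?sqr_ge0.
have ni : `|e^-1| = e^-1 by rewrite ger0_norm.
rewrite -exprVn; split.
- by move=> z; exact: r.
- move=> z a; rewrite /step E; apply: le_trans (l _ _) _.
  rewrite normrN normrM ni; have := normr_ge0 a => ?.
  by rewrite [`|a| * _]mulrC mulrA ler_wpM2r// ler_wpM2l//; lra.
- move=> z a; rewrite /step /dG E.
  have := t1 ((tau - z) / e) (- (a / e)).
  rewrite (_ : - e^-1 * _ * a = logi ((tau - z) / e) * (1 - logi ((tau - z) / e)) * - (a / e)); last ring.
  move=> /le_trans; apply; rewrite sqrrN exprMn.
  by rewrite [a ^+ 2 * _]mulrC mulrA ler_wpM2r ?sqr_ge0// ler_wpM2l//; lra.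
- move=> z a; rewrite /dG E -mulrBr normrM normrN ni.
  apply: le_trans (ler_wpM2l i0 (dl _ _)) _.
  rewrite normrN normrM ni; have := normr_ge0 a => ?.
  have -> : e^-1 * (2 * (`|a| * e^-1)) = 2 * e^-1 ^+ 2 * `|a| by ring.
  by rewrite ler_wpM2r// ler_wpM2l//; lra.
- move=> z a; rewrite /step /dG /ddG E.
  have := t2 ((tau - z) / e) (- (a / e)).
  rewrite (_ : - e^-1 * _ * a = logi ((tau - z) / e) * (1 - logi ((tau - z) / e)) * - (a / e)); last ring.
  rewrite (_ : e^-1 ^+ 2 * _ / 2 * a ^+ 2 = logi ((tau - z) / e) * (1 - logi ((tau - z) / e)) * (1 - 2 * logi ((tau - z) / e)) / 2 * (- (a / e)) ^+ 2); last ring.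
  move=> /le_trans; apply; rewrite psiN -mulrA ler_wpM2l//.
  by rewrite [a / e]mulrC psi_scale.
Qed.

End Calculus.

(** * Anticoncentration of the squared norm *)

Section Anticoncentration.
Context {R : realType} {p : nat}.
Local Notation V := 'rV[R]_p.
Local Notation law := (seq (R * V)).
Implicit Types (l : law) (v w x : V).

(** The squared modulus of the mean of [exp (i j x)] over [j < N]: the Fejer kernel, normalised to 1
    at the origin. *)
Definition fej (N : nat) (x : R) : R :=
  (N%:R^-1 * \sum_(j < N) cos (j%:R * x)) ^+ 2 +
  (N%:R^-1 * \sum_(j < N) sin (j%:R * x)) ^+ 2.

Lemma fejE N (x : R) : fej N x =
  N%:R ^- 2 * \sum_(j < N) \sum_(k < N) cos ((j%:R - k%:R) * x).
Proof.
rewrite /fej !exprMn -mulrDr exprVn; congr (_ * _).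
rewrite !expr2 !mulr_suml -big_split; apply: eq_bigr => j _ /=.
rewrite !mulr_sumr -big_split; apply: eq_bigr => k _ /=.
by rewrite mulrBl cosB.
Qed.

Lemma fej_ge0 N (x : R) : 0 <= fej N x.
Proof. by rewrite addr_ge0 ?sqr_ge0. Qed.

Lemma fej_lb N (x : R) : (0 < N)%N -> N%:R * `|x| <= 1 -> 1 / 4 <= fej N x.
Proof.
move=> N0 Nx; have N1 : 0 < N%:R :> R by rewrite ltr0n.
have H : 1 / 2 <= N%:R^-1 * \sum_(j < N) cos (j%:R * x).
  rewrite ler_pdivlMl//.
  have -> : N%:R * (1 / 2) = \sum_(j < N) (1 / 2) :> R.
    by rewrite sumr_const card_ord mulr_natl.
  apply: ler_sum => -[j jN] _ /=.
  apply: le_trans (cos_ge _).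
  have h : `|j%:R * x| <= 1.
    rewrite normrM ger0_norm//; apply: le_trans Nx; rewrite ler_wpM2r//.
    by rewrite ler_nat ltnW.
  have : (j%:R * x) ^+ 2 <= 1.
    by rewrite -[_ ^+ 2]real_normK ?num_real// expr_le1.
  lra.
rewrite /fej; have := sqr_ge0 (N%:R^-1 * \sum_(j < N) sin (j%:R * x)).
have : (1 / 2) ^+ 2 <= (N%:R^-1 * \sum_(j < N) cos (j%:R * x)) ^+ 2 :> R.
  by rewrite ler_pXn2r ?nnegrE//; lra.
by rewrite (_ : (1 / 2) ^+ 2 = 1 / 4); [lra | field].
Qed.

(** The law of the difference of two independent copies, whose characteristic function is real. *)
Definition symm l := lconv l (scl (-1) l).

Lemma Ex_symm l f : Ex (symm l) f = Ex l (fun a => Ex l (fun b => f (a - b))).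
Proof.
rewrite Ex_lconv; apply: eq_Ex => a; rewrite Ex_scl.
by apply: eq_Ex => b; rewrite scaleN1r.
Qed.

Lemma Ex_cpow_symm k l f :
  Ex (cpow k (symm l)) f = Ex (cpow k l) (fun a => Ex (cpow k l) (fun b => f (a - b))).
Proof.
elim: k f => [|k ih] f; first by rewrite !Ex_cpow0 subr0.
rewrite Ex_cpowS Ex_symm [RHS]Ex_cpowS; apply: eq_Ex => a.
transitivity (Ex l (fun b => Ex (cpow k l) (fun c => Ex (cpow k l) (fun d => f (a - b + (c - d)))))).
  by apply: eq_Ex => b; rewrite ih.
rewrite Ex_exch; apply: eq_Ex => c; rewrite Ex_cpowS.
by apply: eq_Ex => b; apply: eq_Ex => d; rewrite opprD addrACA.
Qed.

Lemma law_symm l : is_law l -> is_law (symm l).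
Proof. by move=> hl; apply: law_lconv => //; exact: law_scl. Qed.

Lemma sg2_symm l v : is_law l -> centered l -> sg2 (symm l) v = 2 * sg2 l v.
Proof.
move=> hl cl; rewrite sg2_lconv//; last exact: law_scl.
by rewrite sg2_scl; ring.
Qed.

Lemma centered_symm l : is_law l -> centered l -> centered (symm l).
Proof.
by move=> hl cl; apply: centered_lconv => //; [exact: law_scl | exact: centered_scl].
Qed.

Lemma psi_symm k l v : is_law l ->
  Ex (cpow k (symm l)) (fun x => psi (dotv x v)) <= 16 * Ex (cpow k l) (fun x => psi (dotv x v)).
Proof.
move=> hl; have hk := law_cpow k hl; rewrite Ex_cpow_symm.
have -> : 16 * Ex (cpow k l) (fun x => psi (dotv x v)) =
  Ex (cpow k l) (fun a => Ex (cpow k l) (fun b => 8 * (psi (dotv a v) + psi (dotv b v)))).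
  under [RHS]eq_Ex => a do rewrite ExZ ExD Ex_cst//.
  by rewrite [RHS]ExZ ExD Ex_cst//; ring.
apply: le_Ex => // a; apply: le_Ex => // b.
by rewrite dotvDl dotvNl -[psi (dotv b v)]psiN; exact: psiD.
Qed.

Lemma Ex_sin_symm l v : Ex (symm l) (fun x => sin (dotv x v)) = 0.
Proof.
have h : Ex (symm l) (fun x => sin (dotv x v)) = - Ex (symm l) (fun x => sin (dotv x v)).
  rewrite !Ex_symm {1}Ex_exch -ExN; apply: eq_Ex => a; rewrite -ExN; apply: eq_Ex => b.
  by rewrite -sinN -dotvNl opprB.
lra.
Qed.

(** The sine means vanish by symmetry, so the cosine mean alone is multiplicative. *)
Lemma Ex_cos_cpow k l v :
  Ex (cpow k (symm l)) (fun x => cos (dotv x v)) = (Ex (symm l) (fun x => cos (dotv x v))) ^+ k.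
Proof.
elim: k => [|k ih]; first by rewrite Ex_cpow0 dotv0l cos0 expr0.
rewrite Ex_cpowS exprS -ih -ExZr.
set c := Ex (cpow k (symm l)) (fun x => cos (dotv x v)).
set s := Ex (cpow k (symm l)) (fun x => sin (dotv x v)).
transitivity (Ex (symm l) (fun x => cos (dotv x v) * c - sin (dotv x v) * s)).
  apply: eq_Ex => x; rewrite -!ExZ -ExB; apply: eq_Ex => y.
  by rewrite dotvDl cosD.
by rewrite ExB !ExZr Ex_sin_symm mul0r subr0.
Qed.

(** The right-hand side is [|E exp (i be)|^2]; the left-hand side is the squared real part of
    [exp (i al) E exp (i be)]. *)
Lemma Ex_cos_sqr l (al : R) (be : V -> R) : is_law l ->
  (Ex l (fun s => cos (al + be s))) ^+ 2 <=
  Ex l (fun s => Ex l (fun s' => cos (be s - be s'))).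
Proof.
move=> hl.
set c := Ex l (fun s => cos (be s)); set s := Ex l (fun s => sin (be s)).
have -> : Ex l (fun s => cos (al + be s)) = cos al * c - sin al * s.
  rewrite -!ExZ -ExB; apply: eq_Ex => x; exact: cosD.
have -> : Ex l (fun s => Ex l (fun s' => cos (be s - be s'))) = c ^+ 2 + s ^+ 2.
  rewrite !expr2 -!ExZr -ExD; apply: eq_Ex => x; rewrite -!ExZ -ExD.
  by apply: eq_Ex => y; rewrite cosB.
have h := cos2Dsin2 al; have := sqr_ge0 (cos al * s + sin al * c).
have : (cos al * c - sin al * s) ^+ 2 + (cos al * s + sin al * c) ^+ 2 =
  (cos al ^+ 2 + sin al ^+ 2) * (c ^+ 2 + s ^+ 2) by ring.
rewrite h mul1r; lra.
Qed.

(* Two Cauchy-Schwarz steps decouple the quadratic phase into a bilinear one. *)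
Lemma decoupling a b l (th tau : R) : is_law l ->
  (Ex (cpow (a + b) l) (fun s => cos (th * sqnorm s - tau))) ^+ 4 <=
  Ex (cpow b (symm l)) (fun v => Ex (cpow a (symm l)) (fun u => cos (2 * th * dotv u v))).
Proof.
move=> hl; have ha := law_cpow a hl; have hb := law_cpow b hl.
rewrite Ex_cpowD.
(* For fixed [x] the square is opened in [y], which cancels [|x|^2]. *)
have h1 : (Ex (cpow a l) (fun x => Ex (cpow b l) (fun y => cos (th * sqnorm (x + y) - tau)))) ^+ 2
   <= Ex (cpow b l) (fun y => Ex (cpow b l) (fun y' => Ex (cpow a l) (fun x =>
       cos (th * (sqnorm y - sqnorm y') + 2 * th * dotv x (y - y'))))).
  apply: le_trans (Ex_sqr _ ha) _.
  under [leRHS]eq_Ex do rewrite Ex_exch.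
  rewrite [leRHS]Ex_exch; apply: le_Ex => // x.
  have := @Ex_cos_sqr _ (- tau) (fun y => th * sqnorm (x + y)) hb.
  under eq_Ex do rewrite addrC.
  move=> /le_trans; apply; apply/eq_ler/eq_Ex => y; apply/eq_Ex => y'.
  by congr cos; rewrite !sqnormD dotvDr dotvNr; ring.
rewrite (exprM _ 2 2); apply: le_trans (_ : (Ex (cpow b l) (fun y => Ex (cpow b l) (fun y' => Ex (cpow a l) (fun x =>
       cos (th * (sqnorm y - sqnorm y') + 2 * th * dotv x (y - y')))))) ^+ 2 <= _).
  by rewrite ler_pXn2r ?nnegrE ?sqr_ge0//; apply: le_trans h1; rewrite sqr_ge0.
apply: le_trans (Ex_sqr _ hb) _; rewrite Ex_cpow_symm; apply: le_Ex => // y.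
apply: le_trans (Ex_sqr _ hb) _; apply: le_Ex => // y'.
(* The second opening, in [x], sees the terms in [|y|^2] and [|y'|^2] as a constant phase and
   removes them. *)
apply: le_trans (Ex_cos_sqr _ _ ha) _.
rewrite Ex_cpow_symm; apply/eq_ler/eq_Ex => x; apply/eq_Ex => x'.
by rewrite -mulrBr -dotvNl -dotvDl.
Qed.

(** For [e < y < 1], [c <= 1 - (y - e) <= 1 / (1 + (y - e))], and Bernoulli's inequality bounds the
    power by [1 / (1 + k (y - e))]. The summand [y] covers [y >= 1], where [c] may be negative, and
    [k e] covers [y <= e]. *)
Lemma pow_bound (c y e : R) (k : nat) : -1 <= c <= 1 -> 0 <= y -> 0 <= e ->
  1 - y <= c <= 1 - y + e -> c ^+ k <= (1 + k%:R * y)^-1 + k%:R * e + y.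
Proof.
move=> /andP[cm1 c1] y0 e0 /andP[cl cu].
have k0 : 0 <= k%:R :> R by [].
have ky := mulr_ge0 k0 y0; have ke := mulr_ge0 k0 e0.
have ck : c ^+ k <= 1.
  apply: le_trans (ler_norm _) _; rewrite normrX exprn_ile1//.
  by rewrite ler_norml cm1.
have i0 : 0 <= (1 + k%:R * y)^-1 by rewrite invr_ge0; lra.
case: (leP 1 y) => y1; first lra.
have c0 : 0 <= c by lra.
have i1 : 1 - k%:R * y <= (1 + k%:R * y)^-1.
  rewrite -[leRHS]mul1r ler_pdivlMr; last lra.
  have := sqr_ge0 (k%:R * y); lra.
case: (leP y e) => ye.
  have : k%:R * y <= k%:R * e by rewrite ler_wpM2l.
  lra.
have t0 : 0 < y - e by lra.
have B n : 1 + n%:R * (y - e) <= (1 + (y - e)) ^+ n.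
  elim: n => [|n ih]; first by rewrite mul0r addr0 expr0.
  rewrite exprS; apply: le_trans (_ : (1 + (y - e)) * (1 + n%:R * (y - e)) <= _).
    rewrite -(natr1 n); have : 0 <= n%:R * (y - e) ^+ 2 by rewrite mulr_ge0 ?sqr_ge0.
    lra.
  by rewrite ler_wpM2l//; lra.
have cb : c ^+ k <= (1 + k%:R * (y - e))^-1.
  have kt : 0 <= k%:R * (y - e) by rewrite mulr_ge0// ltW.
  rewrite -[leRHS]mul1r ler_pdivlMr; last lra.
  apply: le_trans (_ : c ^+ k * (1 + (y - e)) ^+ k <= _).
    by rewrite ler_wpM2l ?exprn_ge0.
  rewrite -exprMn exprn_ile1//; first by rewrite mulr_ge0//; lra.
  nra.
have : (1 + k%:R * (y - e))^-1 <= (1 + k%:R * y)^-1 + k%:R * e.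
  have kt : 0 <= k%:R * (y - e) by rewrite mulr_ge0// ltW.
  rewrite -[leLHS]mul1r ler_pdivrMr; last lra.
  set A := k%:R * y in ky i0 i1 *; set B' := k%:R * e in ke *.
  have -> : k%:R * (y - e) = A - B' by rewrite mulrBr.
  have kt' : 0 <= A - B' by rewrite /A /B' -mulrBr.
  have -> : ((1 + A)^-1 + B') * (1 + (A - B')) = 1 + B' * (1 + (A - B') - (1 + A)^-1).
    by field; lra.
  have : (1 + A)^-1 <= 1 by rewrite invf_le1//; lra.
  move=> ?; have : 0 <= B' * (1 + (A - B') - (1 + A)^-1) by rewrite mulr_ge0//; lra.
  lra.
lra.
Qed.

(** The cosine mean of the symmetrised law lies between [1 - sg2 l v] and the same plus a Lyapunov
    error: symmetrising doubles the variance and cancels the 1/2 of the expansion. Then [pow_bound]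
    gives the decay in [k]. *)
Lemma charfun_bound k l v : is_law l -> centered l ->
  Ex (cpow k (symm l)) (fun u => cos (dotv u v)) <=
  (1 + k%:R * sg2 l v)^-1 + 16 * k%:R * Ex l (fun x => psi (dotv x v)) + sg2 l v.
Proof.
move=> hl cl; have hs := law_symm hl.
set e := Ex (symm l) (fun x => psi (dotv x v)).
have he : e <= 16 * Ex l (fun x => psi (dotv x v)).
  by have := @psi_symm 1 l v hl; rewrite !Ex_cpow1.
have e0 : 0 <= e by apply: Ex_ge0 => // x; exact: psi_ge0.
rewrite Ex_cos_cpow; apply: le_trans (@pow_bound _ (sg2 l v) e k _ _ e0 _) _.
- apply/andP; split; last by apply: Ex_le_cst => // x; exact: cos_le1.
  by rewrite -(Ex_cst (-1) hs); apply: le_Ex => // x; exact: cos_geN1.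
- exact: sg2_ge0.
- have hy : Ex (symm l) (fun x => 1 - dotv x v ^+ 2 / 2) = 1 - sg2 l v.
    by rewrite ExB Ex_cst// ExZr -/(sg2 (symm l) v) sg2_symm//; field.
  apply/andP; split.
    by rewrite -hy; apply: le_Ex => // x; exact: cos_ge.
  by rewrite -hy -ExD; apply: le_Ex => // x; exact: cos_le.
rewrite lerD2r lerD2l [16 * _]mulrC -mulrA ler_wpM2l//.
Qed.

Lemma Ex_fej l N (r : R) (be : V -> R) :
  Ex l (fun u => fej N (r * be u)) =
  N%:R ^- 2 * \sum_(j < N) \sum_(k < N) Ex l (fun u => cos ((j%:R - k%:R) * r * be u)).
Proof.
under eq_Ex do rewrite fejE.
rewrite ExZ Ex_sum; congr (_ * _); apply: eq_bigr => j _.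
rewrite Ex_sum; apply: eq_bigr => k _; apply: eq_Ex => u; by rewrite mulrA.
Qed.

Lemma avg_diag N (b : 'I_N -> 'I_N -> R) (B : R) : (0 < N)%N -> 0 <= B ->
  (forall j k, b j k <= (j == k)%:R + B) ->
  N%:R ^- 2 * (\sum_(j < N) \sum_(k < N) b j k) <= N%:R^-1 + B.
Proof.
move=> N0 B0 hb; have N1 : 0 < N%:R :> R by rewrite ltr0n.
have : \sum_(j < N) \sum_(k < N) b j k <= \sum_(j < N) \sum_(k < N) ((j == k)%:R + B).
  by apply: ler_sum => j _; apply: ler_sum => k _.
have -> : \sum_(j < N) \sum_(k < N) ((j == k)%:R + B) = N%:R + N%:R ^+ 2 * B.
  under eq_bigr => j _.
    rewrite big_split/= sumr_const card_ord (bigD1 j)//= eqxx big1 ?addr0; last first.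
      by move=> i; rewrite eq_sym => /negPf ->.
    over.
  by rewrite big_split/= !sumr_const card_ord -mulr_natr -[X in _ + X]mulr_natr; ring.
move=> h; apply: le_trans (ler_wpM2l _ h) _; first by rewrite invr_ge0 sqr_ge0.
by apply: eq_ler; field; rewrite gt_eqF.
Qed.

(** The off-diagonal frequencies [(i - j) r] have modulus between [r] and [r N]: the lower end
    drives the decay, the upper end enters the errors. The diagonal contributes [N^-1]. *)
Lemma fej_symm_bound k l v N (r : nat) : is_law l -> centered l -> (0 < N)%N -> (0 < r)%N ->
  Ex (cpow k (symm l)) (fun u => fej N (r%:R * dotv u v)) <=
  N%:R^-1 + ((1 + r%:R ^+ 2 * (k%:R * sg2 l v))^-1
   + 16 * k%:R * ((r * N)%:R ^+ 3 * Ex l (fun x => psi (dotv x v)))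
   + (r * N)%:R ^+ 2 * sg2 l v).
Proof.
move=> hl cl N0 r0; have s0 := sg2_ge0 v hl.
have P0 : 0 <= Ex l (fun x => psi (dotv x v)) by apply: Ex_ge0 => // x; exact: psi_ge0.
have i0 : 0 <= (1 + r%:R ^+ 2 * (k%:R * sg2 l v))^-1.
  by rewrite invr_ge0 addr_ge0// !mulr_ge0 ?exprn_ge0.
have p0 n : 0 <= (r * N)%:R ^+ n :> R by rewrite exprn_ge0.
rewrite Ex_fej; apply: avg_diag => //.
  by rewrite !addr_ge0// ?mulr_ge0// ?mulr_ge0.
move=> i j; case: eqP => [->|/eqP ij].
  rewrite subrr; apply: le_trans (_ : 1 <= _).
    by apply: Ex_le_cst => [|u]; [exact/law_cpow/law_symm | exact: cos_le1].
  by rewrite lerDl !addr_ge0// ?mulr_ge0// ?mulr_ge0.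
rewrite add0r; set d := (i%:R - j%:R) * r%:R.
have d1 : 1 <= `|i%:R - j%:R| :> R.
  move: ij; rewrite neq_ltn => /orP[] h.
    rewrite distrC -natrB ?(ltnW h)// ger0_norm// ler1n subn_gt0//.
  by rewrite -natrB ?(ltnW h)// ger0_norm// ler1n subn_gt0.
have dN : `|i%:R - j%:R| <= N%:R :> R.
  have hi : i%:R <= N%:R :> R by rewrite ler_nat ltnW.
  have hj : j%:R <= N%:R :> R by rewrite ler_nat ltnW.
  have := ler0n R i; have := ler0n R j; rewrite ler_norml; lra.
have nd : `|d| = `|i%:R - j%:R| * r%:R by rewrite normrM [`|r%:R|]ger0_norm.
have dr : r%:R <= `|d| by rewrite nd ler_peMl.
have drN : `|d| <= (r * N)%:R by rewrite nd natrM mulrC ler_wpM2l.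
have d2 : d ^+ 2 = `|d| ^+ 2 by rewrite real_normK// num_real.
have -> : Ex (cpow k (symm l)) (fun u => cos (d * dotv u v)) =
    Ex (cpow k (symm l)) (fun u => cos (dotv u (d *: v))).
  by apply: eq_Ex => u; rewrite dotvZr.
apply: le_trans (charfun_bound _ _ hl cl) _; rewrite sg2Z !lerD//.
- have q1 : 0 <= r%:R ^+ 2 * (k%:R * sg2 l v) by rewrite mulr_ge0 ?exprn_ge0// mulr_ge0.
  have q2 : r%:R ^+ 2 * (k%:R * sg2 l v) <= k%:R * (d ^+ 2 * sg2 l v).
    rewrite mulrCA ler_wpM2l// ler_wpM2r// d2 ler_pXn2r ?nnegrE//.
  by rewrite lef_pV2 ?posrE ?lerD2l//; lra.
- rewrite ler_wpM2l ?mulr_ge0// -ExZ; apply: le_Ex => // x.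
  apply: le_trans (psi_scale _ _); last by rewrite ler1n muln_gt0 r0.
  apply: le_psi; rewrite dotvZr [leLHS]normrM [leRHS]normrM ler_wpM2r//.
  by rewrite [leRHS]ger0_norm.
- by rewrite ler_wpM2r// d2 ler_pXn2r ?nnegrE.
Qed.

(* The conditional variance of the bilinear form must not be small; this is reduced by Markov's
   inequality to a second application of the Fejer kernel to an independent sum. *)
Lemma smallball k b l (N r : nat) : model l -> (0 < N)%N -> (0 < r)%N -> (0 < k)%N ->
  (b <= k)%N -> (k <= 2 * b)%N ->
  Ex (cpow b (symm l)) (fun v => (4 * (r * N)%:R ^+ 2 * sg2 l v < k%:R)%R%:R) <=
  16 * (N%:R^-1 + ((1 + r%:R ^+ 2 / 2)^-1 + 96 * (r * N)%:R ^+ 3 * (lyap1 l k%:R + lyap2 l k%:R)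
     + (r * N)%:R ^+ 2 / k%:R)).
Proof.
move=> hm N0 r0 k0 bk kb; have [hl cl h1] := hm.
have hw := law_cpow k hl; have hv : is_law (cpow b (symm l)) by exact/law_cpow/law_symm.
have k1 : 0 < k%:R :> R by rewrite ltr0n.
have rN1 : 1 <= (r * N)%:R :> R by rewrite ler1n muln_gt0 r0.
have rN0 : 0 < (r * N)%:R :> R by lra.
(* [w] is an auxiliary sum of [k] copies, and [w'] normalises it so that [sg2 l (w' w) = 1 / k]. The
   weight [sg2 l w / k] has mean 1, of which the [w] that are not good carry at most 1/2. *)
pose good w := k%:R <= 2 * sg2 l w.
pose w' w := (Num.sqrt (k%:R * sg2 l w))^-1 *: w.
pose wt w := sg2 l w / k%:R * (good w)%:R.
have s0 w := sg2_ge0 w hl.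
have wt0 w : 0 <= wt w by rewrite !mulr_ge0 ?invr_ge0.
have Ewt : Ex (cpow k l) (fun w => sg2 l w / k%:R) = 1.
  by rewrite ExZr mean_sg2_cpow// divff// gt_eqF.
have pt v : (4 * (r * N)%:R ^+ 2 * sg2 l v < k%:R)%R%:R <=
    16 * Ex (cpow k l) (fun w => wt w * fej N (r%:R * dotv v (w' w))).
  case: ltP => hv'; last first.
    by rewrite mulr_ge0//; apply: Ex_ge0 => // w; rewrite mulr_ge0 ?fej_ge0.
  (* A Markov term: on [good w], [Q w >= sg2 l w / k] whenever [v . w'] leaves the window of the
     kernel, while its mean is at most 1/4 when [sg2 l v] is small. Thus [1 - 1/2 - 1/4] is at most
     4 times the weighted kernel mean, which gives the factor 16. *)
  pose Q w := (r * N)%:R ^+ 2 * (dotv v w ^+ 2) / k%:R ^+ 2.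
  have key w : sg2 l w / k%:R - 1 / 2 - Q w <= 4 * (wt w * fej N (r%:R * dotv v (w' w))).
    have Q0 : 0 <= Q w by apply: divr_ge0; [apply: mulr_ge0|]; exact: sqr_ge0.
    have t0 : 0 <= 4 * (wt w * fej N (r%:R * dotv v (w' w))).
      by rewrite !mulr_ge0 ?fej_ge0.
    case: (boolP (good w)) => gw; last first.
      move: gw; rewrite /good -ltNge => gw.
      have : sg2 l w / k%:R <= 1 / 2 by rewrite ler_pdivrMr//; lra.
      lra.
    have sw : 0 < sg2 l w by move: gw; rewrite /good; lra.
    case: (leP ((r * N)%:R * `|dotv v (w' w)|) 1) => h.
      have hf : 1 / 4 <= fej N (r%:R * dotv v (w' w)).
        apply: fej_lb => //; apply: le_trans h.
        by rewrite normrM [`|r%:R|]ger0_norm// natrM mulrA [N%:R * _]mulrC.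
      rewrite /wt gw mulr1.
      have : 0 <= sg2 l w / k%:R by rewrite mulr_ge0// invr_ge0 ltW.
      nra.
    have : sg2 l w / k%:R <= Q w; last lra.
    have h2 : 1 <= (r * N)%:R ^+ 2 * (dotv v (w' w)) ^+ 2.
      rewrite -[dotv _ _ ^+ 2]real_normK ?num_real// -exprMn.
      by rewrite -[leLHS](expr1n _ 2) ler_pXn2r ?nnegrE//; lra.
    move: h2; rewrite /w' dotvZr exprMn exprVn sqr_sqrtr ?mulr_ge0//.
    rewrite mulrCA mulrC ler_pdivlMr ?mulr_gt0// mul1r => h2.
    rewrite /Q ler_pdivlMr ?exprn_gt0//.
    by have -> : sg2 l w / k%:R * k%:R ^+ 2 = k%:R * sg2 l w by field; rewrite gt_eqF.
  have := le_Ex hw key; rewrite !ExB ExZ Ewt Ex_cst//.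
  have -> : Ex (cpow k l) Q = (r * N)%:R ^+ 2 * sg2 l v / k%:R.
    rewrite /Q; transitivity (Ex (cpow k l) (fun w => (r * N)%:R ^+ 2 / k%:R ^+ 2 * dotv w v ^+ 2)).
      by apply: eq_Ex => w; rewrite dotvC; ring.
    by rewrite ExZ -/(sg2 _ _) sg2_cpow//; field; rewrite gt_eqF.
  have : (r * N)%:R ^+ 2 * sg2 l v / k%:R <= 1 / 4 by rewrite ler_pdivrMr//; lra.
  rewrite mulr1n; lra.
apply: le_trans (le_Ex hv pt) _; rewrite ExZ ler_wpM2l// Ex_exch.
have Epsi : k%:R * Ex (cpow k l) (fun w => Ex l (fun x => psi (dotv x w / k%:R))) <=
    3 * (lyap1 l k%:R + lyap2 l k%:R).
  apply: le_trans (@psi_pair _ _ k l k%:R hl cl k1 (lexx _)).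
  rewrite Ex_exch ler_wpM2l//.
  by apply/eq_ler/eq_Ex => x; apply: eq_Ex => s; rewrite dotvC.
pose bd w := (sg2 l w / k%:R) * (N%:R^-1 + (1 + r%:R ^+ 2 / 2)^-1 + (r * N)%:R ^+ 2 / k%:R)
   + 32 * (r * N)%:R ^+ 3 * (k%:R * Ex l (fun x => psi (dotv x w / k%:R))).
apply: (@le_trans _ _ (Ex (cpow k l) bd)); last first.
  rewrite /bd ExD ExZr Ewt !ExZ.
  have c0 : 0 <= 32 * (r * N)%:R ^+ 3 :> R by rewrite mulr_ge0// exprn_ge0.
  have := ler_wpM2l c0 Epsi.
  set E := Ex _ _; set L := lyap1 _ _ + _; set C := (r * N)%:R ^+ 3; lra.
apply: le_Ex => // w; rewrite ExZ.
have Y0 : 0 <= Ex l (fun x => psi (dotv x w / k%:R)) by apply: Ex_ge0 => // x; exact: psi_ge0.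
have sk0 : 0 <= sg2 l w / k%:R by rewrite mulr_ge0// invr_ge0 ltW.
case: (boolP (good w)) => gw; last first.
  have B0 : 0 <= N%:R^-1 :> R by rewrite invr_ge0.
  have B1 : 0 <= (1 + r%:R ^+ 2 / 2)^-1 :> R by rewrite invr_ge0 addr_ge0// divr_ge0// exprn_ge0.
  have B2 : 0 <= (r * N)%:R ^+ 2 / k%:R :> R by rewrite divr_ge0 ?exprn_ge0.
  have B3 : 0 <= 32 * (r * N)%:R ^+ 3 * (k%:R * Ex l (fun x => psi (dotv x w / k%:R))).
    by rewrite mulr_ge0 ?mulr_ge0// exprn_ge0.
  rewrite /wt (negbTE gw) mulr0 mul0r /bd; apply: addr_ge0 => //; apply: mulr_ge0 => //.
have sw : 0 < sg2 l w by move: gw; rewrite /good; lra.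
rewrite /wt gw mulr1.
apply: le_trans (ler_wpM2l sk0 (fej_symm_bound b (w' w) hl cl N0 r0)) _.
have sw' : sg2 l (w' w) = k%:R^-1.
  rewrite sg2Z exprVn sqr_sqrtr ?mulr_ge0 ?ltW//; field.
  by rewrite !gt_eqF.
rewrite sw' /bd.
have hI : (1 + r%:R ^+ 2 * (b%:R * k%:R^-1))^-1 <= (1 + r%:R ^+ 2 / 2)^-1 :> R.
  have q1 : 0 <= r%:R ^+ 2 / 2 :> R by rewrite divr_ge0 ?exprn_ge0.
  have q2 : r%:R ^+ 2 / 2 <= r%:R ^+ 2 * (b%:R * k%:R^-1) :> R.
    rewrite ler_wpM2l ?exprn_ge0// ler_pdivlMr// mulrC ler_pdivrMr// mulrC.
    by rewrite -natrM ler_nat.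
  by rewrite lef_pV2 ?posrE ?lerD2l//; lra.
have {}hI := ler_wpM2l sk0 hI.
(* The weight cancels the normalisation of [w'] in the square; inside [cut1] a factor [g^-1 <= 2]
   remains. *)
have hP : sg2 l w / k%:R * Ex l (fun x => psi (dotv x (w' w))) <=
    2 * Ex l (fun x => psi (dotv x w / k%:R)).
  rewrite -!ExZ; apply: le_Ex => // x.
  set g := Num.sqrt (sg2 l w / k%:R).
  have g2 : g ^+ 2 = sg2 l w / k%:R by rewrite sqr_sqrtr.
  have g0 : 0 < g by rewrite sqrtr_gt0 divr_gt0.
  have eg : Num.sqrt (k%:R * sg2 l w) = k%:R * g.
    have -> : k%:R * sg2 l w = k%:R ^+ 2 * (sg2 l w / k%:R) by field; rewrite gt_eqF.
    by rewrite sqrtrM ?sqr_ge0// sqrtr_sqr ger0_norm.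
  have g12 : g^-1 <= 2.
    rewrite invf_ple ?posrE//.
    have : (1/2) ^+ 2 <= g ^+ 2.
      rewrite g2 ler_pdivlMr//; move: gw; rewrite /good (_ : (1 / 2) ^+ 2 = 1 / 4 :> R); last by field.
      by have := k1; lra.
    by rewrite ler_pXn2r ?nnegrE ?(ltW g0)//; lra.
  rewrite -g2 /psi /w' dotvZr eg.
  have -> : (k%:R * g)^-1 * dotv x w = g^-1 * (dotv x w / k%:R) by field; rewrite !gt_eqF.
  set u := dotv x w / k%:R.
  have -> (c : R) : g ^+ 2 * ((g^-1 * u) ^+ 2 * c) = u ^+ 2 * c by field; rewrite gt_eqF.
  rewrite [leRHS]mulrCA ler_wpM2l ?sqr_ge0//.
  apply: le_trans (cut1_scale _ _); last lra.
  by rewrite le_cut1// !normrM ler_wpM2r// !ger0_norm// ?invr_ge0 ltW.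
have bk' : b%:R <= k%:R :> R by rewrite ler_nat.
set Y := Ex l (fun x => psi (dotv x w / k%:R)) in Y0 hP *.
set Z := Ex l (fun x => psi (dotv x (w' w))) in hP *.
set C3 := (r * N)%:R ^+ 3.
have hZ : 16 * C3 * (b%:R * (sg2 l w / k%:R * Z)) <= 16 * C3 * (k%:R * (2 * Y)).
  rewrite ler_wpM2l ?mulr_ge0 ?exprn_ge0//.
  apply: le_trans (ler_wpM2l (ler0n _ _) hP) _.
  by rewrite ler_wpM2r// mulr_ge0.
set s := sg2 l w / k%:R in hI hZ sk0 *.
set I1 := (1 + _)^-1 in hI *; set I2 := (1 + _)^-1 in hI *.
have -> : s * (N%:R^-1 + (I1 + 16 * b%:R * (C3 * Z) + (r * N)%:R ^+ 2 / k%:R)) =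
  s * N%:R^-1 + s * I1 + 16 * C3 * (b%:R * (s * Z)) + s * ((r * N)%:R ^+ 2 / k%:R) by ring.
have -> : s * (N%:R^-1 + I2 + (r * N)%:R ^+ 2 / k%:R) + 32 * C3 * (k%:R * Y) =
  s * N%:R^-1 + s * I2 + 16 * C3 * (k%:R * (2 * Y)) + s * ((r * N)%:R ^+ 2 / k%:R) by ring.
by rewrite lerD2r; apply: lerD => //; rewrite lerD2l.
Qed.

End Anticoncentration.

Section Anticoncentration2.
Context {R : realType} {p : nat}.
Local Notation V := 'rV[R]_p.
Local Notation law := (seq (R * V)).
Implicit Types (l : law) (v w x : V).

Lemma avg_sqr N (a : 'I_N -> R) : (0 < N)%N ->
  (N%:R^-1 * \sum_(i < N) a i) ^+ 2 <= N%:R^-1 * \sum_(i < N) a i ^+ 2.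
Proof.
move=> N0; have N1 : 0 < N%:R :> R by rewrite ltr0n.
set S := \sum_(i < N) a i.
have : 0 <= \sum_(i < N) (a i - N%:R^-1 * S) ^+ 2 by apply: sumr_ge0 => i _; exact: sqr_ge0.
have -> : \sum_(i < N) (a i - N%:R^-1 * S) ^+ 2 =
  \sum_(i < N) a i ^+ 2 - N%:R * (N%:R^-1 * S) ^+ 2.
  have -> : \sum_(i < N) (a i - N%:R^-1 * S) ^+ 2 =
     \sum_(i < N) (a i ^+ 2 + (- 2 * (N%:R^-1 * S) * a i + (N%:R^-1 * S) ^+ 2)).
    by apply: eq_bigr => i _; ring.
  rewrite !big_split/= -mulr_sumr -/S sumr_const card_ord -[X in _ + (_ + X)]mulr_natl.
  by field; rewrite gt_eqF.
rewrite subr_ge0 => h; rewrite ler_pdivlMl//.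
Qed.

Lemma avg2_pow4 N (a : 'I_N -> 'I_N -> R) : (0 < N)%N ->
  (N%:R ^- 2 * \sum_(i < N) \sum_(j < N) a i j) ^+ 4 <=
  N%:R ^- 2 * \sum_(i < N) \sum_(j < N) a i j ^+ 4.
Proof.
move=> N0; have N1 : 0 < N%:R :> R by rewrite ltr0n.
have i0 : 0 <= N%:R^-1 :> R by rewrite invr_ge0 ltW.
have E (b : 'I_N -> 'I_N -> R) : N%:R ^- 2 * \sum_(i < N) \sum_(j < N) b i j =
   N%:R^-1 * \sum_(i < N) (N%:R^-1 * \sum_(j < N) b i j).
  by rewrite -mulr_sumr mulrA -exprVn.
have sq (b : 'I_N -> 'I_N -> R) : (N%:R ^- 2 * \sum_(i < N) \sum_(j < N) b i j) ^+ 2 <=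
   N%:R ^- 2 * \sum_(i < N) \sum_(j < N) b i j ^+ 2.
  rewrite !E; apply: le_trans (avg_sqr _ N0) _; rewrite ler_wpM2l//.
  by apply: ler_sum => i _; exact: avg_sqr.
rewrite (exprM _ 2 2); apply: le_trans (_ : (N%:R ^- 2 * \sum_(i < N) \sum_(j < N) a i j ^+ 2) ^+ 2 <= _).
  rewrite ler_pXn2r ?nnegrE ?sqr_ge0//.
  by rewrite mulr_ge0 ?invr_ge0 ?sqr_ge0// !sumr_ge0// => i _; rewrite sumr_ge0// => j _; exact: sqr_ge0.
apply: le_trans (sq _) _.
by apply/eq_ler; congr (_ * _); apply: eq_bigr => i _; apply: eq_bigr => j _; rewrite -exprM.
Qed.

(** The sum is cut into two halves and decoupled. Given the second half [v], the kernel at scale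
    [M^3] is at most [2 / M] up to errors unless [sg2 l v < k / (4 M^4)], an event bounded by
    [smallball] with [N = r = M]. Hence [34 = 1 + 1 + 16 * 2] and [7680 = 128 * 48 + 16 * 96], while
    [M^12] is the cube of [M^3 * M]. *)
Lemma fej_qstat_bound k M l (tau : R) : model l -> (0 < M)%N -> (1 < k)%N ->
  (Ex (cpow k l) (fun s => fej M ((M ^ 3)%:R * (sqnorm s / k%:R - tau)))) ^+ 4 <=
  34 / M%:R + 7680 * M%:R ^+ 12 * (lyap1 l k%:R + lyap2 l k%:R + k%:R^-1).
Proof.
move=> hm M0 k1; have [hl cl h1] := hm.
have k0 : 0 < k%:R :> R by rewrite ltr0n ltnW.
have M1 : 1 <= M%:R :> R by rewrite ler1n.
have M0' : 0 < M%:R :> R by lra.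
pose a := k./2; pose b := (k - a)%N.
have ab : (a + b = k)%N by rewrite subnKC// /a -divn2 leq_div.
have ak : (a <= k)%N by rewrite -ab leq_addr.
have bk : (b <= k)%N by rewrite -ab leq_addl.
have k2b : (k <= 2 * b)%N.
  have := odd_double_half k; rewrite -/a => ek; rewrite /b -{1}ek -muln2 -ek.
  by case: (odd k) => /=; rewrite ?add0n ?add1n; lia.
have k4a : (k <= 4 * a)%N.
  by have := odd_double_half k; rewrite -/a -muln2; case: (odd k) => /=; lia.
have hu := law_cpow a (law_symm hl); have hv := law_cpow b (law_symm hl).
pose r := (M ^ 3)%N; have r0 : (0 < r)%N by rewrite expn_gt0 M0.
pose c := 2 / k%:R : R.
have L0 : 0 <= lyap1 l k%:R + lyap2 l k%:R by rewrite addr_ge0 ?lyap1_ge0 ?lyap2_ge0.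
have P0 v : 0 <= Ex l (fun x => psi (dotv x v)) by apply: Ex_ge0 => // x; exact: psi_ge0.
rewrite Ex_fej; apply: le_trans (avg2_pow4 _ M0) _.
apply: (@le_trans _ _ (Ex (cpow b (symm l)) (fun v => Ex (cpow a (symm l))
    (fun u => fej M (r%:R * dotv u (c *: v)))))).
  under [leRHS]eq_Ex do rewrite Ex_fej.
  rewrite ExZ ler_wpM2l ?invr_ge0 ?sqr_ge0// Ex_sum; apply: ler_sum => i _.
  rewrite Ex_sum; apply: ler_sum => j _.
  have := @decoupling _ _ a b l ((i%:R - j%:R) * r%:R / k%:R) ((i%:R - j%:R) * r%:R * tau) hl.
  rewrite ab => h; apply: le_trans (le_trans _ h) _.
    apply: eq_ler; congr (_ ^+ 4); apply: eq_Ex => s; congr cos; rewrite -/r; ring.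
  apply/eq_ler/eq_Ex => v; apply/eq_Ex => u; congr cos; rewrite dotvZr /c; ring.
apply: (@le_trans _ _ (Ex (cpow b (symm l)) (fun v =>
   M%:R^-1 + ((4 * (M * M)%:R ^+ 2 * sg2 l v < k%:R)%R%:R + M%:R^-1
    + 128 * (r * M)%:R ^+ 3 * (k%:R * Ex l (fun x => psi (dotv x v / k%:R)))
    + 4 * (r * M)%:R ^+ 2 / k%:R ^+ 2 * sg2 l v)))).
  apply: le_Ex => // v.
  apply: le_trans (fej_symm_bound a (c *: v) hl cl M0 r0) _.
  rewrite lerD2l; apply: lerD; first apply: lerD.
  - have s0 := sg2_ge0 v hl.
    have q0 : 0 <= r%:R ^+ 2 * (a%:R * sg2 l (c *: v)) by rewrite mulr_ge0 ?exprn_ge0// mulr_ge0// sg2_ge0.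
    have i0 : 0 <= M%:R^-1 :> R by rewrite invr_ge0 ltW.
    have i1 : (1 + r%:R ^+ 2 * (a%:R * sg2 l (c *: v)))^-1 <= 1 by rewrite invf_le1; lra.
    case: ltP => hs; first by rewrite mulr1n; lra.
    rewrite mulr0n add0r lef_pV2 ?posrE//; last lra.
    have M40 : 0 < (M * M)%:R ^+ 2 :> R by rewrite exprn_gt0// ltr0n muln_gt0 M0.
    have h3 : k%:R^-1 * sg2 l v <= a%:R * sg2 l (c *: v).
      rewrite sg2Z mulrA ler_wpM2r// /c.
      have -> : a%:R * (2 / k%:R) ^+ 2 = 4 * a%:R / k%:R ^+ 2 :> R by field; rewrite gt_eqF.
      rewrite ler_pdivlMr ?exprn_gt0// expr2 mulrA mulVf ?gt_eqF// mul1r -natrM ler_nat//.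
    have h4 : 1 <= 4 * (M * M)%:R ^+ 2 * (k%:R^-1 * sg2 l v).
      by rewrite mulrCA ler_pdivlMl// mulr1.
    (* Scale [M^3] against the threshold scale [M^2] leaves a factor [M^2 / 4], and
       [1 + M^2 / 4 >= M]. *)
    have h5 : 1 / 4 * M%:R ^+ 2 <= r%:R ^+ 2 * (k%:R^-1 * sg2 l v).
      have -> : r%:R ^+ 2 = M%:R ^+ 2 * (M * M)%:R ^+ 2 :> R.
        by rewrite /r natrX natrM; ring.
      have h4' : 1 / 4 <= (M * M)%:R ^+ 2 * (k%:R^-1 * sg2 l v) by lra.
      have := ler_wpM2l (sqr_ge0 (M%:R : R)) h4'; lra.
    have h6 := ler_wpM2l (exprn_ge0 2 (ler0n R r)) h3.
    have := sqr_ge0 (M%:R / 2 - 1 : R); lra.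
  - have hP : Ex l (fun x => psi (dotv x (c *: v))) <= 8 * Ex l (fun x => psi (dotv x v / k%:R)).
      rewrite -ExZ; apply: le_Ex => // x; rewrite dotvZr /c.
      have -> : 2 / k%:R * dotv x v = 2 * (dotv x v / k%:R) by ring.
      exact: psi2.
    set Y := Ex _ _ in hP *; set Z := Ex _ _ in hP *.
    have Z0 : 0 <= Z by apply: Ex_ge0 => // x; exact: psi_ge0.
    have -> : 16 * a%:R * ((r * M)%:R ^+ 3 * Y) = 16 * (r * M)%:R ^+ 3 * (a%:R * Y) by ring.
    have -> : 128 * (r * M)%:R ^+ 3 * (k%:R * Z) = 16 * (r * M)%:R ^+ 3 * (k%:R * (8 * Z)) by ring.
    rewrite ler_wpM2l ?mulr_ge0 ?exprn_ge0//.
    apply: le_trans (ler_wpM2l (ler0n _ _) hP) _.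
    by rewrite ler_wpM2r ?mulr_ge0// ler_nat.
  - by rewrite sg2Z /c; apply: eq_ler; field; rewrite gt_eqF.
rewrite !ExD !ExZ !Ex_cst//.
have hS := smallball hm M0 M0 (ltnW k1) bk k2b.
have hQ : Ex (cpow b (symm l)) (sg2 l) <= 2 * k%:R.
  rewrite Ex_sg2C; apply: (@le_trans _ _ (Ex l (fun x => 2 * k%:R * sg2 l x))); last first.
    by rewrite ExZ h1 mulr1.
  apply: le_Ex => // x; rewrite sg2_cpow; [|exact: law_symm|exact: centered_symm].
  by rewrite sg2_symm// mulrA ler_wpM2r ?sg2_ge0// mulrC ler_wpM2l// ler_nat.
have hP : k%:R * Ex (cpow b (symm l)) (fun v => Ex l (fun x => psi (dotv x v / k%:R))) <=
    48 * (lyap1 l k%:R + lyap2 l k%:R).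
  have bk' : b%:R <= k%:R :> R by rewrite ler_nat.
  have := @psi_pair _ _ b l k%:R hl cl k0 bk'.
  suff : Ex (cpow b (symm l)) (fun v => Ex l (fun x => psi (dotv x v / k%:R))) <=
    16 * Ex l (fun x => Ex (cpow b l) (fun s => psi (dotv s x / k%:R))).
    move=> h h'; apply: le_trans (ler_wpM2l (ltW k0) h) _.
    set E := Ex l _ in h' *; set L := lyap1 _ _ + _ in h' *; lra.
  rewrite Ex_exch -ExZ; apply: le_Ex => // x.
  apply: le_trans (le_trans (psi_symm b (k%:R^-1 *: x) hl) _).
    by apply/eq_ler/eq_Ex => s; rewrite dotvZr dotvC mulrC.
  by rewrite ler_wpM2l//; apply/eq_ler/eq_Ex => s; rewrite dotvZr mulrC.
have hM2 : (1 + M%:R ^+ 2 / 2)^-1 <= M%:R^-1 :> R.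
  have := sqr_ge0 (M%:R : R); have := sqr_ge0 (M%:R - 1 : R) => h1m h2m; rewrite lef_pV2 ?posrE//; lra.
have rM : (r * M)%:R = M%:R ^+ 4 :> R by rewrite /r natrM natrX; ring.
have MM : (M * M)%:R = M%:R ^+ 2 :> R by rewrite natrM; ring.
move: hS; rewrite rM MM; set I := Ex _ (fun v => _%:R) => hS.
have q1 : 128 * (M%:R ^+ 4) ^+ 3 * (k%:R * Ex (cpow b (symm l)) (fun v => Ex l (fun x => psi (dotv x v / k%:R)))) <=
   128 * (M%:R ^+ 4) ^+ 3 * (48 * (lyap1 l k%:R + lyap2 l k%:R)).
  by rewrite ler_wpM2l// mulr_ge0 ?exprn_ge0.
have q2 : 4 * (M%:R ^+ 4) ^+ 2 / k%:R ^+ 2 * Ex (cpow b (symm l)) (sg2 l) <=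
    8 * (M%:R ^+ 8) * k%:R^-1.
  apply: le_trans (_ : 4 * (M%:R ^+ 4) ^+ 2 / k%:R ^+ 2 * (2 * k%:R) <= _).
    by rewrite ler_wpM2l// divr_ge0 ?mulr_ge0 ?exprn_ge0.
  by apply: eq_ler; field; rewrite gt_eqF.
have q3 : 96 * (M%:R ^+ 2) ^+ 3 * (lyap1 l k%:R + lyap2 l k%:R) <= 96 * M%:R ^+ 12 * (lyap1 l k%:R + lyap2 l k%:R).
  by rewrite ler_wpM2r// ler_wpM2l// -exprM ler_weXn2l.
have q4 : (M%:R ^+ 2) ^+ 2 / k%:R <= M%:R ^+ 12 / k%:R :> R.
  by rewrite ler_wpM2r ?invr_ge0 ?(ltW k0)// -exprM ler_weXn2l.
have q5 : M%:R ^+ 8 / k%:R <= M%:R ^+ 12 / k%:R :> R.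
  by rewrite ler_wpM2r ?invr_ge0 ?(ltW k0)// ler_weXn2l.
have e12 : (M%:R ^+ 4) ^+ 3 = M%:R ^+ 12 :> R by rewrite -exprM.
rewrite e12 in q1 *.
have q6 : 0 <= M%:R ^+ 12 * k%:R^-1 :> R by rewrite mulr_ge0 ?exprn_ge0// invr_ge0 ltW.
have q7 : 0 <= M%:R ^+ 12 * (lyap1 l k%:R + lyap2 l k%:R) by rewrite mulr_ge0 ?exprn_ge0.
move: hS q1 q2 q3 q4 q5 q6 q7 hM2.
set E1 := Ex _ _; set E2 := Ex _ _; set L := lyap1 _ _ + _.
set M12 := M%:R ^+ 12; set M8 := M%:R ^+ 8; set M42 := (M%:R ^+ 4) ^+ 2.
set M6 := (M%:R ^+ 2) ^+ 3; set M22 := (M%:R ^+ 2) ^+ 2; set J := (1 + _)^-1.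
lra.
Qed.

End Anticoncentration2.

(** Fixes the constant before the dimension and the law, so that the thresholds derived from it are
    uniform in both. *)
Lemma fej_qstat_bound_ex (R : realType) : exists2 C : R, 0 < C &
  forall p k M (l : seq (R * 'rV[R]_p)) (tau : R), model l -> (0 < M)%N -> (1 < k)%N ->
  (Ex (cpow k l) (fun s => fej M ((M ^ 3)%:R * (sqnorm s / k%:R - tau)))) ^+ 4 <=
  34 / M%:R + C * M%:R ^+ 12 * (lyap1 l k%:R + lyap2 l k%:R + k%:R^-1).
Proof. by exists 7680; [rewrite ltr0n | move=> p; exact: fej_qstat_bound]. Qed.

(* [4 fej M (M^3 (x - tau))] dominates the indicator of [|x - tau| <= M^-4], so this bounds the
   concentration function of [|S_k|^2 / k]; the constants do not depend on the dimension. *)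
Lemma anticonc (R : realType) (eta : R) : 0 < eta -> exists M : nat, exists2 th : R, (0 < M)%N /\ 0 < th &
  forall p (l : seq (R * 'rV[R]_p)) k tau, model l -> theta l k%:R < th -> (0 < k)%N ->
  Ex (cpow k l) (fun s => fej M ((M ^ 3)%:R * (sqnorm s / k%:R - tau))) <= eta.
Proof.
move=> e0; have [C C0 HC] := fej_qstat_bound_ex R.
have e4 : 0 < eta ^+ 4 by rewrite exprn_gt0.
pose M := (Num.truncn (68 / eta ^+ 4)).+1.
have hM : 68 / eta ^+ 4 < M%:R by exact: truncnS_gt.
have M0 : 0 < M%:R :> R by rewrite ltr0n.
have M12 : 0 < M%:R ^+ 12 :> R by rewrite exprn_gt0.
(* The value 1/2 forces [k > 1] through the summand [k^-1] of [theta]; the other value leaves half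
   of [eta^4] to the Lyapunov terms, [M] having taken the first half. *)
exists M, (Num.min (1 / 2) (eta ^+ 4 / (2 * C * M%:R ^+ 12))).
  split; [by [] | rewrite lt_min divr_gt0//=].
  by rewrite divr_gt0// !mulr_gt0.
move=> p l k tau hm; rewrite lt_min => /andP[t1 t2] k0.
have [hl cl h1] := hm; have k0' : 0 < k%:R :> R by rewrite ltr0n.
have v0 : 0 <= var_sq l / k%:R by rewrite divr_ge0 ?var_sq_ge0.
have k1 : (1 < k)%N.
  have : k%:R^-1 < 1 / 2 :> R.
    apply: le_lt_trans t1; rewrite /theta lerDr !addr_ge0 ?lyap1_ge0 ?lyap2_ge0//.
  rewrite div1r ltf_pV2 ?posrE// => h.
  by rewrite -(ltr_nat R) (lt_trans _ h)// ltr1n.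
have := HC p k M l tau hm (ltn0Sn _ : (0 < M)%N) k1.
set F := Ex _ _ => hF.
have F0 : 0 <= F by apply: Ex_ge0 => [|s]; [exact: law_cpow | exact: fej_ge0].
rewrite -(ler_pXn2r (ltn0Sn 3)) ?nnegrE ?(ltW e0)//; apply: le_trans hF _.
have h34 : 34 / M%:R <= eta ^+ 4 / 2.
  rewrite ler_pdivrMr//; move: hM; rewrite ltr_pdivrMr//; lra.
have : C * M%:R ^+ 12 * (lyap1 l k%:R + lyap2 l k%:R + k%:R^-1) <= eta ^+ 4 / 2.
  move: t2; rewrite ltr_pdivlMr ?mulr_gt0// ?mulr_gt0// => t2.
  have : (lyap1 l k%:R + lyap2 l k%:R + k%:R^-1) * (2 * C * M%:R ^+ 12) <= theta l k%:R * (2 * C * M%:R ^+ 12).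
    rewrite ler_wpM2r ?mulr_ge0 ?(ltW M12) ?(ltW C0)// /theta; lra.
  lra.
lra.
Qed.

(** * Products of finite laws *)

Section Sample.
Context {R : realType} {p : nat} {I : finType}.
Local Notation V := 'rV[R]_p.
Variables (w : I -> R) (z : I -> V).

Definition cell_law : seq (R * V) := [seq (w i, z i) | i <- enum I].

Definition En n (F : ('I_n -> V) -> R) : R :=
  \sum_(b : {ffun 'I_n -> I}) (\prod_i w (b i)) * F (fun i => z (b i)).

Lemma Ex_cell f : Ex cell_law f = \sum_i w i * f (z i).
Proof. by rewrite /Ex /cell_law big_map big_enum. Qed.

Definition fcons n (i : I) (b : {ffun 'I_n -> I}) : {ffun 'I_n.+1 -> I} :=
  [ffun j => if unlift ord0 j is Some k then b k else i].

Lemma fcons0 n i (b : {ffun 'I_n -> I}) : fcons i b ord0 = i.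
Proof. by rewrite ffunE unlift_none. Qed.

Lemma fconsS n i (b : {ffun 'I_n -> I}) k : fcons i b (lift ord0 k) = b k.
Proof. by rewrite ffunE liftK. Qed.

Lemma sum_ffunS n (G : {ffun 'I_n.+1 -> I} -> R) :
  \sum_b G b = \sum_i \sum_b G (fcons i b).
Proof.
rewrite pair_big/= (reindex (fun q : I * {ffun 'I_n -> I} => fcons q.1 q.2))//=.
exists (fun b => (b ord0, [ffun k => b (lift ord0 k)])) => [[i b] _|b _] /=.
  congr (_, _); first exact: fcons0.
  by apply/ffunP => k; rewrite ffunE fconsS.
apply/ffunP => j; case: (unliftP ord0 j) => [k ->|->]; last by rewrite fcons0.
by rewrite fconsS ffunE.
Qed.

Lemma En0 (F : ('I_0 -> V) -> R) x : (forall y, F y = F x) -> En F = F x.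
Proof.
move=> h; rewrite /En (eq_bigr (fun=> F x)); last first.
  by move=> b _; rewrite big_ord0 mul1r.
by rewrite sumr_const card_ffun card_ord expn0 mulr1n.
Qed.

Lemma EnS n (F : ('I_n.+1 -> V) -> R) (F' : V -> ('I_n -> V) -> R) :
  (forall x, F x = F' (x ord0) (fun k => x (lift ord0 k))) ->
  En F = Ex cell_law (fun y => En (F' y)).
Proof.
move=> h; rewrite /En sum_ffunS Ex_cell; apply: eq_bigr => i _.
rewrite mulr_sumr; apply: eq_bigr => b _.
rewrite big_ord_recl fcons0 h fcons0 mulrA; congr (_ * F' _ _).
  by congr (_ * _); apply: eq_bigr => k _; rewrite fconsS.
by apply/funext => k; rewrite fconsS.
Qed.

Hypothesis hl : is_law cell_law.

Lemma eq_En n (F G : ('I_n -> V) -> R) : (forall x, F x = G x) -> En F = En G.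
Proof. by move=> h; apply: eq_bigr => b _; rewrite h. Qed.

Lemma w_ge0 i : 0 <= w i.
Proof. by have [h _] := hl; apply: (h (w i, z i)); apply: map_f; rewrite mem_enum. Qed.

Lemma le_En n (F G : ('I_n -> V) -> R) : (forall x, F x <= G x) -> En F <= En G.
Proof.
move=> h; apply: ler_sum => b _; rewrite ler_wpM2l//.
by apply: prodr_ge0 => i _; exact: w_ge0.
Qed.

Lemma EnD n (F G : ('I_n -> V) -> R) : En (fun x => F x + G x) = En F + En G.
Proof. by rewrite /En -big_split; apply: eq_bigr => b _; rewrite mulrDr. Qed.

(** Induction on the sample size: the first draw belongs to at most one of the two families and is
    absorbed into the corresponding power. Boolean predicates restrict to the remaining indices by
    mere composition with [lift]. *)
Lemma marginal_aux n (al be : 'I_n -> bool) (phi : V -> V -> R) :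
  (forall i, ~~ (al i && be i)) ->
  En (fun x => phi (\sum_(i < n | al i) x i) (\sum_(i < n | be i) x i)) =
  Ex (cpow #|al| cell_law) (fun s =>
    Ex (cpow #|be| cell_law) (fun s' => phi s s')).
Proof.
have card0 m (a : 'I_m.+1 -> bool) : #|a| = (a ord0 + #|(fun i => a (lift ord0 i))|)%N.
  rewrite -!sum1_card.
  by rewrite big_mkcond [X in (_ + X)%N]big_mkcond big_ord_recl -!topredE/=; case: (a ord0).
elim: n al be phi => [|n ih] al be phi dj.
  rewrite (@En0 _ (fun=> 0)); last by move=> y; rewrite !big_ord0.
  have E (a : 'I_0 -> bool) : #|a| = 0%N by apply: eq_card0 => -[].
  by rewrite !E !Ex_cpow0 !big_ord0.
pose al' i := al (lift ord0 i); pose be' i := be (lift ord0 i).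
rewrite (@EnS _ _ (fun y x => phi ((if al ord0 then y else 0) + \sum_(i < n | al' i) x i)
    ((if be ord0 then y else 0) + \sum_(i < n | be' i) x i))); last first.
  by move=> x; congr (phi _ _); rewrite big_mkcond big_ord_recl -big_mkcond.
under eq_Ex => y do rewrite (ih al' be' (fun s s' => phi ((if al ord0 then y else 0) + s) ((if be ord0 then y else 0) + s')) (fun i => dj _)).
rewrite !card0 -/al' -/be'.
have := dj ord0; case: (al ord0); case: (be ord0) => //= _.
- rewrite Ex_cpowS; apply: eq_Ex => y; apply: eq_Ex => s.
  by apply: eq_Ex => s'; rewrite add0r.
- rewrite Ex_exch; apply: eq_Ex => s; rewrite Ex_cpowS.
  by apply: eq_Ex => y; apply: eq_Ex => s'; rewrite add0r.
- rewrite Ex_cst//; apply: eq_Ex => s; apply: eq_Ex => s'.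
  by rewrite !add0r.
Qed.

Lemma marginal n (a c : {set 'I_n}) (phi : V -> V -> R) :
  (forall i, ~~ ((i \in a) && (i \in c))) ->
  En (fun x => phi (\sum_(i in a) x i) (\sum_(i in c) x i)) =
  Ex (cpow #|a| cell_law) (fun s => Ex (cpow #|c| cell_law) (fun s' => phi s s')).
Proof.
move=> dj; by rewrite (@marginal_aux n (fun i => i \in a) (fun i => i \in c) phi dj).
Qed.

End Sample.

(** * Mean-square comparison of quadratic statistics *)

Section Comparison.
Context {R : realType} {p : nat}.
Local Notation V := 'rV[R]_p.
Local Notation law := (seq (R * V)).
Implicit Types (l : law).

Lemma sqr3 (a b c : R) : (a + b + c) ^+ 2 <= 3 * (a ^+ 2 + b ^+ 2 + c ^+ 2).
Proof.
have := sqr_ge0 (a - b); have := sqr_ge0 (b - c); have := sqr_ge0 (a - c); nra.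
Qed.

Lemma abs_le_sqr (x lam : R) : 0 < lam -> `|x| <= lam + x ^+ 2 / lam.
Proof.
move=> l0; rewrite -subr_ge0 -[x ^+ 2]real_normK ?num_real//.
have -> : lam + `|x| ^+ 2 / lam - `|x| = ((`|x| - lam) ^+ 2 + lam * `|x|) / lam.
  by field; rewrite gt_eqF.
by rewrite divr_ge0 ?(ltW l0)// addr_ge0 ?sqr_ge0// mulr_ge0 ?(ltW l0).
Qed.

Definition qc l k (s : V) : R := sqnorm s - k%:R * mean_sq l.

Lemma var_qc k l : model l ->
  Ex (cpow k l) (fun s => qc l k s ^+ 2) <= k%:R * (var_sq l + 2 * k%:R).
Proof.
move=> hm; rewrite var_cpow//; have := ler0n R k.
have -> : k%:R * (var_sq l + 2 * k%:R) = k%:R * var_sq l + 2 * (k%:R ^+ 2 - k%:R) + 2 * k%:R by ring.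
lra.
Qed.

(** The differences of statistics met below are combinations of two centred squared norms and one
    inner product of independent sums; the three second moments are explicit, and the factor 3
    accounts for the cross terms. *)
Lemma L2_indep i j l (al be ga : R) : model l ->
  Ex (cpow i l) (fun s => Ex (cpow j l) (fun s' =>
    (al * qc l i s + be * qc l j s' + ga * dotv s s') ^+ 2)) <=
  3 * (al ^+ 2 * (i%:R * (var_sq l + 2 * i%:R)) + be ^+ 2 * (j%:R * (var_sq l + 2 * j%:R))
       + ga ^+ 2 * (i%:R * j%:R)).
Proof.
move=> hm; have [hl cl h1] := hm; have hi := law_cpow i hl; have hj := law_cpow j hl.
apply: (@le_trans _ _ (Ex (cpow i l) (fun s => Ex (cpow j l) (fun s' =>
   3 * (al ^+ 2 * qc l i s ^+ 2 + be ^+ 2 * qc l j s' ^+ 2 + ga ^+ 2 * dotv s s' ^+ 2))))).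
  by apply: le_Ex => // s; apply: le_Ex => // s'; rewrite -!exprMn; exact: sqr3.
under eq_Ex => s.
  rewrite ExZ ExD ExD Ex_cst// ExZ ExZ.
  under [X in ga ^+ 2 * X]eq_Ex do rewrite dotvC.
  rewrite -/(sg2 (cpow j l) s); over.
rewrite ExZ ler_wpM2l// !ExD Ex_cst// !ExZ lerD//; last first.
  rewrite ler_wpM2l ?sqr_ge0// Ex_sg2C.
  under eq_Ex do rewrite sg2_cpow//.
  by rewrite ExZ mean_sg2_cpow.
by rewrite lerD// ler_wpM2l ?sqr_ge0// var_qc.
Qed.

Variables (G dG ddG : R -> R) (C : R).
Hypothesis hG : smooth3 G dG ddG C.

(** [|x| <= lam + x^2 / lam] turns a second moment into a first one, so no square root of the bound
    appears. *)
Lemma lip_L2 l l' (u v : V -> V -> R) (lam B : R) : is_law l -> is_law l' -> 0 < lam ->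
  Ex l (fun s => Ex l' (fun s' => (u s s' - v s s') ^+ 2)) <= B ->
  Ex l (fun s => Ex l' (fun s' => `|G (u s s') - G (v s s')|)) <= C * (lam + B / lam).
Proof.
move=> hl hl' l0 hB; have C0 := smooth3_C hG.
apply: (@le_trans _ _ (Ex l (fun s => Ex l' (fun s' => C * (lam + (u s s' - v s s') ^+ 2 / lam))))).
  apply: le_Ex => // s; apply: le_Ex => // s'.
  have := smooth3_lip hG (v s s') (u s s' - v s s'); rewrite (addrC (v s s')) subrK.
  by move=> /le_trans; apply; rewrite ler_wpM2l// abs_le_sqr.
under eq_Ex do rewrite ExZ ExD Ex_cst// ExZr.
rewrite ExZ ExD Ex_cst// ExZr ler_wpM2l// lerD2l ler_wpM2r// invr_ge0; exact: ltW.
Qed.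

(* Passing from the full sample to its first [k = m * (n / m)] elements. *)
Lemma drop_rest l (k r m : nat) (lam : R) : model l -> (0 < m)%N -> (r <= m)%N -> (m <= k)%N ->
  var_sq l / m%:R <= 1 -> 0 < lam ->
  `|Ex (cpow (k + r) l) (fun s => G (sqnorm s / (k + r)%:R)) -
    Ex (cpow k l) (fun s => G (sqnorm s / k%:R))|
  <= C * (lam + 30 * (m%:R / (k + r)%:R) / lam).
Proof.
move=> hm m0 rm mk hK l0; have [hl cl h1] := hm.
have hk := law_cpow k hl; have hr := law_cpow r hl.
have k0 : (0 < k)%N by apply: leq_trans m0 mk.
have k0' : 0 < k%:R :> R by rewrite ltr0n.
have m0' : 0 < m%:R :> R by rewrite ltr0n.
have n0 : 0 < (k + r)%:R :> R by rewrite ltr0n addn_gt0 k0.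
set n : R := (k + r)%:R in n0 *.
have K0 := var_sq_ge0 hl.
have en : n = k%:R + r%:R by rewrite /n natrD.
have r0 : 0 <= r%:R :> R by [].
have rm' : r%:R <= m%:R :> R by rewrite ler_nat.
have mk' : m%:R <= k%:R :> R by rewrite ler_nat.
rewrite Ex_cpowD.
have -> : Ex (cpow k l) (fun s => G (sqnorm s / k%:R)) =
   Ex (cpow k l) (fun s => Ex (cpow r l) (fun=> G (sqnorm s / k%:R))).
  by apply: eq_Ex => s; rewrite Ex_cst.
rewrite -ExB; apply: le_trans (Ex_norm _ hk) _.
apply: (@le_trans _ _ (Ex (cpow k l) (fun s => Ex (cpow r l) (fun s' =>
   `|G (sqnorm (s + s') / n) - G (sqnorm s / k%:R)|)))).
  by apply: le_Ex => // s; rewrite -ExB; exact: Ex_norm.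
apply: lip_L2 => //.
(* The mean squared norm is proportional to the number of summands and cancels, which leaves centred
   terms; the three coefficients give [30 = 3 * (3 + 3 + 4)]. *)
have E s s' : sqnorm (s + s') / n - sqnorm s / k%:R =
   (- (r%:R / n / k%:R)) * qc l k s + n^-1 * qc l r s' + 2 / n * dotv s s'.
  rewrite sqnormD /qc en; field; by rewrite -en !gt_eqF.
under eq_Ex do under eq_Ex do rewrite E.
apply: le_trans (L2_indep _ _ _ _ _ hm) _.
set t := m%:R / n.
have K1 : var_sq l <= k%:R by move: hK; rewrite ler_pdivrMr// mul1r => /le_trans; exact.
have rt : r%:R / n <= t by rewrite ler_wpM2r// invr_ge0 ltW.
have rn0 : 0 <= r%:R / n by rewrite divr_ge0// ltW.
have rn1 : r%:R / n <= 1 by rewrite ler_pdivrMr// mul1r en lerDr ltW.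
have k1' : k%:R != 0 :> R by rewrite gt_eqF.
have n1' : k%:R + r%:R != 0 :> R by rewrite -en gt_eqF.
have kn1 : k%:R / n <= 1 by rewrite ler_pdivrMr// mul1r en lerDl.
have kn0 : 0 <= k%:R / n by rewrite divr_ge0// ltW.
have Kn : var_sq l / n <= 1 by rewrite ler_pdivrMr// mul1r en; lra.
have Kk : var_sq l / k%:R <= 1 by rewrite ler_pdivrMr// mul1r.
have -> : (- (r%:R / n / k%:R)) ^+ 2 * (k%:R * (var_sq l + 2 * k%:R)) =
   (r%:R / n) * (r%:R / n) * (var_sq l / k%:R + 2) by field; rewrite k1' n1'.
have -> : n^-1 ^+ 2 * (r%:R * (var_sq l + 2 * r%:R)) =
   (r%:R / n) * (var_sq l / n + 2 * (r%:R / n)) by field; rewrite ?k1' n1'.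
have -> : (2 / n) ^+ 2 * (k%:R * r%:R) = 4 * (k%:R / n) * (r%:R / n) by field; rewrite ?k1' n1'.
set x := r%:R / n in rt rn0 rn1 *.
have a1 : x * x * (var_sq l / k%:R + 2) <= x * 3.
  rewrite -mulrA ler_wpM2l//; apply: le_trans (_ : 1 * (var_sq l / k%:R + 2) <= _); last lra.
  by rewrite ler_wpM2r// addr_ge0// divr_ge0.
have a2 : x * (var_sq l / n + 2 * x) <= x * 3 by rewrite ler_wpM2l//; lra.
have a3 : 4 * (k%:R / n) * x <= 4 * x by rewrite ler_wpM2r//; lra.
lra.
Qed.

(** The statistic of a subset of size [m] through its sum [s] and the sum [s'] of the complement,
    after expanding the recentring by the full mean and dividing by [1 - m / n]. *)
Definition Rstat2 (m n : nat) (s s' : V) : R :=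
  (1 - m%:R / n%:R) * (sqnorm s / m%:R) + m%:R / n%:R * (sqnorm s' / (n%:R - m%:R))
  - 2 / n%:R * dotv s s'.

(** The divisor [1 - m / n] is exactly what makes the means of the two statistics agree, so only
    centred terms remain, of order [m / n] in mean square. *)
Lemma recentre l (n m : nat) (lam : R) : model l -> (0 < m)%N -> (2 * m <= n)%N ->
  var_sq l / m%:R <= 1 -> 0 < lam ->
  Ex (cpow m l) (fun s => Ex (cpow (n - m) l) (fun s' =>
    `|G (Rstat2 m n s s') - G (sqnorm s / m%:R)|)) <=
  C * (lam + 30 * (m%:R / n%:R) / lam).
Proof.
move=> hm m0 mn hK l0; have [hl cl h1] := hm.
have hk := law_cpow m hl; have hr := law_cpow (n - m) hl.
have mn' : (m <= n)%N by apply: leq_trans mn; rewrite leq_pmull.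
have n0 : 0 < n%:R :> R by rewrite ltr0n (leq_trans m0).
have m0' : 0 < m%:R :> R by rewrite ltr0n.
have K0 := var_sq_ge0 hl.
apply: lip_L2 => //.
have ej : (n - m)%:R = n%:R - m%:R :> R by rewrite natrB.
have mn2 : 2 * m%:R <= n%:R :> R by rewrite -natrM ler_nat.
have j0 : 0 < n%:R - m%:R :> R by lra.
set j : R := n%:R - m%:R in ej j0.
set t : R := m%:R / n%:R.
have en : n%:R = m%:R + j :> R by rewrite /j; ring.
have E s s' : Rstat2 m n s s' - sqnorm s / m%:R =
   (- (t / m%:R)) * qc l m s + (t / j) * qc l (n - m) s' + (- (2 / n%:R)) * dotv s s'.
  rewrite /Rstat2 /qc -/t -/j ej; field; by rewrite !gt_eqF.
under eq_Ex do under eq_Ex do rewrite E.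
apply: le_trans (L2_indep _ _ _ _ _ hm) _; rewrite ej.
have K1 : var_sq l <= m%:R by move: hK; rewrite ler_pdivrMr// mul1r.
have t0 : 0 <= t by rewrite divr_ge0// ltW.
have t1 : t <= 1 by rewrite ler_pdivrMr// mul1r; lra.
have jn1 : j / n%:R <= 1 by rewrite ler_pdivrMr// mul1r; lra.
have Kj : var_sq l / j <= 1 by rewrite ler_pdivrMr// mul1r /j; lra.
have Kj0 : 0 <= var_sq l / j by rewrite divr_ge0// ltW.
have Km0 : 0 <= var_sq l / m%:R by rewrite divr_ge0// ltW.
have -> : (- (t / m%:R)) ^+ 2 * (m%:R * (var_sq l + 2 * m%:R)) =
   t * (t * (var_sq l / m%:R + 2)) by field; rewrite !gt_eqF.
have -> : (t / j) ^+ 2 * (j * (var_sq l + 2 * j)) = t * (t * (var_sq l / j + 2)) by field; rewrite !gt_eqF.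
have -> : (- (2 / n%:R)) ^+ 2 * (m%:R * j) = t * (4 * (j / n%:R)) by rewrite /t; field; rewrite !gt_eqF.
have a1 : t * (t * (var_sq l / m%:R + 2)) <= t * 3.
  rewrite ler_wpM2l//; apply: le_trans (_ : 1 * (var_sq l / m%:R + 2) <= _); last lra.
  by rewrite ler_wpM2r// addr_ge0.
have a2 : t * (t * (var_sq l / j + 2)) <= t * 3.
  rewrite ler_wpM2l//; apply: le_trans (_ : 1 * (var_sq l / j + 2) <= _); last lra.
  by rewrite ler_wpM2r// addr_ge0.
have a3 : t * (4 * (j / n%:R)) <= t * 4 by rewrite ler_wpM2l//; lra.
lra.
Qed.

(** The overlap is replaced by its mean squared norm: this keeps the centre and makes the value
    depend on [s] only. Here [21 = 3 * (3 + 4)]. *)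
Lemma drop_overlap l (i j m : nat) (lam : R) : model l -> (0 < m)%N -> (i + j = m)%N ->
  var_sq l / m%:R <= 1 -> 0 < lam ->
  Ex (cpow i l) (fun s => Ex (cpow j l) (fun s' =>
    `|G (sqnorm (s + s') / m%:R) - G ((sqnorm s + j%:R * mean_sq l) / m%:R)|)) <=
  C * (lam + 21 * (j%:R / m%:R) / lam).
Proof.
move=> hm m0 ijm hK l0; have [hl cl h1] := hm.
have hk := law_cpow i hl; have hr := law_cpow j hl.
have m0' : 0 < m%:R :> R by rewrite ltr0n.
have K0 := var_sq_ge0 hl.
apply: lip_L2 => //.
have E s s' : sqnorm (s + s') / m%:R - (sqnorm s + j%:R * mean_sq l) / m%:R =
   0 * qc l i s + m%:R^-1 * qc l j s' + (2 / m%:R) * dotv s s'.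
  rewrite sqnormD /qc; field; by rewrite !gt_eqF.
under eq_Ex do under eq_Ex do rewrite E.
apply: le_trans (L2_indep _ _ _ _ _ hm) _.
have em : m%:R = i%:R + j%:R :> R by rewrite -natrD ijm.
have i0 : 0 <= i%:R :> R by []. have j0 : 0 <= j%:R :> R by [].
set x := j%:R / m%:R.
have x0 : 0 <= x by rewrite divr_ge0.
have x1 : x <= 1 by rewrite ler_pdivrMr// mul1r; lra.
have y1 : i%:R / m%:R <= 1 :> R by rewrite ler_pdivrMr// mul1r; lra.
have -> : m%:R^-1 ^+ 2 * (j%:R * (var_sq l + 2 * j%:R)) = x * (var_sq l / m%:R + 2 * x).
  by rewrite /x; field; rewrite gt_eqF.
have -> : (2 / m%:R) ^+ 2 * (i%:R * j%:R) = x * (4 * (i%:R / m%:R)).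
  by rewrite /x; field; rewrite gt_eqF.
have a2 : x * (var_sq l / m%:R + 2 * x) <= x * 3 by rewrite ler_wpM2l//; lra.
have a3 : x * (4 * (i%:R / m%:R)) <= x * 4 by rewrite ler_wpM2l//; lra.
lra.
Qed.

(** [lindeberg] reaches the size [m * (n %/ m)], and [drop_rest] adds the remainder, shorter than
    one block. The constant 1300 rounds up 1248. *)
Lemma lindeberg_n l (n m : nat) (lam : R) :
  model l -> (0 < m)%N -> (m <= n)%N -> var_sq l / m%:R <= 1 -> 0 < lam ->
  `|Ex (cpow m l) (fun s => G (sqnorm s / m%:R)) -
    Ex (cpow n l) (fun s => G (sqnorm s / n%:R))| <=
  C * 1300 * (lam + (1 + lam^-1) * (theta l m%:R + m%:R / n%:R)).
Proof.
move=> hm m0 mn hK l0.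
have [hl cl h1] := hm; have C0 := smooth3_C hG.
pose M := (n %/ m)%N; pose r := (n %% m)%N.
have en : (m * M + r = n)%N by rewrite mulnC -divn_eq.
have M0 : (0 < M)%N by rewrite divn_gt0.
have m0' : 0 < m%:R :> R by rewrite ltr0n.
have mk : (m <= m * M)%N by rewrite leq_pmulr.
have := @drop_rest l (m * M) r m lam hm m0 (ltnW (ltn_pmod _ m0)) mk hK l0.
rewrite en => h2; have h3 := lindeberg hG hm m0 M0 l0.
rewrite distrC in h2; apply: le_trans (ler_distD _ _ _) (le_trans (lerD h3 h2) _).
rewrite -mulrDr -[leRHS]mulrA ler_wpM2l//.
have t0 : 0 <= m%:R / n%:R :> R by rewrite divr_ge0.
have L0 := addr_ge0 (lyap1_ge0 m%:R hl) (lyap2_ge0 m%:R hl).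
have KK : 0 <= (var_sq l + 1) / m%:R by rewrite divr_ge0 ?addr_ge0 ?var_sq_ge0// ltW.
have eth : theta l m%:R = (var_sq l + 1) / m%:R + (lyap1 l m%:R + lyap2 l m%:R).
  by rewrite /theta; field; rewrite gt_eqF.
rewrite eth (_ : 2 * (var_sq l + 1) / m%:R = 2 * ((var_sq l + 1) / m%:R)); last by rewrite mulrA.
set L := lyap1 _ _ + _ in L0 *; set t := m%:R / _ in t0 *; set K := (var_sq l + 1) / _ in KK *.
have i0 : 0 <= lam^-1 by rewrite invr_ge0 ltW.
have p1 := mulr_ge0 i0 L0; have p2 := mulr_ge0 i0 t0; have p3 := mulr_ge0 i0 KK.
move: p1 p2 p3; set i := lam^-1 in i0 * => p1 p2 p3. lra.
Qed.

End Comparison.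

(** * Covariances of the statistics of two subsets *)

Section PairBound.
Context {R : realType}.

(** The factor [1 - m / n] of the threshold in the estimators is moved into the statistic. *)
Definition Rst p n (a : {set 'I_n}) (x : 'I_n -> 'rV[R]_p) : R :=
  #|a|%:R * sqnorm (#|a|%:R^-1 *: (\sum_(i in a) x i) - n%:R^-1 *: (\sum_i x i))
    / (1 - #|a|%:R / n%:R).

Lemma Rst_Rstat2 p n m (a : {set 'I_n}) (x : 'I_n -> 'rV[R]_p) :
  (0 < m)%N -> (m < n)%N -> #|a| = m ->
  Rst a x = Rstat2 m n (\sum_(i in a) x i) (\sum_(i in ~: a) x i).
Proof.
move=> m0 mn am; rewrite /Rst am.
have -> : \sum_i x i = \sum_(i in a) x i + \sum_(i in ~: a) x i.
  rewrite (bigID (fun i => i \in a))/=; congr (_ + _).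
  by apply: eq_bigl => i; rewrite finset.inE.
set s := \sum_(i in a) x i; set s' := \sum_(i in ~: a) x i.
have m1 : m%:R != 0 :> R by rewrite pnatr_eq0 -lt0n.
have n1 : n%:R != 0 :> R by rewrite pnatr_eq0 -lt0n (ltn_trans m0).
have nm : n%:R - m%:R != 0 :> R by rewrite subr_eq0 eqr_nat gtn_eqF.
have -> : m%:R^-1 *: s - n%:R^-1 *: (s + s') = (m%:R^-1 - n%:R^-1) *: s + (- n%:R^-1) *: s'.
  by rewrite scalerDr scalerBl scaleNr opprD addrA.
rewrite sqnormD !sqnormZ dotvZl dotvZr /Rstat2; field.
by rewrite m1 n1 nm.
Qed.

Lemma mul_perturb (ya yb za zb : R) : `|ya| <= 1 -> `|zb| <= 1 ->
  ya * yb <= za * zb + `|ya - za| + `|yb - zb|.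
Proof.
move=> h1 h2.
have -> : ya * yb = za * zb + zb * (ya - za) + ya * (yb - zb) by ring.
apply: lerD; last first.
  apply: le_trans (ler_norm _) _; rewrite normrM -[leRHS]mul1r ler_wpM2r//.
rewrite lerD2l; apply: le_trans (ler_norm _) _; rewrite normrM -[leRHS]mul1r ler_wpM2r//.
Qed.

Lemma range_dist (x y : R) : 0 <= x <= 1 -> 0 <= y <= 1 -> `|x - y| <= 1.
Proof. by move=> /andP[? ?] /andP[? ?]; rewrite ler_norml; lra. Qed.

Lemma En_total p (I : finType) (w : I -> R) (z : I -> 'rV[R]_p) n (phi : 'rV[R]_p -> R) :
  is_law (cell_law w z) ->
  En w z (fun x : 'I_n -> 'rV[R]_p => phi (\sum_i x i)) = Ex (cpow n (cell_law w z)) phi.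
Proof.
move=> hl.
have := @marginal_aux _ _ _ w z hl n xpredT xpred0 (fun s _ => phi s) (fun=> isT).
rewrite cardT size_enum_ord => ->; apply: eq_Ex => s.
by rewrite Ex_cst//; exact: law_cpow.
Qed.

(** Only the statistic of [a] has to lose the overlap, since [a :\: b] is already disjoint from [b].
    The product then factorises: one factor is at most 1, and the other, centred at the full-sample
    mean [c], is bounded by the comparison of the sizes [m] and [n]. The errors add up to [3 lam],
    [60 = 2 * 30] and 21. *)
Lemma pair_bound_aux p (I : finType) (w : I -> R) (z : I -> 'rV[R]_p) n m
    (a b : {set 'I_n}) (G dG ddG : R -> R) (C lam : R) :
  let l := cell_law w z in
  let c := En w z (fun x : 'I_n -> 'rV[R]_p => G (sqnorm (\sum_i x i) / n%:R)) in
  model l -> smooth3 G dG ddG C -> (0 < m)%N -> (2 * m <= n)%N -> var_sq l / m%:R <= 1 ->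
  0 < lam -> #|a| = m -> #|b| = m ->
  En w z (fun x => (G (Rst a x) - c) * (G (Rst b x) - c)) <=
  C * (3 * lam + 60 * (m%:R / n%:R) / lam + 21 * (#|a :&: b|%:R / m%:R) / lam) +
  `|Ex (cpow m l) (fun s => G (sqnorm s / m%:R)) - Ex (cpow n l) (fun s => G (sqnorm s / n%:R))|.
Proof.
move=> l c hm hG m0 mn hK l0 am bm; have [hl cl h1] := hm.
have mn' : (m < n)%N by apply: leq_trans mn; rewrite mul2n -addnn -[X in (X < _)%N]addn0 ltn_add2l.
have hc : c = Ex (cpow n l) (fun s => G (sqnorm s / n%:R)).
  exact: (@En_total _ _ _ _ _ (fun s => G (sqnorm s / n%:R)) hl).
have c01 : 0 <= c <= 1.
  rewrite hc; apply/andP; split.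
    by apply: Ex_ge0 => [|s]; [exact: law_cpow | case/andP: (smooth3_range hG (sqnorm s / n%:R))].
  by apply: Ex_le_cst => [|s]; [exact: law_cpow | case/andP: (smooth3_range hG (sqnorm s / n%:R))].
have G01 u : 0 <= G u <= 1 by exact: smooth3_range hG u.
pose A := mean_sq l.
pose S (e : {set 'I_n}) (x : 'I_n -> 'rV[R]_p) := \sum_(i in e) x i.
pose za x := G ((sqnorm (S (a :\: b) x) + #|a :&: b|%:R * A) / m%:R).
pose q (e : {set 'I_n}) x := G (sqnorm (S e x) / m%:R).
apply: (@le_trans _ _ (En w z (fun x =>
   ((za x - c) * (q b x - c) + (`|G (Rst a x) - q a x| + `|q a x - za x|)) + `|G (Rst b x) - q b x|))).
  apply: (le_En hl) => x.
  apply: le_trans (@mul_perturb _ _ (za x - c) (q b x - c) _ _) _; try by apply: range_dist => //; exact: G01.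
  have E u v : u - c - (v - c) = u - v by ring.
  rewrite !E lerD2r lerD2l.
  exact: ler_distD.
rewrite !EnD.
have hR (e : {set 'I_n}) : #|e| = m -> En w z (fun x => `|G (Rst e x) - q e x|) <= C * (lam + 30 * (m%:R / n%:R) / lam).
  move=> em; have ce : #|~: e| = (n - m)%N.
    by apply/eqP; rewrite -(eqn_add2l #|e|) cardsC card_ord em subnKC// ltnW.
  have := recentre hG hm m0 mn hK l0; rewrite -{1}em -ce.
  rewrite -(@marginal _ _ _ w z hl n e (~: e) (fun s s' => `|G (Rstat2 m n s s') - G (sqnorm s / m%:R)|)); last first.
    by move=> i; rewrite finset.inE andbN.
  move=> /(le_trans _); apply; apply: eq_ler; apply: eq_En => x.
  by rewrite (@Rst_Rstat2 _ _ m).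
have hD : En w z (fun x => `|q a x - za x|) <= C * (lam + 21 * (#|a :&: b|%:R / m%:R) / lam).
  have ij : (#|a :\: b| + #|a :&: b| = m)%N by rewrite addnC cardsID.
  have := drop_overlap hG hm m0 ij hK l0.
  rewrite -(@marginal _ _ _ w z hl n (a :\: b) (a :&: b) (fun s s' => `|G (sqnorm (s + s') / m%:R) - G ((sqnorm s + #|a :&: b|%:R * mean_sq l) / m%:R)|)); last first.
    by move=> i; rewrite !finset.inE; case: (i \in a); case: (i \in b).
  move=> /(le_trans _); apply; apply: eq_ler; apply: eq_En => x.
  rewrite /q /za; have -> : S a x = S (a :\: b) x + S (a :&: b) x; last by [].
  rewrite /S (bigID (fun i => i \in b))/= addrC; congr (_ + _); apply: eq_bigl => i.
    by rewrite finset.inE andbC.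
  by rewrite finset.inE.
have hP : En w z (fun x => (za x - c) * (q b x - c)) <=
    `|Ex (cpow m l) (fun s => G (sqnorm s / m%:R)) - c|.
  rewrite /za /q /S (@marginal _ _ _ w z hl n (a :\: b) b (fun s s' =>
    (G ((sqnorm s + #|a :&: b|%:R * A) / m%:R) - c) * (G (sqnorm s' / m%:R) - c))); last first.
    by move=> i; rewrite !finset.inE; case: (i \in a); case: (i \in b).
  have hb := law_cpow #|b| hl; under eq_Ex do rewrite ExZ ExB Ex_cst//.
  rewrite ExZr bm; set Z := Ex _ _; set W := Ex _ _.
  apply: le_trans (ler_norm _) _; rewrite normrM -[leRHS]mul1r ler_wpM2r//.
  have hh := law_cpow #|a :\: b| hl.
  apply: le_trans (Ex_norm _ hh) _; apply: Ex_le_cst => // s; apply: range_dist => //; exact: G01.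
have hRa := hR a am; have hRb := hR b bm; rewrite hc in hP *.
move: hP hD hRa hRb; set E1 := En _ _ _; set E2 := En _ _ _; set E3 := En _ _ _; set E4 := En _ _ _.
set N := `|_|; set t := m%:R / n%:R; set d := _ / m%:R; set i := lam^-1.
lra.
Qed.

Lemma pair_bound (C eta : R) : 0 < C -> 0 < eta -> exists th D : R, [/\ 0 < th, 0 < D &
  forall p (I : finType) (w : I -> R) (z : I -> 'rV[R]_p) n m
    (a b : {set 'I_n}) (G dG ddG : R -> R),
  let l := cell_law w z in
  let c := En w z (fun x : 'I_n -> 'rV[R]_p => G (sqnorm (\sum_i x i) / n%:R)) in
  model l -> smooth3 G dG ddG C -> (0 < m)%N -> (0 < n)%N -> theta l m%:R < th ->
  m%:R / n%:R < th -> #|a| = m -> #|b| = m ->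
  En w z (fun x => (G (Rst a x) - c) * (G (Rst b x) - c)) <=
  eta + D * (#|a :&: b|%:R / m%:R)].
Proof.
move=> C0 e0.
have [C1 C10 HC1] : exists2 C1 : R, 0 < C1 & forall p (G dG ddG : R -> R),
  smooth3 G dG ddG C -> forall (l : seq (R * 'rV[R]_p)) (n m : nat) (lam : R),
  model l -> (0 < m)%N -> (m <= n)%N -> var_sq l / m%:R <= 1 -> 0 < lam ->
  `|Ex (cpow m l) (fun s => G (sqnorm s / m%:R)) -
    Ex (cpow n l) (fun s => G (sqnorm s / n%:R))| <=
  C * C1 * (lam + (1 + lam^-1) * (theta l m%:R + m%:R / n%:R)).
  by exists 1300 => [|p G dG ddG hG l n m lam hm m0 mn hK l0]; [rewrite ltr0n | exact: (lindeberg_n hG hm m0 mn hK l0)].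
(* [lam] spends half of [eta]; [B] collects what then multiplies [theta] and [m / n], so that [th]
   spends the other half. *)
pose lam := eta / (2 * C * (3 + C1)).
have l0 : 0 < lam by rewrite divr_gt0// !mulr_gt0// addr_gt0.
pose B := C * 60 * lam^-1 + 2 * C * C1 * (1 + lam^-1).
have i0 : 0 < lam^-1 by rewrite invr_gt0.
have B0 : 0 < B by rewrite addr_gt0 ?mulr_gt0// addr_gt0.
(* The bound 1/2 yields [2 m <= n] and [var_sq l / m <= 1]. *)
pose th := Num.min (1 / 2) (eta / (2 * B)).
exists th, (C * 21 * lam^-1); split.
- by rewrite lt_min !divr_gt0// mulr_gt0.
- by rewrite !mulr_gt0.
move=> p I w z n m a b G dG ddG l c hm hG m0 n0.
rewrite !lt_min => /andP[t1 t2] /andP[s1 s2] am bm; have [hl cl h1] := hm.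
have n0' : 0 < n%:R :> R by rewrite ltr0n.
have m0' : 0 < m%:R :> R by rewrite ltr0n.
have mn : (2 * m <= n)%N.
  by move: s1; rewrite ltr_pdivrMr// => s1; rewrite -(ler_nat R) natrM; lra.
have hK : var_sq l / m%:R <= 1.
  apply: le_trans (_ : theta l m%:R <= _); last lra.
  by rewrite /theta -!addrA lerDl !addr_ge0 ?lyap1_ge0 ?lyap2_ge0 ?invr_ge0.
have mn' : (m <= n)%N by apply: leq_trans mn; rewrite leq_pmull.
apply: le_trans (pair_bound_aux hm hG m0 mn hK l0 am bm) _.
apply: le_trans (lerD (lexx _) (HC1 _ _ _ _ hG _ _ _ _ hm m0 mn' hK l0)) _.
set t := theta _ _ in t1 t2 *; set s := m%:R / n%:R in s1 s2 *.
set d := _ / m%:R; set i := lam^-1 in B0 i0 *.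
have e1 : lam * (2 * C * (3 + C1)) = eta by rewrite mulfVK// gt_eqF// !mulr_gt0// addr_gt0.
move: t2 s2; rewrite !ltr_pdivlMr ?mulr_gt0// => t2 s2.
have e2 : C * (3 * lam + 60 * s * i + 21 * d * i) + C * C1 * (lam + (1 + i) * (t + s)) =
  lam * (C * (3 + C1)) + (C * 60 * i * s + C * C1 * (1 + i) * (t + s)) + C * 21 * i * d by ring.
rewrite e2 lerD2r.
have p0 : 0 <= C * C1 * (1 + i) by rewrite !mulr_ge0 ?addr_ge0 ?ltW.
have q0 : 0 <= C * 60 * i by rewrite !mulr_ge0 ?ltW.
have r1 : C * C1 * (1 + i) * (t + s) <= C * C1 * (1 + i) * (2 * (eta / (2 * B))).
  rewrite ler_wpM2l//.
  have : t <= eta / (2 * B) by rewrite ler_pdivlMr ?mulr_gt0// ltW.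
  have : s <= eta / (2 * B) by rewrite ler_pdivlMr ?mulr_gt0// ltW.
  lra.
have r2 : C * 60 * i * s <= C * 60 * i * (eta / (2 * B)).
  by rewrite ler_wpM2l// ler_pdivlMr ?mulr_gt0// ltW.
have e3 : C * C1 * (1 + i) * (2 * (eta / (2 * B))) + C * 60 * i * (eta / (2 * B)) = eta / 2.
  transitivity (B * (eta / (2 * B))); first by move: (eta / _) => X; rewrite /B -/i; ring.
  by field; rewrite gt_eqF.
lra.
Qed.

End PairBound.

(** * Discretisation of the sample *)

Section Transfer.
Context d (T : measurableType d) (R : realType) (P : probability T R).

Definition cyl n (I : finType) (io : 'I_n -> T -> I) (b : {ffun 'I_n -> I}) : set T :=
  [set t | forall i, io i t = b i].

(** [D] is carried along for the events on the random subsets; otherwise it is the whole space. *)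
Definition indep_cells n (I : finType) (io : 'I_n -> T -> I) (w : I -> R) (D : set T) : Prop :=
  (forall i c, measurable [set t | io i t = c]) /\
  forall b : {ffun 'I_n -> I}, P (D `&` cyl io b) = (P D * (\prod_i w (b i))%:E)%E.

Lemma measurable_cyl n (I : finType) (io : 'I_n -> T -> I) b :
  (forall i c, measurable [set t | io i t = c]) -> measurable (cyl io b).
Proof.
move=> h; rewrite (_ : cyl io b = \bigcap_(i in [set: 'I_n]) [set t | io i t = b i]); last first.
  by apply/seteqP; split=> t /= H i; [move=> _|]; exact: H.
by apply: fin_bigcap_measurable => //; exact: finite_finset.
Qed.

Lemma finite_comp_measurable n (I : finType) (io : 'I_n -> T -> I)
    (g : {ffun 'I_n -> I} -> R) :
  (forall i c, measurable [set t | io i t = c]) ->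
  measurable_fun setT (fun t => g [ffun i => io i t]).
Proof.
move=> h; rewrite (_ : (fun t => _) = (fun t => \sum_b g b * \1_(cyl io b) t)).
  apply: measurable_sum => b; apply: measurable_funM => //.
  by apply: measurable_indic; exact: measurable_cyl.
apply/funext => t; rewrite (bigD1 [ffun i => io i t])//= indicE mem_set; last first.
  by move=> i; rewrite ffunE.
rewrite mulr1 big1 ?addr0// => b /eqP bn.
rewrite indicE memNset ?mulr0// => H; apply: bn; apply/ffunP => i.
by rewrite ffunE H.
Qed.

Lemma integrable_bounded (u : T -> R) (B : R) (D : set T) : measurable D -> measurable_fun setT u ->
  (forall t, `|u t| <= B) -> P.-integrable D (EFin \o u).
Proof.
move=> mD mu hB; apply: (@integrableS _ _ _ P setT) => //.
have Pf : (P setT < +oo)%E by rewrite probability_setT ltry.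
apply: measurable_bounded_integrable => //.
exists B; split; first exact: num_real.
by move=> M BM t _; apply: le_trans (hB t) (ltW BM).
Qed.

Lemma Rintegral_cells n (I : finType) (io : 'I_n -> T -> I) (w : I -> R) (D : set T)
    (g : {ffun 'I_n -> I} -> R) : measurable D -> indep_cells io w D ->
  \int[P]_(t in D) g [ffun i => io i t] = fine (P D) * \sum_(b : {ffun 'I_n -> I}) (\prod_i w (b i)) * g b.
Proof.
move=> mD [hm hP].
have mc b := @measurable_cyl _ _ _ b hm.
have e : (fun t => (g [ffun i => io i t])%:E) = (fun t => \sum_b (g b * \1_(cyl io b) t)%:E)%E.
  apply/funext => t; rewrite sumEFin; congr EFin.
  rewrite (bigD1 [ffun i => io i t])//= indicE mem_set; last by move=> i; rewrite ffunE.
  rewrite mulr1 big1 ?addr0// => b /eqP bn.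
  rewrite indicE memNset ?mulr0// => H; apply: bn; apply/ffunP => i.
  by rewrite ffunE H.
have ib b : P.-integrable D (fun t => (g b * \1_(cyl io b) t)%:E).
  apply: (@integrable_bounded (fun t => g b * \1_(cyl io b) t) `|g b|) => //.
    by apply: measurable_funM => //; exact: measurable_indic.
  by move=> t; rewrite normrM ler_piMr// indicE; case: (_ \in _); rewrite ?normr1 ?normr0.
rewrite /Rintegral e integral_sum//.
rewrite (eq_bigr (fun b : {ffun 'I_n -> I} => (fine (P D) * ((\prod_i w (b i)) * g b))%:E)); last first.
  move=> b _; under eq_integral do rewrite EFinM.
  rewrite integralZl//; last first.
    apply: (@integrable_bounded (\1_(cyl io b)) 1) => //.
    by move=> t; rewrite indicE; case: (_ \in _); rewrite ?normr1 ?normr0.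
  rewrite integral_indic// setIC.
  transitivity ((g b)%:E * (P D * (\prod_i w (b i))%:E))%E; first by congr (_ * _)%E; exact: hP.
  by rewrite -[P D]fineK ?fin_num_measure// -!EFinM/=; congr EFin; ring.
by rewrite sumEFin/= mulr_sumr.
Qed.

Lemma dominated_cvgR (D : set T) (u_ : nat -> T -> R) (u g : T -> R) : measurable D ->
  (forall r, measurable_fun setT (u_ r)) ->
  (forall t, (fun r => u_ r t) @ \oo --> u t) ->
  P.-integrable setT (EFin \o g) -> (forall r t, `|u_ r t| <= g t) ->
  [/\ measurable_fun setT u, P.-integrable setT (EFin \o u),
      forall t, `|u t| <= g t &
      (fun r => \int[P]_(t in D) u_ r t) @ \oo --> (\int[P]_(t in D) u t)].
Proof.
move=> mD mu hu ig hg.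
have mu' : measurable_fun setT u by apply: (measurable_fun_cvg mu) => t _; exact: hu.
have ug t : `|u t| <= g t.
  by apply: (cvgr_to_le (cvg_norm (hu t))); apply: nearW => r; exact: hg.
have iu : P.-integrable setT (EFin \o u).
  apply: (le_integrable measurableT _ _ ig); first exact/measurable_EFinP.
  by move=> t _ /=; rewrite lee_fin (le_trans (ug t)) ?ler_norm.
split => //.
have iuD : P.-integrable D (EFin \o u) by apply: (@integrableS _ _ _ P setT).
have igD : P.-integrable D (EFin \o g) by apply: (@integrableS _ _ _ P setT).
have mS (h : T -> R) : measurable_fun setT h -> measurable_fun D (EFin \o h).
  by move=> mh; apply/measurable_EFinP; exact: measurable_funS mh.
have ue t : (fun r => (u_ r t)%:E) @ \oo --> (u t)%:E.
  by apply: cvg_EFin; [exact: nearW | exact: hu].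
have [_ _] := @dominated_convergence _ T R P D mD (fun r => EFin \o u_ r) (EFin \o u) (EFin \o g)
  (fun r => mS _ (mu r)) (mS _ mu')
  (aeW _ (fun t _ => ue t)) igD (aeW _ (fun t r _ => hg r t)).
move=> H; apply: (@fine_cvg _ _ _ _ (fun r => (\int[P]_(t in D) (u_ r t)%:E)%E)).
rewrite fineK//; exact: integrable_fin_num.
Qed.
End Transfer.

(** * Rounding real numbers to a finite grid *)

Section Grid.
Context {R : realType}.

Definition gN (r : nat) : nat := (2 * r * r.+1)%N.
(** Mesh [1 / (r + 1)] on [[-r, r]]; values outside are moved to the end points, on the left because
    [Num.truncn] is 0 on negative numbers, on the right by [minn]. *)
Definition gnat r (y : R) : nat := minn (gN r) (Num.truncn ((y + r%:R) * r.+1%:R)).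
Definition gidx r (y : R) : 'I_(gN r).+1 := inord (gnat r y).
Definition gval r (j : 'I_(gN r).+1) : R := j%:R / r.+1%:R - r%:R.

Lemma gidxE r y : gidx r y = gnat r y :> nat.
Proof. by rewrite inordK// ltnS geq_minl. Qed.

Lemma gN_val r : (gN r)%:R = 2 * r%:R * r.+1%:R :> R.
Proof. by rewrite /gN !natrM. Qed.

Lemma gval_close r y : `|y| <= r%:R -> `|y - gval (gidx r y)| <= r.+1%:R^-1.
Proof.
rewrite ler_norml => /andP[y1 y2]; have r0 : 0 < r.+1%:R :> R by rewrite ltr0n.
set u := (y + r%:R) * r.+1%:R.
have u0 : 0 <= u by rewrite mulr_ge0// ?ler0n//; lra.
have uN : u <= (gN r)%:R by rewrite gN_val ler_wpM2r//; lra.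
have /andP[t1 t2] := truncn_itv u0.
have gE : gnat r y = Num.truncn u.
  by apply/minn_idPr; rewrite -(ler_nat R) (le_trans t1).
rewrite /gval gidxE gE.
have e : y - ((Num.truncn u)%:R / r.+1%:R - r%:R) = (u - (Num.truncn u)%:R) / r.+1%:R.
  by rewrite /u; field; rewrite gt_eqF.
rewrite e normrM (ger0_norm (_ : 0 <= r.+1%:R^-1)) ?invr_ge0 ?(ltW r0)//.
rewrite -[leRHS]mul1r ler_wpM2r ?invr_ge0 ?(ltW r0)//.
move: t2; rewrite -(natr1 (Num.truncn u)); move: (Num.truncn u)%:R t1 {e gE uN u0} => v t1 t2; rewrite ler_norml; lra.
Qed.

(** The bound is free of [r] and includes the values moved to an end point, so it can serve in
    dominated convergence. *)
Lemma gval_bound r y : `|gval (gidx r y)| <= `|y| + 1.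
Proof.
have r0 : 0 < r.+1%:R :> R by rewrite ltr0n.
case: (leP `|y| r%:R) => hy.
  have h := gval_close hy.
  have i1 : r.+1%:R^-1 <= 1 :> R by rewrite invf_le1// ler1n.
  have := ler_normB y (y - gval (gidx r y)); rewrite subKr => /le_trans; apply.
  by rewrite lerD2l; exact: le_trans h i1.
have gv : `|gval (gidx r y)| <= r%:R.
  rewrite /gval gidxE ler_norml.
  have h1 : 0 <= (gnat r y)%:R / r.+1%:R :> R by rewrite divr_ge0.
  have h2 : (gnat r y)%:R / r.+1%:R <= 2 * r%:R :> R.
    by rewrite ler_pdivrMr// -gN_val ler_nat geq_minl.
  move: (_ / _) h1 h2 => a h1 h2; lra.
lra.
Qed.

Lemma gval_cvg y : (fun r => gval (gidx r y)) @ \oo --> y.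
Proof.
apply/cvgrPdist_le => e e0.
near=> r.
apply: le_trans (gval_close _) _.
  near: r; exists (Num.truncn `|y|).+1 => // r /= hr.
  by apply: le_trans (ltW (truncnS_gt _)) _; rewrite ler_nat.
near: r; exists (Num.truncn e^-1).+1 => // r /= hr.
rewrite invf_ple ?posrE ?ltr0n//.
by apply: le_trans (ltW (truncnS_gt _)) _; rewrite ler_nat; apply: leq_trans hr _.
Unshelve. all: by end_near. Qed.

(** Rounding is monotone, so its fibres are intervals. *)
Lemma gidx_measurable r j : measurable [set y : R | gidx r y = j].
Proof.
apply: is_interval_measurable => x y /= hx hy t /andP[xt ty].
have mono a b : a <= b -> (gnat r a <= gnat r b)%N.
  move=> ab; rewrite /gnat leq_min geq_minl/=; apply: leq_trans (geq_minr _ _) _.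
  by apply: le_truncn; rewrite ler_wpM2r// lerD2r.
apply: ord_inj; apply/eqP; rewrite eqn_leq; apply/andP; split.
  by rewrite -hy !gidxE mono.
by rewrite -hx !gidxE mono.
Qed.

End Grid.

(** * Transfer of expectations from the cells to the sample *)

Section Cells.
Context d (T : measurableType d) (R : realType) (P : probability T R).
Context {p : nat} (n : nat) (X : nat -> T -> 'rV[R]_p) (mu : 'rV[R]_p).
Hypothesis hX : iid_sample P n X.
Hypothesis n0 : (0 < n)%N.

Definition cellT (r : nat) : finType := {ffun 'I_p -> 'I_(@gN r).+1}.
Definition vcell r (x : 'rV[R]_p) : cellT r := [ffun k => gidx r ((x - mu) 0 k)].
Definition cell r i t : cellT r := vcell r (X i t).
(** Read off the first vector; by identical distribution it is the weight at every index of the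
    sample. *)
Definition cellw r (c : cellT r) : R := fine (P [set t | cell r 0 t = c]).

Definition indep_of (D : set T) : Prop :=
  forall A : nat -> set 'rV[R]_p, (forall i, vec_meas (A i)) ->
  P (D `&` \bigcap_(i in `I_n) (X i @^-1` A i)) = (P D * \prod_(i < n) P (X i @^-1` A i))%E.

Lemma indep_ofT : indep_of setT.
Proof.
by move=> A mA; rewrite setTI probability_setT mul1e; have [_ -> ] := hX.
Qed.

Lemma vec_meas_cell r c : vec_meas [set x | vcell r x = c].
Proof.
pose GG : set (set 'rV[R]_p) := [set A | exists (k : 'I_p) (B : set R),
               measurable B /\ A = (fun v : 'rV[R]_p => v 0 k) @^-1` B].
rewrite (_ : [set x | _] = \bigcap_(k in [set: 'I_p]) [set x : 'rV[R]_p | gidx r ((x - mu) 0 k) = c k]).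
  apply: (@fin_bigcap_measurable _ (g_sigma_algebraType GG)) => [|k _]; first exact: finite_finset.
  apply: sub_sigma_algebra; exists k, [set y | gidx r (y - mu 0 k) = c k]; split; last first.
    by apply/seteqP; split => x /=; rewrite !mxE.
  have mb : measurable_fun setT (fun y : R => y - mu 0 k) by exact: measurable_funB.
  by have := mb measurableT _ (@gidx_measurable R r (c k)); rewrite setTI.
apply/seteqP; split => x /=; first by move=> <- k _; rewrite ffunE.
by move=> H; apply/ffunP => k; rewrite ffunE; exact: H.
Qed.

Lemma vec_measT : vec_meas [set: 'rV[R]_p].
Proof.
pose GG : set (set 'rV[R]_p) := [set A | exists (k : 'I_p) (B : set R),
               measurable B /\ A = (fun v : 'rV[R]_p => v 0 k) @^-1` B].
exact: (@measurableT _ (g_sigma_algebraType GG)).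
Qed.

Lemma cell_measurable r i c : (i < n)%N -> measurable [set t | cell r i t = c].
Proof. by have [h _ _] := hX; move=> im; exact: (h i im _ (@vec_meas_cell r c)). Qed.

Lemma cell_prob r i c : (i < n)%N -> P [set t | cell r i t = c] = (cellw c)%:E.
Proof.
move=> im; have [_ _ h] := hX; rewrite /cellw fineK; last first.
  by apply: fin_num_measure; exact: cell_measurable.
exact: (h i _ im (@vec_meas_cell r c)).
Qed.

Lemma cells_indep k r D : (k <= n)%N -> indep_of D ->
  indep_cells P (fun i : 'I_k => cell r i) (@cellw r) D.
Proof.
move=> kn hD; split => [i c|b]; first by apply: cell_measurable; exact: leq_trans kn.
(* Indices from [k] on receive the whole space and contribute a factor 1. *)
pose A i : set 'rV[R]_p := if insub i is Some j then [set x | vcell r x = b j] else setT.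
have mA i : vec_meas (A i).
  by rewrite /A; case: insubP => [j _ _|_]; [exact: vec_meas_cell | exact: vec_measT].
have -> : cyl (fun i : 'I_k => cell r i) b = \bigcap_(i in `I_n) (X i @^-1` A i).
  apply/seteqP; split => t /= H.
    by move=> i /= _; rewrite /A; case: insubP => //= j _ ji; rewrite -ji; exact: H.
  move=> i; have := H i (leq_trans (ltn_ord i) kn); rewrite /A.
  by case: insubP => [j _ /val_inj -> //|]; rewrite ltn_ord.
rewrite hD//; congr (_ * _)%E.
rewrite -(big_mkord xpredT (fun i => P (X i @^-1` A i))) (big_cat_nat (leq0n k) kn)/=.
rewrite [X in (_ * X)%E]big_nat_cond [X in (_ * X)%E]big1 ?mule1; last first.
  move=> i /andP[/andP[ki _] _]; rewrite /A insubN -?leqNgt// preimage_setT.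
  exact: probability_setT.
rewrite big_mkord -prodEFin; apply: eq_bigr => i _.
rewrite -(cell_prob _ (leq_trans (ltn_ord i) kn)); congr (P _).
rewrite /A; case: insubP => [j _ /val_inj -> //|]; by rewrite ltn_ord.
Qed.

Lemma cell_law_is_law r (z : cellT r -> 'rV[R]_p) : is_law (cell_law (@cellw r) z).
Proof.
split=> [c /mapP[i _ ->] /=|]; first exact: fine_ge0.
rewrite /cell_law big_map big_enum/=.
have := @Rintegral_cells _ T R P 1 (cellT r) (fun i => cell r i) (@cellw r) setT (fun=> 1)
   measurableT (cells_indep r n0 indep_ofT).
have PT : fine (P setT) = 1 by rewrite probability_setT.
rewrite Rintegral_cst// mul1r !PT mul1r => E.
have H := @EnS R p (cellT r) (@cellw r) z 0 (fun=> 1) (fun _ _ => 1) (fun=> erefl).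
have H1 : En (@cellw r) z (fun _ : 'I_1 -> 'rV[R]_p => 1) = 1 by rewrite /En -E.
rewrite H1 Ex_cell in H; rewrite [RHS]H; apply: eq_bigr => c _.
by rewrite (@En0 _ _ _ _ _ (fun=> 1) (fun=> 0))// mulr1.
Qed.

Variable z : forall r, cellT r -> 'rV[R]_p.

(* The discretised expectations converge, and so do those restricted to an independent event. *)
Lemma transfer k (F : nat -> ('I_k -> 'rV[R]_p) -> R) (u g : T -> R) : (k <= n)%N ->
  (forall t, (fun r => F r (fun i => z (cell r i t))) @ \oo --> u t) ->
  P.-integrable setT (EFin \o g) ->
  (forall r t, `|F r (fun i => z (cell r i t))| <= g t) ->
  [/\ measurable_fun setT u, P.-integrable setT (EFin \o u), forall t, `|u t| <= g t,
      (fun r => En (@cellw r) (@z r) (F r)) @ \oo --> \int[P]_t u t &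
      forall D, measurable D -> indep_of D ->
        \int[P]_(t in D) u t = fine (P D) * \int[P]_t u t].
Proof.
move=> kn hu ig hg.
pose G r (b : {ffun 'I_k -> cellT r}) := F r (fun i => z (b i)).
have GE r : (fun t => F r (fun i => z (cell r i t))) = (fun t => G r [ffun i : 'I_k => cell r i t]).
  by apply/funext => t; rewrite /G; congr (F r _); apply/funext => i; rewrite ffunE.
have mG r : measurable_fun setT (fun t => F r (fun i => z (cell r i t))).
  rewrite GE; apply: finite_comp_measurable => i c.
  by apply: cell_measurable; exact: leq_trans kn.
have H D mD := @dominated_cvgR _ T R P D _ u g mD mG hu ig hg.
have [m1 i1 b1 c1] := H setT measurableT.
have E D : measurable D -> indep_of D ->
   (fun r => \int[P]_(t in D) F r (fun i => z (cell r i t))) = (fun r => fine (P D) * En (@cellw r) (@z r) (F r)).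
  move=> mD iD; apply/funext => r.
  have -> : (fun t => F r (fun i => z (cell r i t))) = (fun t => G r [ffun i : 'I_k => cell r i t]) by exact: GE.
  by rewrite (Rintegral_cells _ mD (cells_indep r kn iD)).
have c2 : (fun r => En (@cellw r) (@z r) (F r)) @ \oo --> \int[P]_t u t.
  move: c1; rewrite (E _ measurableT indep_ofT) probability_setT/=.
  by under eq_fun do rewrite mul1r.
split => // D mD iD; have [_ _ _ c3] := H D mD.
rewrite (E _ mD iD) in c3.
have c4 : (fun r => fine (P D) * En (@cellw r) (@z r) (F r)) @ \oo --> fine (P D) * \int[P]_t u t.
  by apply: cvgM => //; exact: cvg_cst.
exact: (cvg_unique _ c3 c4).
Qed.

End Cells.

(** * Convergence of norms and quadratic forms *)

Section Convergence.
Context {R : realType}.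

Lemma lip_cvg (f : R -> R) (C : R) (u_ : nat -> R) (u : R) :
  (forall x y, `|f x - f y| <= C * `|x - y|) -> u_ @ \oo --> u -> (f \o u_) @ \oo --> f u.
Proof.
move=> hf hu; apply/cvgrPdist_le => e e0.
have C0 : 0 <= C by have := hf 1 0; rewrite subr0 normr1 mulr1; apply: le_trans.
have e1 : 0 < e / (C + 1) by rewrite divr_gt0// ltr_wpDl.
have /cvgrPdist_le /(_ _ e1) := hu; apply: filterS => r hr /=.
apply: le_trans (hf _ _) _; apply: le_trans (ler_wpM2l C0 hr) _.
by rewrite mulrCA ler_piMr ?(ltW e0)// ler_pdivrMr ?ltr_wpDl// mul1r lerDl.
Qed.

Lemma cut1_lip (x y : R) : `|cut1 x - cut1 y| <= 1 * `|x - y|.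
Proof.
rewrite mul1r; apply: le_trans (_ : `| `|x| - `|y| | <= _); last exact: ler_dist_dist.
have h1 := ler_norm (`|x| - `|y|); have h2 := ler_norm (`|y| - `|x|); rewrite distrC in h2.
by case: (cut1P x) => -[? ->]; case: (cut1P y) => -[? ->]; rewrite ler_norml; lra.
Qed.

Lemma cvg_cut1 (u_ : nat -> R) (u : R) : u_ @ \oo --> u -> (fun r => cut1 (u_ r)) @ \oo --> cut1 u.
Proof. exact: lip_cvg cut1_lip. Qed.

Lemma cvg_sqrt (u_ : nat -> R) (u : R) : u_ @ \oo --> u -> (fun r => Num.sqrt (u_ r)) @ \oo --> Num.sqrt u.
Proof. by move=> hu; apply: continuous_cvg => //; exact: sqrt_continuous. Qed.

Lemma cvg_sumR (J : Type) (s : seq J) (Q : pred J) (F : J -> nat -> R) (f : J -> R) :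
  (forall j, F j @ \oo --> f j) ->
  (fun r => \sum_(j <- s | Q j) F j r) @ \oo --> \sum_(j <- s | Q j) f j.
Proof.
move=> h; elim: s => [|j s ih].
  by rewrite big_nil; under eq_fun do rewrite big_nil; exact: cvg_cst.
rewrite big_cons; under eq_fun do rewrite big_cons.
by case: (Q j) => //; apply: cvgD.
Qed.

Definition vcvg p (x_ : nat -> 'rV[R]_p) (x : 'rV[R]_p) : Prop :=
  forall k, (fun r => x_ r 0 k) @ \oo --> x 0 k.

Lemma vcvg_dotv p (x_ y_ : nat -> 'rV[R]_p) x y : vcvg x_ x -> vcvg y_ y ->
  (fun r => dotv (x_ r) (y_ r)) @ \oo --> dotv x y.
Proof. by move=> hx hy; apply: cvg_sumR => k; apply: cvgM. Qed.

Lemma vcvg_sqnorm p (x_ : nat -> 'rV[R]_p) x : vcvg x_ x ->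
  (fun r => sqnorm (x_ r)) @ \oo --> sqnorm x.
Proof. by move=> hx; exact: vcvg_dotv. Qed.

Lemma vcvgD p (x_ y_ : nat -> 'rV[R]_p) x y : vcvg x_ x -> vcvg y_ y ->
  vcvg (fun r => x_ r + y_ r) (x + y).
Proof. by move=> hx hy k; rewrite mxE; under eq_fun do rewrite mxE; exact: cvgD. Qed.

Lemma vcvgZ p (a_ : nat -> R) (a : R) (x_ : nat -> 'rV[R]_p) x : a_ @ \oo --> a -> vcvg x_ x ->
  vcvg (fun r => a_ r *: x_ r) (a *: x).
Proof. by move=> ha hx k; rewrite mxE; under eq_fun do rewrite mxE; exact: cvgM. Qed.

Lemma vcvgN p (x_ : nat -> 'rV[R]_p) x : vcvg x_ x -> vcvg (fun r => - x_ r) (- x).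
Proof. by move=> hx k; rewrite mxE; under eq_fun do rewrite mxE; exact: cvgN. Qed.

Lemma vcvg_sum p (J : Type) (s : seq J) (Q : pred J) (F : J -> nat -> 'rV[R]_p) f :
  (forall j, vcvg (F j) (f j)) ->
  vcvg (fun r => \sum_(j <- s | Q j) F j r) (\sum_(j <- s | Q j) f j).
Proof.
move=> h k; rewrite summxE; under eq_fun do rewrite summxE.
by apply: cvg_sumR => j; exact: h.
Qed.

Lemma dotv_CS p (x y : 'rV[R]_p) : dotv x y ^+ 2 <= sqnorm x * sqnorm y.
Proof.
case: (eqVneq (sqnorm y) 0) => [y0|yn0].
  have -> : y = 0.
    apply/rowP => k; rewrite mxE.
    have /(_ k isT) := @psumr_eq0P R _ xpredT (fun k => y 0 k * y 0 k) (fun k _ => sqr_ge0 (y 0 k)) y0.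
    move=> /eqP; rewrite mulf_eq0 orbb => /eqP -> //.
  by rewrite dotv0r expr0n/= mulr_ge0 ?sqnorm_ge0.
have yp : 0 < sqnorm y by rewrite lt0r yn0 sqnorm_ge0.
have := sqnorm_ge0 (sqnorm y *: x + (- dotv x y) *: y).
rewrite sqnormD !sqnormZ dotvZl dotvZr => h.
rewrite -(ler_pM2l yp); lra.
Qed.

(** Written through covariance entries, second moments in a moving direction converge as soon as the
    finitely many covariances do. *)
Lemma sg2_cov p (l : seq (R * 'rV[R]_p)) v :
  sg2 l v = \sum_k \sum_j v 0 k * v 0 j * Ex l (fun x => x 0 k * x 0 j).
Proof.
rewrite /sg2.
transitivity (Ex l (fun x => \sum_k \sum_j v 0 k * v 0 j * (x 0 k * x 0 j))).
  apply: eq_Ex => x; rewrite expr2 /dotv mulr_suml; apply: eq_bigr => k _.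
  by rewrite mulr_sumr; apply: eq_bigr => j _; ring.
by rewrite Ex_sum; apply: eq_bigr => k _; rewrite Ex_sum; apply: eq_bigr => j _; rewrite ExZ.
Qed.

Lemma Ex_sg2_cov p (l : seq (R * 'rV[R]_p)) :
  Ex l (sg2 l) = \sum_k \sum_j (Ex l (fun x => x 0 k * x 0 j)) ^+ 2.
Proof.
rewrite (eq_Ex _ (@sg2_cov _ l)) Ex_sum; apply: eq_bigr => k _.
rewrite Ex_sum; apply: eq_bigr => j _.
by rewrite ExZr expr2.
Qed.

Lemma sg2_le p (l : seq (R * 'rV[R]_p)) v : is_law l -> sg2 l v <= mean_sq l * sqnorm v.
Proof.
move=> hl; rewrite /mean_sq -ExZr; apply: le_Ex => // x; exact: dotv_CS.
Qed.

End Convergence.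

Section SmallSamples.
Context {R : realType} {p : nat} {I : finType} (w : I -> R) (z : I -> 'rV[R]_p).

Lemma En1 (F : ('I_1 -> 'rV[R]_p) -> R) : En w z F = Ex (cell_law w z) (fun x => F (fun=> x)).
Proof.
have c (x : 'I_1 -> 'rV[R]_p) : x = (fun=> x ord0) by apply/funext => i; rewrite ord1.
rewrite (@EnS _ _ _ w z 0 F (fun y _ => F (fun=> y))); last by move=> x; rewrite {1}(c x).
by apply: eq_Ex => y; rewrite (@En0 _ _ _ _ _ _ (fun=> 0)).
Qed.

Lemma En2 (F : 'rV[R]_p -> 'rV[R]_p -> R) :
  En w z (fun x : 'I_2 -> 'rV[R]_p => F (x ord0) (x ord_max)) =
  Ex (cell_law w z) (fun x => Ex (cell_law w z) (fun y => F x y)).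
Proof.
rewrite (@EnS _ _ _ w z 1 _ (fun y x => F y (x ord0))); last first.
  by move=> x; congr (F _ (x _)); apply: val_inj.
by apply: eq_Ex => y; rewrite En1.
Qed.
End SmallSamples.

(** * Discretised laws in normalised form *)

Section Approx.
Context d (T : measurableType d) (R : realType) (P : probability T R).
Context {p : nat} (n : nat) (X : nat -> T -> 'rV[R]_p) (mu : 'rV[R]_p) (Sigma : 'M[R]_p).
Hypothesis hX : iid_sample P n X.
Hypothesis n1 : (1 < n)%N.
Hypothesis hS : mean_cov P n X mu Sigma.
Let n0 : (0 < n)%N := ltnW n1.
Local Notation Y i t := (X i t - mu).
Local Notation sq i t := (sqnorm (Y i t)).
Hypothesis h4 : P.-integrable setT (fun t => (sq 0%N t ^+ 2)%:E).

Lemma integrable_dom (c1 c2 : R) : P.-integrable setT (fun t => (c1 * sq 0%N t ^+ 2 + c2)%:E).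
Proof.
under eq_fun do rewrite EFinD EFinM.
apply: integrableD => //; first exact: integrableZl.
exact: finite_measure_integrable_cst.
Qed.

(** Recentring and rescaling are under control only from some index on; before it the functional is
    replaced by 0. *)
Lemma transfer_ev (z : forall r : nat, @cellT p r -> 'rV[R]_p) r0 k
    (F : nat -> ('I_k -> 'rV[R]_p) -> R) (u g : T -> R) : (k <= n)%N ->
  (forall t, (fun r => F r (fun i => z r (cell X mu r i t))) @ \oo --> u t) ->
  P.-integrable setT (EFin \o g) ->
  (forall r t, (r0 <= r)%N -> `|F r (fun i => z r (cell X mu r i t))| <= g t) ->
  [/\ measurable_fun setT u, P.-integrable setT (EFin \o u), forall t, `|u t| <= g t,
      (fun r => En (@cellw _ T R P p X mu r) (z r) (F r)) @ \oo --> \int[P]_t u t &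
      forall D, measurable D -> indep_of P n X D ->
        \int[P]_(t in D) u t = fine (P D) * \int[P]_t u t].
Proof.
move=> kn hu ig hg.
have g0 t : 0 <= g t by apply: le_trans (hg r0 t (leqnn _)).
pose F' r x := if (r0 <= r)%N then F r x else 0.
have hu' t : (fun r => F' r (fun i => z r (cell X mu r i t))) @ \oo --> u t.
  apply: cvg_trans (hu t); apply: near_eq_cvg; exists r0 => // r /= hr.
  by rewrite /F' hr.
have hg' r t : `|F' r (fun i => z r (cell X mu r i t))| <= g t.
  by rewrite /F'; case: ifP => hr; [exact: hg | rewrite normr0].
have [a1 a2 a3 a4 a5] := transfer hX n0 kn hu' ig hg'.
split => //; apply: cvg_trans a4; apply: near_eq_cvg; exists r0 => // r /= hr.
by rewrite /F' hr.
Qed.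

Lemma coord_sq (x : 'rV[R]_p) k : x 0 k ^+ 2 <= sqnorm x.
Proof.
rewrite /sqnorm /dotv (bigD1 k)//= -expr2 lerDl sumr_ge0// => j _.
by rewrite -expr2 sqr_ge0.
Qed.

Definition gridv r (c : @cellT p r) : 'rV[R]_p := \row_k gval (c k).
(** Rounding does not preserve the mean; this bias tends to zero and is subtracted. *)
Definition gridm r : 'rV[R]_p :=
  \row_k Ex (cell_law (@cellw _ T R P p X mu r) (@gridv r)) (fun x => x 0 k).
Definition gridc r (c : @cellT p r) : 'rV[R]_p := gridv c - gridm r.
Local Notation W := (@cellw _ T R P p X mu).
Definition law0 r := cell_law (@W r) (@gridc r).

Lemma gridv_cvg i t : vcvg (fun r => gridv (cell X mu r i t)) (Y i t).
Proof.
move=> k; under eq_fun do rewrite mxE ffunE; exact: gval_cvg.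
Qed.

Lemma gridm_cvg : vcvg gridm 0.
Proof.
move=> k; rewrite [X in _ --> X]mxE.
have [X1 X2 X3 X4] := hS n0 k k.
(* [|y| + 1 <= s^2 + 3] when [y^2 <= s]: the domination is expressed through the fourth moment. *)
have [] := @transfer_ev gridv 0 1 (fun r x => x ord0 0 k) (fun t => Y 0%N t 0 k)
   (fun t => 1 * sq 0%N t ^+ 2 + 3) n0.
- by move=> t; exact: gridv_cvg.
- exact: integrable_dom.
- move=> r t _; rewrite mxE ffunE; apply: le_trans (gval_bound _ _) _.
  have h : `|Y 0%N t 0 k| ^+ 2 <= sq 0%N t by rewrite real_normK ?num_real// coord_sq.
  have := sqnorm_ge0 (Y 0%N t); move: h; set a := `|_|; set s := sqnorm _ => h s0.
  have := sqr_ge0 (a - 1 / 2); have := sqr_ge0 (s - 1 / 2); lra.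
move=> _ i1 _ c1 _; move: c1; under eq_fun do rewrite En1.
have -> : \int[P]_t (Y 0%N t 0 k) = 0.
  have -> : (fun t => (Y 0%N t) 0 k) = (fun t => X 0%N t 0 k - mu 0 k) by apply/funext => t; rewrite !mxE.
  rewrite RintegralB//; last exact: finite_measure_integrable_cst.
  have -> : \int[P]_t X 0%N t 0 k = mu 0 k by rewrite /Rintegral X3.
  have -> : \int[P]_(t in setT) mu 0 k = mu 0 k.
    by rewrite Rintegral_cst// (_ : fine (P setT) = 1) ?mulr1// probability_setT.
  exact: subrr.
by under [in X in _ -> X]eq_fun do rewrite mxE.
Qed.

Lemma gridc_cvg i t : vcvg (fun r => gridc (cell X mu r i t)) (Y i t).
Proof.
have := vcvgD (@gridv_cvg i t) (vcvgN gridm_cvg).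
by rewrite oppr0 addr0.
Qed.

Lemma gridm_small : exists r0, forall r k, (r0 <= r)%N -> `|gridm r 0 k| <= 1.
Proof.
have H (k : 'I_p) : \forall r \near \oo, `|gridm r 0 k| <= 1.
  have /cvgrPdist_le/(_ 1 ltr01) := @gridm_cvg k.
  by apply: filterS => r; rewrite mxE sub0r normrN.
have [r0 _ h] := filter_forall _ H.
by exists r0 => r k hr; exact: h.
Qed.

Lemma gridc_bound r i t k : (forall k, `|gridm r 0 k| <= 1) ->
  `|gridc (cell X mu r i t) 0 k| <= `|Y i t 0 k| + 2.
Proof.
move=> h; rewrite /gridc mxE [X in _ + X]mxE; apply: le_trans (ler_normB _ _) _.
have := gval_bound r (Y i t 0 k); have := h k; rewrite [gridv _ _ _]mxE ffunE.
move=> h1 h2; apply: le_trans (lerD h2 h1) _; rewrite -addrA lerD2l; lra.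
Qed.

Lemma law0_cov k j :
  (fun r => Ex (law0 r) (fun x => x 0 k * x 0 j)) @ \oo --> Sigma k j.
Proof.
have [r0 hr0] := gridm_small.
have [X1 X2 X3 X4] := hS n0 k j.
have [] := @transfer_ev gridc r0 1 (fun r x => x ord0 0 k * x ord0 0 j)
   (fun t => Y 0%N t 0 k * Y 0%N t 0 j) (fun t => 2 * sq 0%N t ^+ 2 + 10) n0.
- by move=> t; apply: cvgM; exact: gridc_cvg.
- exact: integrable_dom.
- move=> r t hr; rewrite normrM.
  have hk := @gridc_bound r 0%N t k (fun k => hr0 r k hr).
  have hj := @gridc_bound r 0%N t j (fun k => hr0 r k hr).
  apply: le_trans (ler_pM _ _ hk hj) _ => //.
  have h : `|Y 0%N t 0 k| ^+ 2 <= sq 0%N t by rewrite real_normK ?num_real// coord_sq.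
  have h' : `|Y 0%N t 0 j| ^+ 2 <= sq 0%N t by rewrite real_normK ?num_real// coord_sq.
  have := sqnorm_ge0 (Y 0%N t); move: h h'.
  set a := `|_|; set s := sqnorm _; set b := `|_| => h h' s0.
  have := sqr_ge0 (a - b); have := sqr_ge0 (s - 1 / 2).
  have := sqr_ge0 (a - 2); have := sqr_ge0 (b - 2).
  nra.
move=> _ _ _ c1 _; move: c1; under eq_fun do rewrite En1.
have -> // : \int[P]_t (Y 0%N t 0 k * Y 0%N t 0 j) = Sigma k j.
rewrite /Rintegral; under eq_integral do rewrite !mxE.
by rewrite X4.
Qed.

Lemma law0_centered r : centered (law0 r).
Proof.
move=> v; rewrite /dotv Ex_sum big1// => k _; rewrite ExZr.
suff -> : Ex (law0 r) (fun x => x 0 k) = 0 by rewrite mul0r.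
have hl := cell_law_is_law mu hX n0 (@gridv r).
transitivity (Ex (cell_law (@W r) (@gridv r)) (fun x => x 0 k - gridm r 0 k)).
  by rewrite !Ex_cell; apply: eq_bigr => c _; rewrite !mxE.
by rewrite ExB Ex_cst// mxE subrr.
Qed.

(** This is [tr (Sigma^2) = f^2] for a symmetric [Sigma]; as a polynomial in the covariances it is
    the limit of [F2]. *)
Definition ff : R := \sum_k \sum_j Sigma k j ^+ 2.
Hypothesis ff0 : 0 < ff.
Definition F2 r : R := Ex (law0 r) (sg2 (law0 r)).
(** The power [x^(-1/4)]: the normalised quantity [Ex l (sg2 l)] is quartic in the vectors. At
    [x = f^2] it is [f^(-1/2)]. *)
Definition scale (x : R) : R := (Num.sqrt (Num.sqrt x))^-1.
Definition gridz r (c : @cellT p r) : 'rV[R]_p := scale (F2 r) *: gridc c.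
Definition lawz r := cell_law (@W r) (@gridz r).

Lemma scale4 x : 0 < x -> scale x ^+ 4 * x = 1.
Proof.
move=> x0; rewrite /scale exprVn (exprM _ 2 2) sqr_sqrtr ?sqrtr_ge0// sqr_sqrtr ?ltW//.
by rewrite mulVf// gt_eqF.
Qed.

Lemma scale_gt0 x : 0 < x -> 0 < scale x.
Proof. by move=> x0; rewrite invr_gt0 !sqrtr_gt0. Qed.

Lemma F2_cvg : F2 @ \oo --> ff.
Proof.
rewrite /F2; under eq_fun do rewrite Ex_sg2_cov.
apply: cvg_sumR => k; apply: cvg_sumR => j.
by rewrite expr2; under eq_fun do rewrite expr2; apply: cvgM; exact: law0_cov.
Qed.

Lemma scale_cvg : (fun r => scale (F2 r)) @ \oo --> scale ff.
Proof.
apply: cvgV; first by rewrite gt_eqF// !sqrtr_gt0.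
by apply: cvg_sqrt; apply: cvg_sqrt; exact: F2_cvg.
Qed.

Lemma gridz_cvg i t : vcvg (fun r => gridz (cell X mu r i t)) (scale ff *: Y i t).
Proof. exact: vcvgZ scale_cvg (@gridc_cvg i t). Qed.

Lemma lawzE r : lawz r = scl (scale (F2 r)) (law0 r).
Proof. by rewrite /scl /law0 /cell_law -map_comp; apply: eq_map. Qed.

Lemma lawz_cov k j :
  (fun r => Ex (lawz r) (fun x => x 0 k * x 0 j)) @ \oo --> scale ff ^+ 2 * Sigma k j.
Proof.
have E r : Ex (lawz r) (fun x => x 0 k * x 0 j) = scale (F2 r) * scale (F2 r) * Ex (law0 r) (fun x => x 0 k * x 0 j).
  by rewrite lawzE Ex_scl -ExZ; apply: eq_Ex => x; rewrite !mxE; ring.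
under eq_fun do rewrite E; rewrite expr2.
by apply: cvgM; [apply: cvgM; exact: scale_cvg | exact: law0_cov].
Qed.

(** The summand [4 p] pays for rounding and bias in each coordinate. Dependence on [p] is harmless:
    [n] and [p] are fixed while the mesh shrinks, and only integrability of the square matters. *)
Definition dom i t : R := 8 * scale ff ^+ 2 * (sq i t + 4 * p%:R) *+ 4.

(** From some index on the bias is at most 1, [F2] is positive and the scale is at most twice its
    limit. Dividing by the discretised [F2 r], not by its limit, makes the law a model exactly. *)
Lemma approx_model : exists r0,
  [/\ forall r, (r0 <= r)%N -> model (lawz r) &
      forall r i t, (r0 <= r)%N -> sqnorm (gridz (cell X mu r i t)) <= dom i t].
Proof.
have [r0 hr0] := gridm_small.
have s0 := scale_gt0 ff0.
have [r1 _ h1] : \forall r \near \oo, 0 < F2 r by exact: cvgr_gt F2_cvg _ ff0.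
have [r2 _ h2] : \forall r \near \oo, scale (F2 r) <= 2 * scale ff.
  have hs : scale ff < 2 * scale ff by lra.
  exact: cvgr_le scale_cvg _ hs.
exists (maxn r0 (maxn r1 r2)); split=> [r|r i t]; rewrite !geq_max => /andP[q0 /andP[q1 q2]].
  have hl : is_law (lawz r) by exact: (cell_law_is_law mu hX n0).
  have f0 : 0 < F2 r by exact: h1.
  split => //; rewrite lawzE; first exact/centered_scl/law0_centered.
  rewrite Ex_scl; transitivity (scale (F2 r) ^+ 4 * F2 r); last exact: scale4.
  by rewrite /F2 -ExZ; apply: eq_Ex => x; rewrite sg2_scl sg2Z; ring.
have f0 : 0 < F2 r by exact: h1.
have sr0 := scale_gt0 f0.
have sr : scale (F2 r) <= 2 * scale ff by exact: h2.
rewrite sqnormZ /dom.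
have B : sqnorm (gridc (cell X mu r i t)) <= 2 * (sq i t + 4 * p%:R).
  have -> : 2 * (sq i t + 4 * p%:R) = \sum_(k < p) 2 * ((Y i t 0 k) ^+ 2 + 4).
    rewrite -mulr_sumr big_split/= sumr_const card_ord; congr (2 * (_ + _)).
    by rewrite mulr_natr.
  apply: ler_sum => k _; rewrite -expr2 -real_normK ?num_real// -[X in _ <= 2 * (X + _)]real_normK ?num_real//.
  have h := @gridc_bound r i t k (fun k => hr0 r k q0).
  move: h; set a := `|_|; set b := `|_| => h.
  have : a ^+ 2 <= (b + 2) ^+ 2 by rewrite ler_pXn2r ?nnegrE ?addr_ge0// /a /b.
  have := sqr_ge0 (b - 2); lra.
have S2 : scale (F2 r) ^+ 2 <= 4 * scale ff ^+ 2.
  have -> : 4 * scale ff ^+ 2 = (2 * scale ff) ^+ 2 by ring.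
  by rewrite ler_pXn2r ?nnegrE ?(ltW sr0)// mulr_ge0// ltW.
have Q0 : 0 <= sq i t + 4 * p%:R by rewrite addr_ge0 ?sqnorm_ge0 ?mulr_ge0.
apply: le_trans (ler_pM (sqr_ge0 _) (sqnorm_ge0 _) S2 B) _.
have := mulr_ge0 (sqr_ge0 (scale ff)) Q0; lra.
Qed.

End Approx.

(** * The Lyapunov quantity of the sample *)

Section Limits.
Context d (T : measurableType d) (R : realType) (P : probability T R).
Context {p : nat} (n : nat) (X : nat -> T -> 'rV[R]_p) (mu : 'rV[R]_p) (Sigma : 'M[R]_p).
Hypothesis hX : iid_sample P n X.
Hypothesis n1 : (1 < n)%N.
Hypothesis hS : mean_cov P n X mu Sigma.
Let n0 : (0 < n)%N := ltnW n1.
Local Notation Y i t := (X i t - mu).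
Local Notation sq i t := (sqnorm (Y i t)).
Hypothesis h4 : P.-integrable setT (fun t => (sq 0%N t ^+ 2)%:E).
Hypothesis ff0 : 0 < ff Sigma.
Let s := scale (ff Sigma).
Local Notation Z i t := (scale (ff Sigma) *: (X i t - mu)).
Local Notation lz := (@lawz _ T R P p X mu).
Local Notation dm := (@dom _ T R p X mu Sigma).

Lemma coord_measurable i k : (i < n)%N -> measurable_fun setT (fun t => X i t 0 k).
Proof.
move=> im _ B mB; rewrite setTI; have [h _ _] := hX.
have := h i im ((fun v : 'rV[R]_p => v 0 k) @^-1` B); apply.
by apply: sub_sigma_algebra; exists k, B.
Qed.

(** The assumption concerns the first vector; equality of the two image measures carries it to the
    second. *)
Lemma integrable_sq1 : P.-integrable setT (fun t => (sq 1%N t ^+ 2)%:E).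
Proof.
pose GG : set (set 'rV[R]_p) := [set A | exists (k : 'I_p) (B : set R),
               measurable B /\ A = (fun v : 'rV[R]_p => v 0 k) @^-1` B].
pose V' := g_sigma_algebraType GG.
have mk (k : 'I_p) : measurable_fun [set: V'] (fun v : V' => (v : 'rV[R]_p) 0 k).
  by move=> _ B mB; rewrite setTI; apply: sub_sigma_algebra; exists k, B.
pose f (v : V') : \bar R := ((sqnorm ((v : 'rV[R]_p) - mu)) ^+ 2)%:E.
have mf : measurable_fun [set: V'] f.
  apply/measurable_EFinP; apply: measurable_funX; rewrite /sqnorm /dotv.
  have mk' (k : 'I_p) : measurable_fun [set: V'] (fun v : V' => ((v : 'rV[R]_p) - mu) 0 k).
    rewrite (_ : (fun v => _) = (fun v : V' => (v : 'rV[R]_p) 0 k - mu 0 k)); last by apply/funext => v; rewrite !mxE.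
    exact: measurable_funB.
  by apply: measurable_sum => k; exact: measurable_funM.
have mX i : (i < n)%N -> measurable_fun setT (X i : T -> V').
  by move=> im _ A mA; rewrite setTI; have [h _ _] := hX; exact: (h i im A mA).
have f0 : {in [set: V'], forall v, (0 <= f v)%E} by move=> v _; rewrite lee_fin sqr_ge0.
have e0 := ge0_integral_pushforward (mX 0%N n0) P measurableT mf f0.
have e1 := ge0_integral_pushforward (mX 1%N n1) P measurableT mf f0.
have m1 : measurable_fun setT (fun t => (sq 1%N t ^+ 2)%:E).
  by apply: measurableT_comp mf (mX 1%N n1).
apply/integrableP; split => //.
have E : (\int[P]_t `|(sq 1%N t ^+ 2)%:E| = \int[P]_t `|(sq 0%N t ^+ 2)%:E|)%E.
  under eq_integral do rewrite gee0_abs ?lee_fin ?sqr_ge0//.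
  under [RHS]eq_integral do rewrite gee0_abs ?lee_fin ?sqr_ge0//.
  move: e0 e1; rewrite !preimage_setT /comp /f => <- <-.
  apply: eq_measure_integral => [||q0 q1 A mA _]; [exact: mX | exact: mX |].
  by have [_ _ h] := hX; exact: (h 1%N A).
by rewrite E; have /integrableP[] := h4.
Qed.

Lemma integrable_dm2 i : (i < 2)%N -> P.-integrable setT (fun t => (dm i t ^+ 2)%:E).
Proof.
move=> i2; have hi : P.-integrable setT (fun t => (sq i t ^+ 2)%:E).
  by case: i i2 => [|[|]] // _; exact: integrable_sq1.
have mi : measurable_fun setT (fun t => sq i t).
  have im : (i < n)%N by exact: leq_trans n1.
  rewrite /sqnorm /dotv; apply: measurable_sum => k.
  have mk : measurable_fun setT (fun t => (Y i t) 0 k).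
    rewrite (_ : (fun t => _) = (fun t => X i t 0 k - mu 0 k)); last by apply/funext => v; rewrite !mxE.
    by apply: measurable_funB => //; exact: coord_measurable.
  exact: measurable_funM.
pose c := 8 * s ^+ 2 *+ 4.
have dE t : dm i t = c * (sq i t + 4 * p%:R) by rewrite /dom /c /s; ring.
have ig : P.-integrable setT (fun t => (2 * c ^+ 2 * sq i t ^+ 2 + 32 * c ^+ 2 * p%:R ^+ 2)%:E).
  under eq_fun do rewrite EFinD EFinM.
  apply: integrableD => //; first exact: integrableZl.
  exact: finite_measure_integrable_cst.
apply: (le_integrable measurableT _ _ ig).
  apply/measurable_EFinP; apply: measurable_funX; rewrite (funext dE).
  by apply: measurable_funM => //; exact: measurable_funD.
move=> t _; rewrite /= lee_fin ger0_norm ?sqr_ge0//; apply: le_trans (ler_norm _).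
rewrite dE exprMn; have := sqr_ge0 (c * (sq i t - 4 * p%:R)); rewrite exprMn; lra.
Qed.

(** [Amean], [Sform] and the quantities below are the population counterparts of [mean_sq], [sg2]
    and the terms of [theta], for [z = (X - mu) / sqrt f]. *)
Definition Amean : R := \sum_k s ^+ 2 * Sigma k k.
Definition Sform (v : 'rV[R]_p) : R := \sum_k \sum_j v 0 k * v 0 j * (s ^+ 2 * Sigma k j).
Definition Kinf : R := \int[P]_t (sqnorm (Z 0%N t) - Amean) ^+ 2.
Definition L1inf (m : R) : R := \int[P]_t (Sform (Z 0%N t) * cut1 (Num.sqrt (Sform (Z 0%N t) / m))).
Definition L2inf (m : R) : R :=
  \int[P]_t (dotv (Z 0%N t) (Z 1%N t) ^+ 2 * cut1 (dotv (Z 0%N t) (Z 1%N t) / m)).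
Definition theta_inf (m : R) : R := Kinf / m + L1inf m + L2inf m + m^-1.

Lemma mean_sq_cvg : (fun r => mean_sq (lz r)) @ \oo --> Amean.
Proof.
have E r : mean_sq (lz r) = \sum_k Ex (lz r) (fun x => x 0 k * x 0 k).
  by rewrite /mean_sq -Ex_sum.
under eq_fun do rewrite E; apply: cvg_sumR => k.
exact: (lawz_cov hX n1 hS h4 ff0).
Qed.

Lemma sg2_cvg (v_ : nat -> 'rV[R]_p) v : vcvg v_ v -> (fun r => sg2 (lz r) (v_ r)) @ \oo --> Sform v.
Proof.
move=> hv; under eq_fun do rewrite sg2_cov; apply: cvg_sumR => k; apply: cvg_sumR => j.
apply: cvgM; first by apply: cvgM.
exact: (lawz_cov hX n1 hS h4 ff0).
Qed.

Lemma mean_sq_bd : exists r0, forall r, (r0 <= r)%N -> `|mean_sq (lz r)| <= `|Amean| + 1.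
Proof.
have [r0 _ h] : \forall r \near \oo, `|mean_sq (lz r)| <= `|Amean| + 1.
  have hs : `|Amean| < `|Amean| + 1 by rewrite ltrDl.
  exact: cvgr_le (cvg_norm mean_sq_cvg) _ hs.
by exists r0.
Qed.

Let zcv i t := @gridz_cvg _ T R P p n X mu Sigma hX n1 hS h4 ff0 i t.

(** One transfer for each of the three expectations, over samples of size 1, 1 and 2, all dominated
    through squares of [dom]. *)
Lemma theta_cvg (m : R) : 0 < m -> (fun r => theta (lz r) m) @ \oo --> theta_inf m.
Proof.
move=> m0; have [r1 [hmod hdom]] := approx_model hX n1 hS h4 ff0.
have [r2 hA] := mean_sq_bd.
set B := `|Amean| + 1 in hA.
have B0 : 0 <= B by rewrite addr_ge0.
have dm0 i t : 0 <= dm i t.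
  by apply: mulrn_wge0; apply: mulr_ge0; [apply: mulr_ge0 => //; exact: sqr_ge0 | apply: addr_ge0; [exact: sqnorm_ge0 | exact: mulr_ge0]].
have i0 := @integrable_dm2 0%N isT.
have i1 := @integrable_dm2 1%N isT.
have imm (a b : R) : P.-integrable setT (fun t => (a * dm 0%N t ^+ 2 + b)%:E).
  under eq_fun do rewrite EFinD EFinM.
  apply: integrableD => //; first exact: integrableZl.
  exact: finite_measure_integrable_cst.
apply: cvgD; last exact: cvg_cst.
apply: cvgD; first apply: cvgD.
- apply: cvgM; last exact: cvg_cst.
  have [] := @transfer_ev _ T R P p n X mu hX n1 (@gridz _ T R P p X mu) (maxn r1 r2) 1
    (fun r x => (sqnorm (x ord0) - mean_sq (lz r)) ^+ 2) (fun t => (sqnorm (Z 0%N t) - Amean) ^+ 2)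
    (fun t => 2 * dm 0%N t ^+ 2 + 2 * B ^+ 2) n0.
  + move=> t; rewrite expr2; under eq_fun do rewrite expr2.
    by apply: cvgM; apply: cvgB; (try exact: mean_sq_cvg); apply: vcvg_sqnorm; exact: zcv.
  + exact: imm.
  + move=> r t; rewrite geq_max => /andP[h1 h2].
    rewrite ger0_norm ?sqr_ge0//.
    have a1 := hdom r 0%N t h1; have a2 := hA r h2.
    have a3 := sqnorm_ge0 (gridz P X mu (cell X mu r 0%N t)).
    apply: le_trans (_ : 2 * sqnorm (gridz P X mu (cell X mu r 0%N t)) ^+ 2 + 2 * `|mean_sq (lz r)| ^+ 2 <= _).
      rewrite real_normK ?num_real//.
      have := sqr_ge0 (sqnorm (gridz P X mu (cell X mu r 0%N t)) + mean_sq (lz r)).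
      lra.
    by rewrite lerD// ler_wpM2l// ler_pXn2r ?nnegrE ?dm0.
  move=> _ _ _ c1 _; move: c1; under eq_fun do rewrite En1.
  exact.
- have [] := @transfer_ev _ T R P p n X mu hX n1 (@gridz _ T R P p X mu) (maxn r1 r2) 1
    (fun r x => sg2 (lz r) (x ord0) * cut1 (Num.sqrt (sg2 (lz r) (x ord0) / m)))
    (fun t => Sform (Z 0%N t) * cut1 (Num.sqrt (Sform (Z 0%N t) / m)))
    (fun t => B * dm 0%N t ^+ 2 + B) n0.
  + move=> t; have hs : (fun r => sg2 (lz r) (gridz P X mu (cell X mu r 0%N t))) @ \oo --> Sform (Z 0%N t).
      by apply: sg2_cvg; exact: zcv.
    apply: cvgM => //; apply: cvg_cut1; apply: cvg_sqrt; apply: cvgM => //; exact: cvg_cst.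
  + exact: imm.
  + move=> r t; rewrite geq_max => /andP[h1 h2].
    have [hl _ _] := hmod r h1.
    have s0 := sg2_ge0 (gridz P X mu (cell X mu r 0%N t)) hl.
    rewrite ger0_norm ?mulr_ge0 ?cut1_ge0//.
    apply: le_trans (_ : sg2 (lz r) (gridz P X mu (cell X mu r 0%N t)) * 1 <= _).
      by rewrite ler_wpM2l ?cut1_le1.
    rewrite mulr1; apply: le_trans (sg2_le _ hl) _.
    apply: le_trans (_ : B * dm 0%N t <= _).
      apply: ler_pM; rewrite ?sqnorm_ge0//; [exact: Ex_ge0 hl (fun x => sqnorm_ge0 x) | | exact: hdom].
      exact: le_trans (ler_norm _) (hA r h2).
    rewrite -[X in _ <= _ + X]mulr1 -mulrDr ler_wpM2l//.
    have := sqr_ge0 (dm 0%N t - 1 / 2); lra.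
  move=> _ _ _ c1 _; move: c1; under eq_fun do rewrite En1.
  exact.
- have [] := @transfer_ev _ T R P p n X mu hX n1 (@gridz _ T R P p X mu) (maxn r1 r2) 2
    (fun r x => dotv (x ord0) (x ord_max) ^+ 2 * cut1 (dotv (x ord0) (x ord_max) / m))
    (fun t => dotv (Z 0%N t) (Z 1%N t) ^+ 2 * cut1 (dotv (Z 0%N t) (Z 1%N t) / m))
    (fun t => dm 0%N t ^+ 2 + dm 1%N t ^+ 2) n1.
  + move=> t; have hs : (fun r => dotv (gridz P X mu (cell X mu r 0%N t)) (gridz P X mu (cell X mu r 1%N t))) @ \oo --> dotv (Z 0%N t) (Z 1%N t).
      by apply: vcvg_dotv; exact: zcv.
    apply: cvgM; first by rewrite expr2; under eq_fun do rewrite expr2; exact: cvgM.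
    by apply: cvg_cut1; apply: cvgM => //; exact: cvg_cst.
  + exact: (integrableD measurableT i0 i1).
  + move=> r t; rewrite geq_max => /andP[h1 h2].
    rewrite ger0_norm; last by apply: mulr_ge0; [exact: sqr_ge0 | exact: cut1_ge0].
    set x := gridz P X mu (cell X mu r 0%N t); set y := gridz P X mu (cell X mu r 1%N t).
    apply: le_trans (_ : dotv x y ^+ 2 * 1 <= _); first by rewrite ler_wpM2l ?cut1_le1 ?sqr_ge0.
    rewrite mulr1; apply: le_trans (dotv_CS _ _) _.
    have a1 := hdom r 0%N t h1; have a2 := hdom r 1%N t h1.
    apply: le_trans (ler_pM (sqnorm_ge0 _) (sqnorm_ge0 _) a1 a2) _.
    have := sqr_ge0 (dm 0%N t - dm 1%N t); have := sqr_ge0 (dm 0%N t); have := sqr_ge0 (dm 1%N t); lra.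
  move=> _ _ _ c1 _; move: c1.
  under eq_fun do rewrite (En2 _ _ (fun x y => dotv x y ^+ 2 * cut1 (dotv x y / m))).
  exact.
Qed.

End Limits.

(** * Passing to the limit in the discretisation *)

Section Consequences.
Context {R : realType}.

Definition setting d (T : measurableType d) (P : probability T R) p n (X : nat -> T -> 'rV[R]_p)
    (mu : 'rV[R]_p) (Sigma : 'M[R]_p) : Prop :=
  [/\ iid_sample P n X, (1 < n)%N, mean_cov P n X mu Sigma,
      P.-integrable setT (fun t => (sqnorm (X 0%N t - mu) ^+ 2)%:E) & 0 < ff Sigma].

Definition Zn (T : Type) p n (X : nat -> T -> 'rV[R]_p) mu (Sigma : 'M[R]_p) (t : T) (i : 'I_n) : 'rV[R]_p :=
  scale (ff Sigma) *: (X i t - mu).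

Definition qstat p n (x : 'I_n -> 'rV[R]_p) : R := sqnorm (\sum_i x i) / n%:R.

Definition vcontinuous p n (F : ('I_n -> 'rV[R]_p) -> R) : Prop :=
  forall x_ x, (forall i, vcvg (fun r => x_ r i) (x i)) -> (fun r => F (x_ r)) @ \oo --> F x.

Lemma vcontinuous_qstat p n : vcontinuous (@qstat p n).
Proof.
move=> x_ x hx; apply: cvgM; last exact: cvg_cst.
by apply: vcvg_sqnorm; apply: vcvg_sum => i; exact: hx.
Qed.

Lemma vcontinuous_Rst p n (a : {set 'I_n}) : vcontinuous (@Rst R p n a).
Proof.
move=> x_ x hx; apply: cvgM; last exact: cvg_cst.
apply: cvgM; first exact: cvg_cst.
apply: vcvg_sqnorm; apply: vcvgD; last apply: vcvgN.
  by apply: (vcvgZ (cvg_cst _)); apply: vcvg_sum => i; exact: hx.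
by apply: (vcvgZ (cvg_cst _)); apply: vcvg_sum => i; exact: hx.
Qed.

Lemma vcontinuous_comp p n (F : ('I_n -> 'rV[R]_p) -> R) (g : R -> R) :
  continuous g -> vcontinuous F -> vcontinuous (g \o F).
Proof. by move=> cg cF x_ x hx; apply: continuous_cvg; [exact: cg | exact: cF]. Qed.

Lemma continuous_fej N : continuous (@fej R N).
Proof.
have -> : @fej R N = fun x => N%:R ^- 2 * \sum_(j < N) \sum_(k < N) cos ((j%:R - k%:R) * x).
  by apply/funext => x; rewrite fejE.
move=> x; apply: cvgM; first exact: cvg_cst.
have add_c : continuous (fun q : R * R => q.1 + q.2) by exact: add_continuous.
apply: (cvg_big add_c) => j _; apply: (cvg_big add_c) => k _.
apply: continuous_cvg; first exact: continuous_cos.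
by apply: cvgM; [exact: cvg_cst | exact: cvg_id].
Qed.

Lemma fej_le1 N (x : R) : fej N x <= 1.
Proof.
rewrite fejE; case: N => [|N]; first by rewrite big_ord0 mulr0.
rewrite ler_pdivrMl ?exprn_gt0// mulr1.
apply: le_trans (_ : \sum_(j < N.+1) \sum_(k < N.+1) 1 <= _).
  by apply: ler_sum => j _; apply: ler_sum => k _; exact: cos_le1.
by rewrite !sumr_const card_ord expr2 mulr_natr.
Qed.

Lemma smooth3_continuous G dG ddG (C : R) : smooth3 G dG ddG C -> continuous G.
Proof.
move=> hG x; apply/cvgrPdist_le => e e0.
have C0 := smooth3_C hG.
near=> y.
have := smooth3_lip hG x (y - x); rewrite subrKC distrC => /le_trans; apply.
have : `|y - x| <= e / (C + 1).
  rewrite distrC; near: y; apply: cvgr_dist_le; first exact: cvg_id.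
  by rewrite divr_gt0// ltr_wpDl.
rewrite ler_pdivlMr ?ltr_wpDl// => h; apply: le_trans h.
by rewrite mulrC ler_wpM2l// lerDl.
Unshelve. all: by end_near. Qed.

Section Fixed.
Context d (T : measurableType d) (P : probability T R) {p : nat} (n : nat).
Variables (X : nat -> T -> 'rV[R]_p) (mu : 'rV[R]_p) (Sigma : 'M[R]_p).
Hypothesis hset : setting P n X mu Sigma.
Local Notation th_inf := (@theta_inf _ T R P p X mu Sigma).
Local Notation lz := (@lawz _ T R P p X mu).
Local Notation Zt t := (@Zn T p n X mu Sigma t).
Local Notation W := (@cellw _ T R P p X mu).
Local Notation gz := (@gridz _ T R P p X mu).

Lemma theta_small (m th : R) : 0 < m -> th_inf m < th -> 
  exists r0, forall r, (r0 <= r)%N -> model (lz r) /\ theta (lz r) m < th.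
Proof.
have [hX n1 hS h4 f0] := hset; move=> m0 hth.
have [r1 [hm _]] := approx_model hX n1 hS h4 f0.
have [r2 _ h2] : \forall r \near \oo, theta (lz r) m < th.
  exact: cvgr_lt (theta_cvg hX n1 hS h4 f0 m0) _ hth.
exists (maxn r1 r2) => r; rewrite geq_max => /andP[q1 q2].
by split; [exact: hm | exact: h2].
Qed.

(** [F] may vary with the mesh because the centre of the covariances is itself a discretised
    mean. *)
Lemma limit_law (F : nat -> ('I_n -> 'rV[R]_p) -> R) (Finf : ('I_n -> 'rV[R]_p) -> R) (B : R) :
  (forall x_ x, (forall i, vcvg (fun r => x_ r i) (x i)) -> (fun r => F r (x_ r)) @ \oo --> Finf x) ->
  (forall r x, `|F r x| <= B) ->
  [/\ measurable_fun setT (fun t => Finf (Zt t)), P.-integrable setT (EFin \o (fun t => Finf (Zt t))),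
      (fun r => En (@W r) (@gz r) (F r)) @ \oo --> \int[P]_t Finf (Zt t) &
      forall D, measurable D -> indep_of P n X D ->
        \int[P]_(t in D) Finf (Zt t) = fine (P D) * \int[P]_t Finf (Zt t)].
Proof.
have [hX n1 hS h4 f0] := hset; move=> cF bF.
have [] := @transfer_ev _ T R P p n X mu hX n1 gz 0 n F (fun t => Finf (Zt t)) (fun=> B) (leqnn n).
- by move=> t; apply: cF => i; exact: (@gridz_cvg _ T R P p n X mu Sigma hX n1 hS h4 f0 i t).
- exact: finite_measure_integrable_cst.
- by move=> r t _; exact: bF.
by [].
Qed.

(** Truncated at [k], the function is a bounded pointwise limit of finitely valued measurable ones;
    then [k] tends to infinity. *)
Lemma measurable_vcontinuous (F : ('I_n -> 'rV[R]_p) -> R) : vcontinuous F ->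
  measurable_fun setT (fun t => F (Zt t)).
Proof.
move=> cF.
have mG (g : R -> R) (B : R) : continuous g -> (forall x, `|g x| <= B) -> measurable_fun setT (fun t => g (F (Zt t))).
  move=> cg bg; have [] := @limit_law (fun=> g \o F) (g \o F) B => //.
  - by move=> x_ x hx; exact: (vcontinuous_comp cg cF).
  - by move=> r x; exact: bg.
pose g (k : nat) (x : R) := Order.max (- k%:R) (Order.min k%:R x).
apply: (@measurable_fun_cvg _ _ _ _ (fun k t => g k (F (Zt t)))) => //.
- move=> k; apply: (mG (g k) k%:R) => x.
    have ck (c : R) : {for x, continuous (fun _ : R => c : R^o)} by exact: cvg_cst.
    have ci : {for x, continuous (fun y : R => y : R^o)} by exact: cvg_id.
    exact: continuous_max (ck _) (continuous_min (ck _) ci).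
  rewrite /g ler_norml; apply/andP; split; first by rewrite le_max lexx.
  by rewrite ge_max ge_min lexx/= andbT; apply: le_trans (ler0n _ _); rewrite oppr_le0.
move=> t _; apply/cvgrPdist_le => e e0; exists (Num.truncn `|F (Zt t)|).+1 => // k /= hk.
have h : `|F (Zt t)| <= k%:R by apply: le_trans (ltW (truncnS_gt _)) _; rewrite ler_nat.
rewrite /g min_r; last exact: le_trans (ler_norm _) h.
rewrite max_r; first by rewrite subrr normr0 ltW.
by move: h; rewrite ler_norml => /andP[].
Qed.

End Fixed.

Lemma anticonc_limit (eta : R) : 0 < eta -> exists M : nat, exists2 th : R, (0 < M)%N /\ 0 < th &
  forall d (T : measurableType d) (P : probability T R) p n (X : nat -> T -> 'rV[R]_p) mu Sigma tau,
  setting P n X mu Sigma -> theta_inf P X mu Sigma n%:R < th ->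
  \int[P]_t fej M ((M ^ 3)%:R * (qstat (Zn X mu Sigma t : 'I_n -> _) - tau)) <= eta.
Proof.
move=> e0; have [M [th [M0 th0] H]] := anticonc e0.
exists M, th => // d T P p n X mu Sigma tau hset hth.
have [hX n1 hS h4 f0] := hset; have n0 : (0 < n)%N := ltnW n1.
have n0' : 0 < n%:R :> R by rewrite ltr0n.
have [r0 hr] := theta_small hset n0' hth.
pose F (x : 'I_n -> 'rV[R]_p) := fej M ((M ^ 3)%:R * (qstat x - tau)).
have cF : vcontinuous F.
  apply: (@vcontinuous_comp _ _ (@qstat p n) (fun y => fej M ((M ^ 3)%:R * (y - tau)))); last exact: vcontinuous_qstat.
  move=> y; apply: continuous_cvg; first exact: continuous_fej.
  by apply: cvgM; [exact: cvg_cst | apply: cvgB; [exact: cvg_id | exact: cvg_cst]].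
have [] := @limit_law _ T P p n X mu Sigma hset (fun=> F) F 1.
- by move=> x_ x; exact: cF.
- by move=> r x; rewrite ger0_norm ?fej_ge0 ?fej_le1.
move=> _ _ c _; apply: (cvgr_to_le c); exists r0 => // r /= hrr.
have [hm ht] := hr r hrr.
rewrite /F /qstat (@En_total _ _ _ _ _ n (fun s => fej M ((M ^ 3)%:R * (sqnorm s / n%:R - tau)))); last by case: hm.
exact: H.
Qed.

(** The second conclusion serves to condition on the values of two random subsets. *)
Lemma pair_limit (C eta : R) : 0 < C -> 0 < eta -> exists th D : R, [/\ 0 < th, 0 < D &
  forall d (T : measurableType d) (P : probability T R) p n (X : nat -> T -> 'rV[R]_p) mu Sigma m G dG ddG,
  let Zt t : 'I_n -> _ := Zn X mu Sigma t in
  let c := \int[P]_t G (qstat (Zt t)) in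
  setting P n X mu Sigma -> theta_inf P X mu Sigma m%:R < th -> (0 < m)%N -> m%:R / n%:R < th ->
  smooth3 G dG ddG C ->
  forall a b : {set 'I_n}, #|a| = m -> #|b| = m ->
  [/\ \int[P]_t ((G (Rst a (Zt t)) - c) * (G (Rst b (Zt t)) - c)) <= eta + D * (#|a :&: b|%:R / m%:R) &
      forall E, measurable E -> indep_of P n X E ->
      \int[P]_(t in E) ((G (Rst a (Zt t)) - c) * (G (Rst b (Zt t)) - c)) =
      fine (P E) * \int[P]_t ((G (Rst a (Zt t)) - c) * (G (Rst b (Zt t)) - c))]].
Proof.
move=> C0 e0; have [th [D [th0 D0 H]]] := pair_bound C0 e0.
exists th, D; split => // d T P p n X mu Sigma m G dG ddG Zt c hset hth m0 hmn hG a b am bm.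
have [hX n1 hS h4 f0] := hset; have n0 : (0 < n)%N := ltnW n1.
have m0' : 0 < m%:R :> R by rewrite ltr0n.
have [r0 hr] := theta_small hset m0' hth.
have cG := smooth3_continuous hG.
have G01 := smooth3_range hG.
have [] := @limit_law _ T P p n X mu Sigma hset (fun=> G \o @qstat p n) (G \o @qstat p n) 1.
- by move=> x_ x; apply: vcontinuous_comp => //; exact: vcontinuous_qstat.
- by move=> r x; have /andP[g0 g1] := G01 (qstat x); rewrite ger0_norm.
move=> _ _ cc _.
(* The finite bound is centred at the discretised mean [cr r], which converges to [c]. *)
pose cr r := En (@cellw _ T R P p X mu r) (@gridz _ T R P p X mu r) (G \o @qstat p n).
have cr1 r : 0 <= cr r <= 1.
  have hl := cell_law_is_law mu hX n0 (@gridz _ T R P p X mu r).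
  have e1 (v : R) : En (@cellw _ T R P p X mu r) (@gridz _ T R P p X mu r) (fun _ : 'I_n -> 'rV[R]_p => v) = v.
    by rewrite (@En_total _ _ _ _ _ n (fun=> v))// Ex_cst//; exact: law_cpow.
  apply/andP; split; [rewrite -[leLHS]e1 | rewrite -[leRHS]e1]; by apply: le_En => // x; have /andP[] := G01 (qstat x).
have [] := @limit_law _ T P p n X mu Sigma hset
   (fun r x => (G (Rst a x) - cr r) * (G (Rst b x) - cr r)) (fun x => (G (Rst a x) - c) * (G (Rst b x) - c)) 1.
- move=> x_ x hx; have h (a' : {set 'I_n}) : (fun r => G (Rst a' (x_ r)) - cr r) @ \oo --> G (Rst a' x) - c.
    by apply: cvgB => //; exact: (vcontinuous_comp cG (@vcontinuous_Rst p n a')).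
  by apply: cvgM; exact: h.
- by move=> r x; rewrite normrM -[X in _ <= X]mulr1; apply: ler_pM => //; apply: range_dist.
move=> _ _ c1 c2; split; last exact: c2.
apply: (cvgr_to_le c1); exists r0 => // r /= hrr.
have [hm ht] := hr r hrr.
exact: (H p _ _ _ n m a b G dG ddG hm hG m0 n0 ht hmn am bm).
Qed.

End Consequences.

(** * Empirical distribution functions *)

Section BoundedIntegrals.
Context d (T : measurableType d) (R : realType) (P : probability T R).
Implicit Types (u v : T -> R) (B : R).

Definition bmeas u : Prop := measurable_fun setT u /\ exists B : R, forall t, `|u t| <= B.

Lemma bmeas_integrable D u : measurable D -> bmeas u -> P.-integrable D (EFin \o u).
Proof. by move=> mD [mu [B hB]]; exact: integrable_bounded hB. Qed.

Lemma bmeas_cst (c : R) : bmeas (fun=> c).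
Proof. by split => //; exists `|c|. Qed.

Lemma bmeasD u v : bmeas u -> bmeas v -> bmeas (fun t => u t + v t).
Proof.
move=> [mu [B hB]] [mv [B' hB']]; split; first exact: measurable_funD.
by exists (B + B') => t; apply: le_trans (ler_normD _ _) (lerD _ _).
Qed.

Lemma bmeasM u v : bmeas u -> bmeas v -> bmeas (fun t => u t * v t).
Proof.
move=> [mu [B hB]] [mv [B' hB']]; split; first exact: measurable_funM.
by exists (B * B') => t; rewrite normrM ler_pM.
Qed.

Lemma bmeas_sum (J : Type) (s : seq J) (F : J -> T -> R) : (forall j, bmeas (F j)) ->
  bmeas (fun t => \sum_(j <- s) F j t).
Proof.
move=> h; elim: s => [|j s ih].
  by under eq_fun do rewrite big_nil; exact: bmeas_cst.
by under eq_fun do rewrite big_cons; exact: bmeasD.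
Qed.

Lemma bmeas_ind (A : T -> bool) : measurable [set t | A t] -> bmeas (fun t => ind (A t)).
Proof.
move=> mA; have -> : (fun t => ind (A t)) = \1_[set t | A t] :> (T -> R).
  apply/funext => t; rewrite indicE /ind; case: ifP => h; first by rewrite mem_set.
  by rewrite memNset//= h.
split; first exact: measurable_indic.
exists 1 => t; rewrite indicE; case: (_ \in _); by rewrite ?normr1 ?normr0.
Qed.

Lemma Rint_cst (c : R) : \int[P]_t c = c.
Proof. by rewrite Rintegral_cst// (_ : fine (P setT) = 1) ?mulr1// probability_setT. Qed.

Lemma le_Rint u v : bmeas u -> bmeas v -> (forall t, u t <= v t) -> \int[P]_t u t <= \int[P]_t v t.
Proof. by move=> hu hv uv; apply: le_Rintegral => //; exact: bmeas_integrable. Qed.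

Lemma Rint_ind (A : T -> bool) : measurable [set t | A t] ->
  \int[P]_t ind (A t) = fine (P [set t | A t]).
Proof.
move=> mA; rewrite /Rintegral (_ : (fun t => (ind (A t))%:E) = fun t => (\1_[set t | A t] t)%:E).
  by rewrite integral_indic// setIT.
apply/funext => t; rewrite indicE /ind; case: ifP => h; first by rewrite mem_set.
by rewrite memNset//= h.
Qed.

Lemma RintD u v : bmeas u -> bmeas v -> \int[P]_t (u t + v t) = \int[P]_t u t + \int[P]_t v t.
Proof. by move=> hu hv; rewrite RintegralD//; exact: bmeas_integrable. Qed.

Lemma RintZ c u : bmeas u -> \int[P]_t (c * u t) = c * \int[P]_t u t.
Proof. by move=> hu; rewrite RintegralZl//; exact: bmeas_integrable. Qed.

Lemma Rint_sum (J : Type) (s : seq J) (F : J -> T -> R) : (forall j, bmeas (F j)) ->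
  \int[P]_t (\sum_(j <- s) F j t) = \sum_(j <- s) \int[P]_t F j t.
Proof.
move=> h; elim: s => [|j s ih].
  by under eq_fun do rewrite big_nil; rewrite big_nil Rint_cst.
under eq_fun do rewrite big_cons; rewrite big_cons RintD// ?ih//; exact: bmeas_sum.
Qed.

(** The indicator of [E] is at most [e^-2] times the sum of the squares: Chebyshev's inequality and
    the union bound in one. *)
Lemma union_chebyshev (J : eqType) (s : seq J) (F : J -> T -> R) (E : set T) (e : R) :
  measurable E -> 0 < e -> (forall j, bmeas (F j)) ->
  (forall t, E t -> exists2 j, j \in s & e <= `|F j t|) ->
  fine (P E) <= e ^- 2 * \sum_(j <- s) \int[P]_t F j t ^+ 2.
Proof.
move=> mE e0 hF hE.
have mE' : measurable [set t | t \in E] by rewrite set_mem_set.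
have hF2 j : bmeas (fun t => F j t ^+ 2) by under eq_fun do rewrite expr2; exact: bmeasM.
have -> : fine (P E) = \int[P]_t ind (t \in E) by rewrite Rint_ind// set_mem_set.
rewrite -Rint_sum// -RintZ; last exact: bmeas_sum.
apply: le_Rint; [exact: bmeas_ind | by apply: bmeasM; [exact: bmeas_cst | exact: bmeas_sum] |].
move=> t; have s0 (s' : seq J) : 0 <= \sum_(j <- s') F j t ^+ 2 by apply: sumr_ge0 => j _; exact: sqr_ge0.
rewrite /ind; case: ifP => [/set_mem/hE [j js hj]|_]; last by rewrite mulr_ge0// invr_ge0 sqr_ge0.
rewrite mulrC ler_pdivlMr ?exprn_gt0// mul1r.
apply: (@le_trans _ _ (F j t ^+ 2)).
  by rewrite -[leRHS]real_normK ?num_real// ler_pXn2r ?nnegrE// ltW.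
elim: s js {hE} => [//|i s ih]; rewrite inE big_cons => /orP[/eqP ->|/ih h]; first by rewrite lerDl.
by apply: le_trans h _; rewrite lerDr sqr_ge0.
Qed.

End BoundedIntegrals.

(** * Uniformity from quantiles, and logistic brackets of indicators *)

Section Polya.
Context {R : realType}.

(** By monotonicity, closeness at approximate quantiles gives closeness everywhere. The levels are
    attained only up to one mesh [1 / (N + 1)], hence the loss of three meshes. *)
Lemma polya (F Fh : R -> R) (N : nat) (x : nat -> R) (k : R) :
  (forall a b, a <= b -> F a <= F b) -> (forall a b, a <= b -> Fh a <= Fh b) ->
  (forall a, 0 <= F a <= 1) -> (forall a, 0 <= Fh a <= 1) -> 0 <= k ->
  (forall i, (i < N)%N -> i.+1%:R / N.+1%:R <= F (x i) <= i.+2%:R / N.+1%:R) ->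
  (forall i, (i < N)%N -> `|Fh (x i) - F (x i)| <= k) ->
  forall t, `|Fh t - F t| <= k + 3 / N.+1%:R.
Proof.
move=> mF mFh bF bFh k0 hx hk t.
have N0 : 0 < N.+1%:R :> R by rewrite ltr0n.
have qE : N%:R = N.+1%:R - 1 :> R by rewrite -natr1; ring.
move: (N.+1%:R : R) N0 hx qE => q N0 hx qE.
have /andP[F0 F1] := bF t; have /andP[G0 G1] := bFh t.
set y := F t * q.
have y0 : 0 <= y by rewrite mulr_ge0 ?(ltW N0).
have /andP[j1 j2] := truncn_itv y0.
set j := Num.truncn y in j1 j2.
rewrite ler_norml; apply/andP; split.
  have [j3|j3] := ltnP j 3.
    have : y < 3 by apply: lt_le_trans j2 _; rewrite ler_nat.
    rewrite /y -ltr_pdivlMr// => h; lra.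
  have jN : (j <= N.+1)%N.
    rewrite -(ler_nat R) -[leRHS]natr1 qE subrK; apply: le_trans j1 _; rewrite /y -[leRHS]mul1r.
    by apply: ler_wpM2r => //; exact: ltW.
  (* The index [j - 3] rather than [j - 2] makes [F (x (j - 3)) <= (j - 1) / q < F t] strict, which
     places the point to the left of [t]. *)
  have iN : (j - 3 < N)%N by rewrite ltn_subLR//; apply: leq_ltn_trans jN _; rewrite !addSn add0n ltnS leqW.
  have /andP[a1 a2] := hx _ iN; have := hk _ iN; rewrite ler_norml => /andP[b1 _].
  have ej : (j - 3)%:R = j%:R - 3 :> R by rewrite natrB.
  have e1 : (j - 3).+1%:R = j%:R - 2 :> R by rewrite -natr1 ej; ring.
  have e2 : (j - 3).+2%:R = j%:R - 1 :> R by rewrite -natr1 e1; ring.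
  have lt : F (x (j - 3)%N) < F t.
    apply: le_lt_trans a2 _; rewrite e2 ltr_pdivrMr//; move: j1; rewrite -/y; lra.
  have xt : x (j - 3)%N <= t.
    by rewrite leNgt; apply/negP => /ltW/mF; rewrite leNgt lt.
  have := mFh _ _ xt.
  have : F t - 3 / q < F (x (j - 3)%N).
    apply: lt_le_trans a1; rewrite e1 ltr_pdivlMr// mulrBl divfK ?gt_eqF//.
    by move: j2; rewrite -/y -natr1; lra.
  lra.
have [jN|jN] := ltnP j N; last first.
  have : N%:R / q <= F t by rewrite ler_pdivrMr// -/y; apply: le_trans j1; rewrite ler_nat.
  have -> : N%:R / q = 1 - 1 / q by rewrite qE; field; rewrite gt_eqF.
  have : 0 <= 1 / q by rewrite divr_ge0// ltW.
  lra.
have /andP[a1 a2] := hx _ jN; have := hk _ jN; rewrite ler_norml => /andP[_ b1].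
have lt : F t < F (x j) by apply: lt_le_trans a1; rewrite ltr_pdivlMr.
have xt : t <= x j by rewrite leNgt; apply/negP => /ltW/mF; rewrite leNgt lt.
have := mFh _ _ xt.
have : F (x j) <= F t + 3 / q.
  apply: le_trans a2 _; rewrite ler_pdivrMr// mulrDl divfK ?gt_eqF//.
  by move: j1; rewrite -/y -!natr1; lra.
lra.
Qed.

Lemma logi_mono (x y : R) : x <= y -> logi x <= logi y.
Proof.
move=> xy; rewrite /logi lerD2l lerN2 lef_pV2 ?posrE ?addr_gt0 ?expR_gt0//.
by rewrite lerD2l ler_expR.
Qed.

Lemma logi_hi (k : R) : 0 < k -> 1 - (1 + k)^-1 <= logi k.
Proof.
move=> k0; rewrite /logi lerD2l lerN2 lef_pV2 ?posrE ?addr_gt0 ?expR_gt0//.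
by rewrite lerD2l; apply: le_trans (expR_ge1Dx _); rewrite lerDr.
Qed.

Lemma logi_lo (k : R) : 0 < k -> logi (- k) <= (1 + k)^-1.
Proof.
move=> k0; have e0 := expR_gt0 k.
have -> : logi (- k) = (1 + expR k)^-1.
  rewrite /logi expRN; field; rewrite !gt_eqF//; lra.
rewrite lef_pV2 ?posrE ?addr_gt0//.
by rewrite lerD2l; apply: le_trans (expR_ge1Dx _); rewrite lerDr.
Qed.

(** Shift [h] and width [h / k] put the argument of [logi] beyond [k], where the tail is at most
    [(1 + k)^-1]. *)
Lemma ind_le_step (tau h k x : R) : 0 < h -> 0 < k ->
  ind (x <= tau - h) <= step tau (h / k) x + (1 + k)^-1.
Proof.
move=> h0 k0; have /andP[l0 l1] := logi_bounds ((tau - x) / (h / k)).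
have i0 : 0 < (1 + k)^-1 by rewrite invr_gt0 addr_gt0.
rewrite /step /ind; case: ifP => hx; last by rewrite addr_ge0// ltW.
have : logi k <= logi ((tau - x) / (h / k)).
  apply: logi_mono; rewrite ler_pdivlMr ?divr_gt0// mulrC divfK ?gt_eqF//.
  by move: hx; lra.
have := logi_hi k0; lra.
Qed.

Lemma step_le_ind (tau h k x : R) : 0 < h -> 0 < k ->
  step tau (h / k) x <= ind (x <= tau + h) + (1 + k)^-1.
Proof.
move=> h0 k0; have /andP[l0 l1] := logi_bounds ((tau - x) / (h / k)).
have i0 : 0 < (1 + k)^-1 by rewrite invr_gt0 addr_gt0.
rewrite /step /ind; case: ifP => hx; first by rewrite -[leLHS]addr0 lerD// ltW.
have : logi ((tau - x) / (h / k)) <= logi (- k).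
  apply: logi_mono; rewrite ler_pdivrMr ?divr_gt0// mulNr [k * _]mulrC divfK ?gt_eqF//.
  by move: hx => /negbT; rewrite -ltNge; lra.
have := logi_lo k0; rewrite add0r; lra.
Qed.

End Polya.

(** * Uniform deviation of an empirical distribution function *)

Section Empirical.
Context d (T : measurableType d) (R : realType) (P : probability T R).
Variable Q : T -> R.
Hypothesis mQ : measurable_fun setT Q.

Definition cdfR (x : R) : R := fine (P [set t | Q t <= x]).

Let Qm : {RV P >-> R} := mfun_Sub (mem_set mQ).

Lemma cdfRE x : cdfR x = fine (cdf Qm x).
Proof.
rewrite /cdfR /cdf /distribution /pushforward; congr (fine (P _)).
Qed.

Lemma measurable_le (f : T -> R) x : measurable_fun setT f -> measurable [set t | f t <= x].
Proof.
move=> mf; rewrite -[X in measurable X]setTI (_ : [set t | f t <= x] = f @^-1` `]-oo, x]).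
  exact: mf.
by apply/seteqP; split => t /=; rewrite in_itv.
Qed.

Lemma cdfR_int x : cdfR x = \int[P]_t ind (Q t <= x).
Proof. by rewrite Rint_ind//; exact: measurable_le. Qed.

Lemma cdfR_bounds x : 0 <= cdfR x <= 1.
Proof.
rewrite cdfRE fine_ge0 ?cdf_ge0//= -lee_fin fineK; first exact: cdf_le1.
exact: fin_num_measure.
Qed.

Lemma cdfR_mono x y : x <= y -> cdfR x <= cdfR y.
Proof.
move=> xy; rewrite !cdfRE; apply: fine_le; try exact: fin_num_measure.
exact: cdf_nondecreasing.
Qed.

Lemma cdfR_rc x : cdfR @ x^'+ --> cdfR x.
Proof.
rewrite (_ : cdfR = fun x => fine (cdf Qm x)); last by apply/funext => y; exact: cdfRE.
apply: fine_cvg; rewrite fineK; last exact: fin_num_measure.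
exact: cdf_right_continuous.
Qed.

Lemma cdfR_hi e : 0 < e -> exists x, 1 - e < cdfR x.
Proof.
move=> e0; have : cdfR @ +oo --> (1 : R).
  rewrite (_ : cdfR = fun x => fine (cdf Qm x)); last by apply/funext => y; exact: cdfRE.
  exact: fine_cvg (cvg_cdfy1 Qm).
move=> /cvgrPdist_lt/(_ e e0) [x [_ h]]; exists (x + 1).
have := h (x + 1); rewrite ltrDl ltr01 ltr_norml => /(_ isT) /andP[_]; lra.
Qed.

Lemma cdfR_lo e : 0 < e -> exists x, cdfR x < e.
Proof.
move=> e0; have : cdfR @ -oo --> (0 : R).
  rewrite (_ : cdfR = fun x => fine (cdf Qm x)); last by apply/funext => y; exact: cdfRE.
  exact: fine_cvg (cvg_cdfNy0 Qm).
move=> /cvgrPdist_lt/(_ e e0) [x [_ h]]; exists (x - 1).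
have := h (x - 1); rewrite ltrBlDr ltrDl ltr01 ltr_norml => /(_ isT) /andP[]; lra.
Qed.

(* No tail bound is needed: the increments being at most [r], every level is nearly attained. *)
Lemma quantile (h r a : R) : 0 < h -> (forall x, cdfR (x + 2 * h) <= cdfR x + r) ->
  0 < a < 1 -> exists x, a <= cdfR x <= a + r.
Proof.
move=> h0 hr /andP[a0 a1].
pose S := [set x : R | cdfR x < a].
have Sne : S !=set0 by have [x hx] := cdfR_lo a0; exists x.
have Sub : has_ubound S.
  have a1' : 0 < 1 - a by rewrite subr_gt0.
  have [x hx] := cdfR_hi a1'; exists x => y /= hy; rewrite leNgt; apply/negP => /ltW/cdfR_mono.
  by move: hx hy; rewrite /S/=; lra.
have Ss : has_sup S by [].
have [y Sy hy] := sup_adherent h0 Ss.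
(* [sup S + h] is outside [S], and some point of [S] lies above [sup S - h]; one increment over
   [2 h] links the two. *)
exists (sup S + h); apply/andP; split.
  rewrite leNgt; apply/negP => hc; have : S (sup S + h) by [].
  by move/(ub_le_sup Sub); rewrite gerDl leNgt h0.
have := hr (sup S - h); rewrite (_ : sup S - h + 2 * h = sup S + h); last by ring.
move=> /le_trans; apply; rewrite lerD2r; apply: le_trans (ltW Sy).
by apply: cdfR_mono; exact: ltW.
Qed.

Variables (L : nat) (Rj : 'I_L -> T -> R).
Hypothesis L0 : (0 < L)%N.
Hypothesis mR : forall j, measurable_fun setT (Rj j).

Definition ecdf (t : T) (x : R) : R := L%:R^-1 * \sum_(j < L) ind (Rj j t <= x).

Let L0' : 0 < L%:R :> R. Proof. by rewrite ltr0n. Qed.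

Lemma avg_cst (c : R) : L%:R^-1 * \sum_(j < L) c = c.
Proof. by rewrite sumr_const card_ord -[c *+ L]mulr_natl mulKf// gt_eqF. Qed.

Lemma le_avg (f g : 'I_L -> R) : (forall j, f j <= g j) ->
  L%:R^-1 * \sum_(j < L) f j <= L%:R^-1 * \sum_(j < L) g j.
Proof. by move=> h; rewrite ler_wpM2l ?invr_ge0 ?(ltW L0')//; apply: ler_sum => j _. Qed.

Lemma avgD (f : 'I_L -> R) c : L%:R^-1 * \sum_(j < L) (f j + c) = L%:R^-1 * (\sum_(j < L) f j) + c.
Proof. by rewrite big_split mulrDr avg_cst. Qed.

Lemma ind01 (b : bool) : 0 <= (ind b : R) <= 1.
Proof. by case: b; rewrite /ind ?lexx ?ler01. Qed.

Lemma ind_mono (x a b : R) : a <= b -> ind (x <= a) <= ind (x <= b) :> R.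
Proof.
move=> ab; rewrite {1}/ind; case: ifP => h; last by have /andP[] := ind01 (x <= b).
by rewrite (le_trans h ab).
Qed.

Lemma ecdf_bounds t x : 0 <= ecdf t x <= 1.
Proof.
rewrite /ecdf; apply/andP; split; [rewrite -[leLHS](avg_cst 0) | rewrite -[leRHS](avg_cst 1)];
  by apply: le_avg => j; have /andP[] := ind01 (Rj j t <= x).
Qed.

Lemma ecdf_mono t x y : x <= y -> ecdf t x <= ecdf t y.
Proof. by move=> xy; apply: le_avg => j; exact: ind_mono. Qed.

Lemma ecdf_rc t x : ecdf t @ x^'+ --> ecdf t x.
Proof.
apply: cvgM; first exact: cvg_cst.
have add_c : continuous (fun q : R * R => q.1 + q.2) by exact: add_continuous.
apply: (cvg_big add_c) => j _.
apply: cvg_near_cst; case: (leP (Rj j t) x) => h.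
  by apply: filterS (nbhs_right_gt x) => y /ltW xy; rewrite (le_trans h xy).
by apply: filterS (nbhs_right_lt h) => y yR; rewrite leNgt yR.
Qed.

Lemma bmeas_ecdf x : bmeas (fun t => ecdf t x).
Proof.
apply: bmeasM; first exact: bmeas_cst.
by apply: bmeas_sum => j; apply: bmeas_ind; exact: measurable_le.
Qed.

Definition dev_event (eps : R) : set T := [set t | exists x, eps < `|ecdf t x - cdfR x|].

(** Both functions are right-continuous, so the existential over the reals reduces to the
    rationals. *)
Lemma measurable_dev eps : measurable (dev_event eps).
Proof.
rewrite (_ : dev_event eps = \bigcup_(q : rat) [set t | eps < `|ecdf t (ratr q) - cdfR (ratr q)|]).
  apply: bigcupT_measurable_rat => q.
  have [m _] := bmeas_ecdf (ratr q).
  have m2 : measurable_fun setT (fun t => `|ecdf t (ratr q) - cdfR (ratr q)|).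
    by apply: measurableT_comp => //; exact: measurable_funB.
  have := m2 measurableT `]eps, +oo[%classic (measurable_itv _); rewrite setTI.
  by congr measurable; apply/seteqP; split => t /=; rewrite in_itv/= andbT.
apply/seteqP; split => [t [x hx]|t [q _ hq]]; last by exists (ratr q).
have h : (fun y => `|ecdf t y - cdfR y|) @ x^'+ --> `|ecdf t x - cdfR x|.
  by apply: cvg_norm; apply: cvgB; [exact: ecdf_rc | exact: cdfR_rc].
have [e e0 he] := cvgr_gt _ h _ hx.
have xe : x < x + e by rewrite ltrDl.
have [q] := rat_in_itvoo xe; rewrite in_itv/= => /andP[q1 q2].
exists q => //; apply: he => //=.
by rewrite ltr_norml; apply/andP; split; move: e0 q1 q2; rewrite /=; lra.
Qed.

Definition dev_step (tau e : R) (t : T) : R :=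
  L%:R^-1 * (\sum_(j < L) step tau e (Rj j t)) - \int[P]_t' step tau e (Q t').

Lemma bmeas_step tau e (f : T -> R) : 0 < e <= 1 -> measurable_fun setT f ->
  bmeas (fun t => step tau e (f t)).
Proof.
move=> he mf; have [dG [ddG hG]] := step_smooth tau he.
split; last by exists 1 => t; have /andP[g0 g1] := smooth3_range hG (f t); rewrite ger0_norm.
apply: measurableT_comp mf; apply: continuous_measurable_fun; exact: smooth3_continuous hG.
Qed.

Lemma bmeas_dev_step tau e : 0 < e <= 1 -> bmeas (dev_step tau e).
Proof.
move=> he; apply: bmeasD; last exact: bmeas_cst.
apply: bmeasM; first exact: bmeas_cst.
by apply: bmeas_sum => j; exact: bmeas_step.
Qed.

(** The step at [x_i + h] majorises the indicator at [x_i] and the one at [x_i - h] minorises it, up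
    to [(1 + k)^-1], which makes [2 N] tests. Passing back to the true distribution function moves
    its argument by [2 h] at the cost of one mesh, and [polya] costs three more. *)
Lemma ecdf_close (h k e' nu eps : R) (N : nat) : 0 < h -> 0 < k -> h / k <= 1 -> 0 < e' ->
  (forall x, cdfR (x + 2 * h) <= cdfR x + N.+1%:R^-1) ->
  (forall tau, \int[P]_t dev_step tau (h / k) t ^+ 2 <= nu) ->
  e' + 2 * (1 + k)^-1 + 4 / N.+1%:R <= eps ->
  fine (P (dev_event eps)) <= e' ^- 2 * ((2 * N)%:R * nu).
Proof.
move=> h0 k0 hk1 e0 hF hnu heps.
have he : 0 < h / k <= 1 by rewrite divr_gt0.
set ka := (1 + k)^-1 in heps.
have ka0 : 0 < ka by rewrite invr_gt0 addr_gt0.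
have N0 : 0 < N.+1%:R :> R by rewrite ltr0n.
have Ni0 : 0 < N.+1%:R^-1 :> R by rewrite invr_gt0.
have hq (i : nat) : exists x, (i < N)%N -> i.+1%:R / N.+1%:R <= cdfR x <= i.+2%:R / N.+1%:R.
  case: (ltnP i N) => iN; last by exists 0.
  have a01 : 0 < (i.+1%:R / N.+1%:R : R) < 1.
    by rewrite divr_gt0//= ltr_pdivrMr// mul1r ltr_nat.
  have [x hx] := quantile h0 hF a01; exists x => _.
  by move: hx; rewrite -[i.+2%:R]natr1 mulrDl mul1r.
have [x hx] := choice hq.
pose pt (j : nat * bool) := x j.1 + (if j.2 then h else - h).
pose s := allpairs pair (iota 0 N) [:: true; false].
have hm := measurable_dev eps.
apply: le_trans (_ : e' ^- 2 * \sum_(j <- s) \int[P]_t dev_step (pt j) (h / k) t ^+ 2 <= _); last first.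
  rewrite ler_wpM2l ?invr_ge0 ?sqr_ge0//.
  apply: le_trans (_ : \sum_(j <- s) nu <= _); first by apply: ler_sum => j _.
  by rewrite big_const_seq count_predT iter_addr_0 size_allpairs size_iota/= mulnC mulr_natl.
apply: union_chebyshev => //; first by move=> j; exact: bmeas_dev_step.
move=> t [y hy]; apply: contrapT => hc.
have hW i b : (i < N)%N -> `|dev_step (pt (i, b)) (h / k) t| < e'.
  move=> iN; rewrite ltNge; apply/negP => hle; apply: hc; exists (i, b) => //.
  by apply/allpairsP; exists (i, b); rewrite /= mem_iota; split => //; case: b {hle}; rewrite !inE.
have mf tau : bmeas (fun t => step tau (h / k) (Q t)) by exact: bmeas_step.
have mi z : bmeas (fun t => ind (Q t <= z)) by apply: bmeas_ind; exact: measurable_le.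
have c_hi tau : \int[P]_t step tau (h / k) (Q t) <= cdfR (tau + h) + ka.
  rewrite cdfR_int -(Rint_cst P ka) -RintD//; last exact: bmeas_cst.
  apply: le_Rint => //; first by apply: bmeasD => //; exact: bmeas_cst.
  by move=> z; exact: step_le_ind.
have c_lo tau : cdfR (tau - h) <= \int[P]_t step tau (h / k) (Q t) + ka.
  rewrite cdfR_int -(Rint_cst P ka) -RintD//; last exact: bmeas_cst.
  apply: le_Rint => //; first by apply: bmeasD => //; exact: bmeas_cst.
  by move=> z; exact: ind_le_step.
have hd i : (i < N)%N -> `|ecdf t (x i) - cdfR (x i)| <= e' + 2 * ka + N.+1%:R^-1.
  move=> iN; have := hW i true iN; have := hW i false iN; rewrite !ltr_norml /dev_step /pt /=.
  have a1 : ecdf t (x i) <= L%:R^-1 * (\sum_(j < L) step (x i + h) (h / k) (Rj j t)) + ka.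
    rewrite -avgD; apply: le_avg => j.
    by have := ind_le_step (x i + h) (Rj j t) h0 k0; rewrite addrK.
  have a2 : L%:R^-1 * (\sum_(j < L) step (x i - h) (h / k) (Rj j t)) <= ecdf t (x i) + ka.
    rewrite -avgD; apply: le_avg => j.
    by have := step_le_ind (x i - h) (Rj j t) h0 k0; rewrite subrK.
  have b1 := c_hi (x i + h); have b2 := c_lo (x i - h).
  have f1 := hF (x i); have f2 := hF (x i - h - h).
  rewrite (_ : x i - h - h + 2 * h = x i) in f2; last by ring.
  rewrite (_ : x i + h + h = x i + 2 * h) in b1; last by ring.
  move: a1 a2 b1 b2 f1 f2; set u1 := L%:R^-1 * _; set u2 := L%:R^-1 * _.
  set v1 := \int[P]_t' _; set v2 := \int[P]_t' _.
  move: (N.+1%:R^-1) => q a1 a2 b1 b2 f1 f2 /andP[w2 _] /andP[_ w1].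
  by rewrite ler_norml; apply/andP; split; lra.
have k'0 : 0 <= e' + 2 * ka + N.+1%:R^-1 by rewrite !addr_ge0 ?mulr_ge0// ltW.
have := polya cdfR_mono (@ecdf_mono t) cdfR_bounds (ecdf_bounds t) k'0 hx hd y.
by move=> /(lt_le_trans hy); move: heps; move: (N.+1%:R^-1) => q; lra.
Qed.

End Empirical.

(** * Blocks and random subsets *)

Section Assembly.
Context {R : realType}.

(** The interval [(x, x + 2 h]] with [h = M^-4] lies in the window around [x + h] where [fej_lb]
    gives [4 fej >= 1]. *)
Lemma cdf_increment d (T : measurableType d) (P : probability T R) (Q : T -> R) (M : nat) (r : R) :
  measurable_fun setT Q -> (0 < M)%N ->
  (forall tau, \int[P]_t fej M ((M ^ 3)%:R * (Q t - tau)) <= r / 4) ->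
  forall x, cdfR P Q (x + 2 * (M ^ 4)%:R^-1) <= cdfR P Q x + r.
Proof.
move=> mQ M0 hr x; set h : R := (M ^ 4)%:R^-1.
have M4 : 0 < (M ^ 4)%:R :> R by rewrite ltr0n expn_gt0 M0.
have h0 : 0 < h by rewrite invr_gt0.
have mi z : bmeas (fun t => ind (Q t <= z) : R) by apply: bmeas_ind; exact: measurable_le.
have mf : bmeas (fun t => fej M ((M ^ 3)%:R * (Q t - (x + h)))).
  split; last by exists 1 => t; rewrite ger0_norm ?fej_ge0 ?fej_le1.
  apply: measurableT_comp; first by apply: continuous_measurable_fun; exact: continuous_fej.
  by apply: measurable_funM => //; exact: measurable_funB.
rewrite !cdfR_int//; apply: (@le_trans _ _ (\int[P]_t (ind (Q t <= x) + 4 * fej M ((M ^ 3)%:R * (Q t - (x + h)))))).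
  apply: le_Rint => //; first by apply: bmeasD => //; apply: bmeasM => //; exact: bmeas_cst.
  move=> t; have f0 := fej_ge0 M ((M ^ 3)%:R * (Q t - (x + h))).
  rewrite /ind; case: ifP => h1; case: ifP => h2; rewrite ?add0r ?mulr_ge0// ?lerDl ?mulr_ge0//; last first.
    by rewrite addr_ge0// mulr_ge0.
  rewrite mulrC -ler_pdivrMr//; apply: fej_lb => //.
  rewrite normrM ger0_norm// mulrA -natrM -expnS -ler_pdivlMl// mulr1 -/h.
  by move: h1 (negbT h2); rewrite -ltNge ler_norml => a1 a2; apply/andP; split; lra.
rewrite RintD//; last by apply: bmeasM => //; exact: bmeas_cst.
rewrite lerD2l RintZ// mulrC -ler_pdivlMr//; exact: hr.
Qed.

Definition Qn (T : Type) p n (X : nat -> T -> 'rV[R]_p) mu (Sigma : 'M[R]_p) (t : T) : R :=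
  qstat (Zn X mu Sigma t : 'I_n -> _).

(** Common to blocks and random subsets: what is left to each is a mean-square bound on the smoothed
    deviations. *)
Lemma assembly (eps eta : R) : 0 < eps -> 0 < eta ->
  exists e nu th : R, [/\ 0 < e <= 1, 0 < nu, 0 < th &
  forall d (T : measurableType d) (P : probability T R) p n (X : nat -> T -> 'rV[R]_p) mu Sigma
    L (Rj : 'I_L -> T -> R),
  setting P n X mu Sigma -> theta_inf P X mu Sigma n%:R < th -> (0 < L)%N ->
  (forall j, measurable_fun setT (Rj j)) ->
  (forall tau, \int[P]_t dev_step P (Qn n X mu Sigma) Rj tau e t ^+ 2 <= nu) ->
  measurable (dev_event P (Qn n X mu Sigma) Rj eps) /\
  fine (P (dev_event P (Qn n X mu Sigma) Rj eps)) <= eta].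
Proof.
move=> eps0 eta0.
(* The budget is [eps / 4] each for the meshes [4 / (N + 1)], the logistic tails and the test level
   [e']. *)
pose N := Num.truncn (16 / eps).
have hN : 16 / eps < N.+1%:R by exact: truncnS_gt.
have N0 : 0 < N.+1%:R :> R by rewrite ltr0n.
pose r : R := N.+1%:R^-1.
have r0 : 0 < r by rewrite invr_gt0.
have r4 : 0 < r / 4 by rewrite divr_gt0.
have [M [th [M0 th0] H]] := anticonc_limit r4.
have M4 : 1 <= (M ^ 4)%:R :> R by rewrite ler1n expn_gt0 M0.
have M4' : 0 < (M ^ 4)%:R :> R by apply: lt_le_trans M4.
pose h : R := (M ^ 4)%:R^-1.
have h0 : 0 < h by rewrite invr_gt0.
have h1 : h <= 1 by rewrite invf_le1.
pose k : R := 8 / eps + 1.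
have k1 : 1 < k by rewrite ltrDr divr_gt0.
have k0 : 0 < k by apply: lt_trans k1.
have hk : h / k <= 1 by rewrite ler_pdivrMr// mul1r (le_trans h1)// ltW.
pose e' := eps / 4.
have e0 : 0 < e' by rewrite divr_gt0.
have D0 : 0 < (2 * N)%:R + 1 :> R by rewrite ltr_wpDl.
(* The [2 N] Chebyshev bounds at level [e'] must add up to at most [eta]; the added 1 keeps the
   divisor positive when [N = 0]. *)
pose nu := eta * e' ^+ 2 / ((2 * N)%:R + 1).
have nu0 : 0 < nu by rewrite divr_gt0// mulr_gt0// exprn_gt0.
exists (h / k), nu, th; split => //; first by rewrite divr_gt0.
move=> d T P p n X mu Sigma L Rj hset hth L0 mR hnu.
have mQ : measurable_fun setT (Qn n X mu Sigma).
  exact: (measurable_vcontinuous hset (@vcontinuous_qstat R p n)).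
split; first exact: measurable_dev.
apply: le_trans (ecdf_close mQ L0 mR h0 k0 hk e0 (cdf_increment mQ M0 _) hnu _) _.
- by move=> tau; exact: H.
- have i1 : (1 + k)^-1 <= eps / 8.
    rewrite -[leLHS]div1r ler_pdivrMr; last exact: addr_gt0.
    have -> : eps / 8 * (1 + k) = eps / 4 + 1 by rewrite /k; field; rewrite gt_eqF.
    by rewrite lerDr divr_ge0// ltW.
  have i2 : 4 / N.+1%:R <= eps / 4.
    rewrite ler_pdivrMr//; move: hN; rewrite ltr_pdivrMr//; move: (N.+1%:R : R) => q; lra.
  by rewrite /e'; move: i1 i2; move: (4 / N.+1%:R) ((1 + k)^-1) => q1 q2; lra.
rewrite /nu; have a0 : 0 <= (2 * N)%:R :> R by [].
move: ((2 * N)%:R : R) a0 D0 (e') e0 => a a0 D0 f f0.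
have -> : f ^- 2 * (a * (eta * f ^+ 2 / (a + 1))) = eta * (a / (a + 1)).
  by field; rewrite !gt_eqF.
by rewrite ger_pMr// ler_pdivrMr// mul1r lerDl.
Qed.

Lemma dev_step_sq d (T : measurableType d) (P : probability T R) (Q : T -> R) L (Rj : 'I_L -> T -> R) tau e :
  (0 < L)%N -> 0 < e <= 1 -> (forall j, measurable_fun setT (Rj j)) ->
  let c := \int[P]_t step tau e (Q t) in
  \int[P]_t dev_step P Q Rj tau e t ^+ 2 =
  L%:R^-1 ^+ 2 * \sum_(j < L) \sum_(k < L)
     \int[P]_t ((step tau e (Rj j t) - c) * (step tau e (Rj k t) - c)).
Proof.
move=> L0 he mR c.
have L0' : 0 < L%:R :> R by rewrite ltr0n.
have mY j : bmeas (fun t => step tau e (Rj j t) - c).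
  by apply: bmeasD; [exact: bmeas_step | exact: bmeas_cst].
have mYY j k : bmeas (fun t => (step tau e (Rj j t) - c) * (step tau e (Rj k t) - c)) by exact: bmeasM.
under eq_bigr do rewrite -Rint_sum//.
rewrite -Rint_sum; last by move=> j; exact: bmeas_sum.
rewrite -RintZ; last by apply: bmeas_sum => j; exact: bmeas_sum.
congr (Rintegral _ _ _); apply/funext => t.
rewrite /dev_step -/c -{1}(avg_cst L0 c) -mulrBr -sumrB exprMn; congr (_ * _).
by rewrite expr2 mulr_suml; apply: eq_bigr => j _; rewrite mulr_sumr.
Qed.

End Assembly.

(** * Statistics of consecutive blocks *)

Section FixedSampleSize.
Context {R : realType}.

Lemma mean_shift p (s : R) (mu : 'rV[R]_p) (I : finType) (a : {set I}) (x : I -> 'rV[R]_p) : (0 < #|a|)%N ->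
  #|a|%:R^-1 *: (\sum_(i in a) s *: (x i - mu)) = s *: (#|a|%:R^-1 *: (\sum_(i in a) x i) - mu).
Proof.
move=> a0; have a1 : #|a|%:R != 0 :> R by rewrite pnatr_eq0 -lt0n.
rewrite -scaler_sumr sumrB sumr_const scalerA mulrC -scalerA scalerBr; congr (_ *: (_ - _)).
by rewrite -[mu *+ _]scaler_nat scalerA mulVf// scale1r.
Qed.

Lemma total_mean_shift p (s : R) (mu : 'rV[R]_p) n (x : 'I_n -> 'rV[R]_p) : (0 < n)%N ->
  n%:R^-1 *: (\sum_i s *: (x i - mu)) = s *: (n%:R^-1 *: (\sum_i x i) - mu).
Proof.
move=> n0; have := @mean_shift p s mu _ (finset.setT : {set 'I_n}) x.
rewrite cardsT card_ord => /(_ n0).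
have E (F : 'I_n -> 'rV[R]_p) : \sum_(i in (finset.setT : {set 'I_n})) F i = \sum_i F i.
  by apply: eq_bigl => i; rewrite finset.in_setT.
by rewrite !E.
Qed.

Lemma Rst_Zn (T : Type) p n (X : nat -> T -> 'rV[R]_p) mu (Sigma : 'M[R]_p) (a : {set 'I_n}) t :
  (0 < #|a|)%N -> (0 < n)%N ->
  Rst a (Zn X mu Sigma t) = scale (ff Sigma) ^+ 2 *
    (#|a|%:R * sqnorm (subset_mean X a t - sample_mean n X t) / (1 - #|a|%:R / n%:R)).
Proof.
move=> a0 n0; rewrite /Rst /Zn (mean_shift _ _ _ a0) (total_mean_shift _ _ _ n0).
rewrite -scalerBr opprB subrKA.
by rewrite sqnormZ /subset_mean /sample_mean; ring.
Qed.

Lemma Qn_mean (T : Type) p n (X : nat -> T -> 'rV[R]_p) mu (Sigma : 'M[R]_p) t : (0 < n)%N ->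
  Qn n X mu Sigma t = scale (ff Sigma) ^+ 2 * (n%:R * sqnorm (sample_mean n X t - mu)).
Proof.
move=> n0; have n1 : n%:R != 0 :> R by rewrite pnatr_eq0 -lt0n.
rewrite /Qn /qstat /Zn; have := total_mean_shift (scale (ff Sigma)) mu (fun i : 'I_n => X i t) n0.
move=> /(congr1 (fun v => n%:R *: v)); rewrite scalerA mulfV// scale1r => ->.
by rewrite !sqnormZ /sample_mean; field.
Qed.

Definition block n m j : {set 'I_n} := finset (fun i : 'I_n => (j * m <= i < j.+1 * m)%N).

Lemma sum_block (V : nmodType) n m j (f : nat -> V) : (j < n %/ m)%N ->
  \sum_(i in block n m j) f (nat_of_ord i) = \sum_(l < m) f (j * m + l)%N.
Proof.
move=> jL; have hjm : (j.+1 * m <= n)%N by apply: leq_trans (leq_trunc_div n m); rewrite leq_mul2r jL orbT.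
rewrite (eq_bigl (fun i : 'I_n => (j * m <= i < j.+1 * m)%N)); last by move=> i; rewrite finset.inE.
have -> : \sum_(l < m) f (j * m + l)%N = \sum_(j * m <= i < j.+1 * m) f i.
  by rewrite -[X in _ = \sum_(X <= _ < _) _]add0n; rewrite big_addn mulSn addnK big_mkord; apply: eq_bigr => l _; rewrite addnC.
have /= <- := @big_mkord V 0 +%R n (fun i => (j * m <= i < j.+1 * m)%N) f.
rewrite (@big_nat_widen _ _ _ _ _ _ _ _ hjm) (@big_nat_widenl _ _ _ (j * m) 0%N)//=.
by apply: eq_bigl => i; rewrite andbC.
Qed.

Lemma card_block n m j : (j < n %/ m)%N -> #|block n m j| = m.
Proof.
move=> jL; rewrite -sum1_card (sum_block (fun=> 1%N) jL).
by rewrite sum1_card card_ord.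
Qed.

Lemma block_disjoint n m j k : j != k -> #|block n m j :&: block n m k| = 0%N.
Proof.
move=> jk; apply/eqP; rewrite cards_eq0; apply/eqP/setP => i; rewrite !finset.inE.
apply/negP => /andP[/andP[a1 a2] /andP[b1 b2]].
wlog lt : j k jk a1 a2 b1 b2 / (j < k)%N.
  move=> H; move: (jk); rewrite neq_ltn => /orP[h|h]; first exact: (H j k).
  by apply: (H k j) => //; rewrite eq_sym.
have : (j.+1 * m <= k * m)%N by rewrite leq_mul2r lt orbT.
by move=> /(leq_trans a2); move: b1 => /leq_ltn_trans h /h; rewrite ltnn.
Qed.

(** Distinct blocks do not overlap, so each off-diagonal term is at most [nu / 2]; the [L] diagonal
    terms contribute at most [D / L] in addition, where [L >= n / (2 m)]. *)
Lemma block_close (eps eta : R) : 0 < eps -> 0 < eta -> exists2 th : R, 0 < th &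
  forall d (T : measurableType d) (P : probability T R) p n m (X : nat -> T -> 'rV[R]_p) mu Sigma,
  setting P n X mu Sigma -> (0 < m)%N -> theta_inf P X mu Sigma n%:R < th ->
  theta_inf P X mu Sigma m%:R < th -> m%:R / n%:R < th ->
  measurable [set w | exists t : R, eps < `|Fhat n m X w t - Ftrue P n X mu t|] /\
  fine (P [set w | exists t : R, eps < `|Fhat n m X w t - Ftrue P n X mu t|]) <= eta.
Proof.
move=> eps0 eta0; have [e [nu [th1 [he nu0 th10 H]]]] := assembly eps0 eta0.
have e0 : 0 < e by case/andP: he.
have nu2 : 0 < nu / 2 by rewrite divr_gt0.
have C0 : 0 < 2 / e ^+ 3 by rewrite divr_gt0// exprn_gt0.
have [th2 [D [th20 D0 H2]]] := pair_limit C0 nu2.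
have th30 : 0 < nu / (4 * D) by rewrite divr_gt0// mulr_gt0.
(* [m / n < nu / (4 D)] gives [D / L <= nu / 2]; the bound 1/2 gives [2 m < n] and keeps [1 - m / n]
   positive. *)
exists (Num.min (Num.min th1 th2) (Num.min (1 / 2) (nu / (4 * D)))).
  by rewrite !lt_min th10 th20 th30 divr_gt0.
move=> d T P p n m X mu Sigma hset m0; rewrite !lt_min.
move=> /andP[/andP[q1 _] _] /andP[/andP[_ q2] _] /andP[/andP[_ q3] /andP[q4 q5]].
have [hX n1 hS h4 f0] := hset; have n0 : (0 < n)%N := ltnW n1.
have n0' : 0 < n%:R :> R by rewrite ltr0n.
have m0' : 0 < m%:R :> R by rewrite ltr0n.
have s0 := scale_gt0 f0.
set L := (n %/ m)%N.
have mn : (2 * m < n)%N.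
  by rewrite -(ltr_nat R) natrM; move: q4; rewrite ltr_pdivrMr//; lra.
have L0 : (0 < L)%N by rewrite divn_gt0//; apply: leq_trans (ltnW mn); rewrite leq_pmull.
have L0' : 0 < L%:R :> R by rewrite ltr0n.
have hL : n%:R <= 2 * L%:R * m%:R :> R.
  rewrite -!natrM ler_nat {1}(divn_eq n m) -/L -mulnA mul2n -addnn leq_add2l.
  by apply: leq_trans (ltnW (ltn_pmod n m0)) _; rewrite leq_pmull.
pose Rj (j : 'I_L) t := Rst (block n m j) (Zn X mu Sigma t).
have mR j : measurable_fun setT (Rj j).
  exact: (measurable_vcontinuous hset (@vcontinuous_Rst R p n (block n m j))).
have nz : 0 < 1 - m%:R / n%:R :> R by move: q4; lra.
(* Multiplying [t] by the positive factor [scale (ff Sigma) ^+ 2] maps the line onto itself, so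
   normalising does not change the event. *)
have hev : [set w | exists t : R, eps < `|Fhat n m X w t - Ftrue P n X mu t|] =
           dev_event P (Qn n X mu Sigma) Rj eps.
  have s2 : 0 < scale (ff Sigma) ^+ 2 by rewrite exprn_gt0.
  have E w t : Fhat n m X w t - Ftrue P n X mu t =
     ecdf Rj w (scale (ff Sigma) ^+ 2 * t) - cdfR P (Qn n X mu Sigma) (scale (ff Sigma) ^+ 2 * t).
    congr (_ - _); last first.
      rewrite /Ftrue /cdfR; congr (fine (P _)); apply/seteqP.
      by split => z /=; rewrite Qn_mean// ler_pM2l.
    rewrite /Fhat /ecdf -/L; congr (_ * _); apply: eq_bigr => j _; congr ind.
    rewrite /Rj Rst_Zn ?card_block//; rewrite ler_pM2l// ler_pdivrMr//.
    congr (_ * sqnorm (_ - _) <= _); rewrite /subset_mean /block_mean card_block//.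
    by rewrite (sum_block (fun i => X i w)).
  apply/seteqP; split => w [t ht]; first by exists (scale (ff Sigma) ^+ 2 * t); rewrite -E.
  exists ((scale (ff Sigma) ^+ 2)^-1 * t); move: ht; rewrite E mulVKf// gt_eqF//.
rewrite hev; apply: H => // tau.
rewrite dev_step_sq//; set c := \int[P]_t _.
have [dG [ddG hG]] := step_smooth tau he.
have hp (j k : 'I_L) : \int[P]_t ((step tau e (Rj j t) - c) * (step tau e (Rj k t) - c)) <=
   nu / 2 + (if j == k then D else 0).
  have [h _] := H2 _ T P p n X mu Sigma m _ _ _ hset q2 m0 q3 hG _ _
     (card_block (ltn_ord j)) (card_block (ltn_ord k)).
  apply: le_trans h _; rewrite lerD2l; case: (eqVneq j k) => [->|jk].
    by rewrite finset.setIid card_block// divff ?gt_eqF// mulr1.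
  by rewrite block_disjoint// mul0r mulr0.
apply: (@le_trans _ _ (L%:R^-1 ^+ 2 * (L%:R * (L%:R * (nu / 2) + D)))).
  rewrite ler_wpM2l ?sqr_ge0//.
  apply: (@le_trans _ _ (\sum_(j < L) (L%:R * (nu / 2) + D))); last first.
    by rewrite sumr_const card_ord -[leLHS]mulr_natl.
  apply: ler_sum => j _; apply: le_trans (ler_sum _ (fun k _ => hp j k)) _.
  rewrite big_split sumr_const card_ord -[_ *+ L]mulr_natl lerD2l -big_mkcond/=.
  by rewrite (big_pred1 j)// => k; rewrite eq_sym.
have -> : L%:R^-1 ^+ 2 * (L%:R * (L%:R * (nu / 2) + D)) = nu / 2 + D / L%:R by field; rewrite gt_eqF.
have : D / L%:R <= nu / 2.
  rewrite ler_pdivrMr//.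
  move: q5; rewrite ltr_pdivrMr// mulrAC ltr_pdivlMr ?mulr_gt0// => q5.
  have : m%:R * (4 * D) <= nu * (2 * L%:R * m%:R).
    by apply: le_trans (ltW q5) _; rewrite ler_wpM2l// ltW.
  by rewrite (_ : nu * _ = m%:R * (4 * (nu / 2 * L%:R))); [rewrite ler_pM2l// ler_pM2l | field].
lra.
Qed.

End FixedSampleSize.

(** * Uniform random subsets *)

Section UniformSubsets.
Context {R : realType}.

Definition upi n m (b : {set 'I_n}) : R := if #|b| == m then ('C(n, m)%:R)^-1 else 0.

Lemma upi_sum n m : (m <= n)%N -> \sum_(b : {set 'I_n}) upi m b = 1.
Proof.
move=> mn; rewrite /upi -big_mkcond sumr_const.
have -> : #|[pred b : {set 'I_n} | #|b| == m]| = 'C(n, m).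
  by have := card_draws 'I_n m; rewrite card_ord cardsE.
by rewrite -[_ *+ _]mulr_natr mulVf// pnatr_eq0 -lt0n bin_gt0.
Qed.

Lemma upi_notin n m (i : 'I_n.+1) :
  \sum_(b : {set 'I_n.+1}) upi m b * (i \notin b)%:R = 'C(n, m)%:R / 'C(n.+1, m)%:R.
Proof.
rewrite (eq_bigr (fun b : {set 'I_n.+1} => if (i \notin b) && (#|b| == m) then ('C(n.+1, m)%:R)^-1 else 0)); last first.
  by move=> b _; rewrite /upi; case: (i \notin b); rewrite /= ?mulr1 ?mulr0.
rewrite -big_mkcond sumr_const -[_ *+ _]mulr_natl; congr (_%:R * _).
have := @cards_draws _ (finset.setC (finset.set1 i)) m.
rewrite cardsC1 card_ord => <-; rewrite cardsE; apply: eq_card => b.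
rewrite /in_mem /=; congr (_ && _); apply/idP/fintype.subsetP => [h x xb|h].
  by rewrite !finset.inE; apply: contraNneq h => <-.
by apply/negP => ib; have := h i ib; rewrite !finset.inE eqxx.
Qed.

Lemma upi_in n m (i : 'I_n) : (0 < m <= n)%N ->
  \sum_(b : {set 'I_n}) upi m b * (i \in b)%:R = m%:R / n%:R.
Proof.
case: n i => [[]//|n] i; case: m => [//|m] /andP[_ mn].
have E : \sum_(b : {set 'I_n.+1}) upi m.+1 b * (i \in b)%:R =
    1 - \sum_(b : {set 'I_n.+1}) upi m.+1 b * (i \notin b)%:R.
  rewrite -[X in X - _](upi_sum mn) -sumrB; apply: eq_bigr => b _.
  by case: (i \in b); rewrite /= ?mulr1n ?mulr0n ?mulr1 ?mulr0 ?subr0 ?subrr.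
rewrite E upi_notin.
have h1 : n.+1%:R * 'C(n, m)%:R = m.+1%:R * 'C(n.+1, m.+1)%:R :> R.
  by rewrite -!natrM -mul_bin_diag.
have h2 : 'C(n.+1, m.+1)%:R = 'C(n, m.+1)%:R + 'C(n, m)%:R :> R by rewrite binS natrD.
have c0 : 'C(n.+1, m.+1)%:R != 0 :> R by rewrite pnatr_eq0 -lt0n bin_gt0.
have n0 : n.+1%:R != 0 :> R by rewrite pnatr_eq0.
apply: (mulIf c0); rewrite mulrBl mul1r divfK// mulrAC -h1 [_ * 'C(n, m)%:R]mulrC mulfK//.
by rewrite h2 addrAC subrr add0r.
Qed.

(** By linearity, each element of [a] being hit with probability [m / n]. Two independent subsets
    thus share on average a fraction [m / n] of their size, which replaces the disjointness of
    blocks. *)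
Lemma upi_overlap n m (a : {set 'I_n}) : (0 < m <= n)%N ->
  \sum_(b : {set 'I_n}) upi m b * #|a :&: b|%:R = #|a|%:R * (m%:R / n%:R).
Proof.
move=> hm.
have E (b : {set 'I_n}) : #|a :&: b|%:R = \sum_(i in a) (i \in b)%:R :> R.
  rewrite -sum1_card natr_sum big_mkcond [RHS]big_mkcond; apply: eq_bigr => i _.
  by rewrite !finset.inE; case: (i \in a); case: (i \in b).
under eq_bigr do rewrite E mulr_sumr.
rewrite exchange_big/=; under eq_bigr do rewrite upi_in//.
by rewrite sumr_const -[LHS]mulr_natl.
Qed.

Section Law.
Context d (T : measurableType d) (P : probability T R) (n p m J : nat).
Variables (X : nat -> T -> 'rV[R]_p) (S : nat -> T -> {set 'I_n}).
Hypothesis hS : iid_uniform_subsets P m J X S.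
Hypothesis hX : iid_sample P n X.

Definition pair_event (j k : nat) (a b : {set 'I_n}) : set T := [set t | S j t = a /\ S k t = b].

(** The constraint on the subset of index [i], trivial unless [i] is [j] or [k]; for [j = k] it
    carries both requirements, so one formula covers the diagonal. *)
Let Qp (j k : nat) (a b : {set 'I_n}) (i : nat) : set {set 'I_n} :=
  [set c | (i = j -> c = a) /\ (i = k -> c = b)].

Lemma pair_eventE j k a b : (j < J)%N -> (k < J)%N ->
  pair_event j k a b = \bigcap_(i in `I_J) (S i @^-1` Qp j k a b i).
Proof.
move=> jJ kJ; apply/seteqP; split => t /=.
  by move=> [h1 h2] i /= _; split => ->.
by move=> h; split; [have [h1 _] := h j jJ; exact: h1 | have [_ h1] := h k kJ; exact: h1].
Qed.

Lemma measurable_pair_event j k a b : (j < J)%N -> (k < J)%N -> measurable (pair_event j k a b).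
Proof.
have [h _ _] := hS => jJ kJ.
rewrite (_ : pair_event j k a b = (S j @^-1` [set a]) `&` (S k @^-1` [set b])).
  by apply: measurableI; exact: h.
by apply/seteqP; split => t.
Qed.

Lemma pair_event_prob j k a b : (j < J)%N -> (k < J)%N ->
  P (pair_event j k a b) = (\prod_(i < J) P (S i @^-1` Qp j k a b i))%E.
Proof.
move=> jJ kJ; have [_ _ h] := hS.
have := h (fun=> setT) (Qp j k a b) (fun=> @vec_measT R p).
rewrite [X in P (X `&` _)](_ : _ = setT); last by apply/seteqP.
rewrite setTI -pair_eventE// => ->.
by rewrite [X in (X * _)%E]big1 ?mul1e// => i _; rewrite preimage_setT probability_setT.
Qed.

Lemma pair_event_indep j k a b : (j < J)%N -> (k < J)%N -> indep_of P n X (pair_event j k a b).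
Proof.
move=> jJ kJ A mA; have [_ _ h] := hS.
by rewrite setIC pair_event_prob// muleC pair_eventE// -h.
Qed.

Lemma pair_event_neq j k a b : (j < J)%N -> (k < J)%N -> j != k ->
  fine (P (pair_event j k a b)) = upi m a * upi m b.
Proof.
move=> jJ kJ jk; have [_ h _] := hS; rewrite pair_event_prob//.
rewrite (bigD1 (Ordinal jJ))//= (bigD1 (Ordinal kJ))/=; last first.
  by apply/eqP => /(congr1 val) /= /eqP; rewrite eq_sym (negbTE jk).
rewrite [X in (_ * (_ * X))%E]big1 ?mule1; last first.
  move=> i /andP[i1 i2]; rewrite (_ : _ @^-1` _ = setT) ?probability_setT//.
  apply/seteqP; split => // t _ /=; split => e; exfalso.
    by move/eqP: i1; apply; exact: val_inj.
  by move/eqP: i2; apply; exact: val_inj.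
have -> : S j @^-1` Qp j k a b j = S j @^-1` [set a].
  apply/seteqP; split => t /=; first by move=> [h1 _]; exact: h1.
  by move=> ->; split => // e; move: jk; rewrite e eqxx.
have -> : S k @^-1` Qp j k a b k = S k @^-1` [set b].
  apply/seteqP; split => t /=; first by move=> [_ h1]; exact: h1.
  by move=> ->; split => // e; move: jk; rewrite e eqxx.
rewrite !h// /upi; case: ifP => _; case: ifP => _; by rewrite -?EFinM ?mule0 ?mul0e /= ?mulr0 ?mul0r.
Qed.

Lemma pair_event_eq j a b : (j < J)%N ->
  fine (P (pair_event j j a b)) = if a == b then upi m a else 0.
Proof.
move=> jJ; have [_ h _] := hS; case: eqP => [<-|ab].
  rewrite (_ : pair_event j j a a = S j @^-1` [set a]); last by apply/seteqP; split => t //= [].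
  by rewrite h// /upi; case: ifP.
rewrite (_ : pair_event j j a b = set0) ?measure0//.
by apply/seteqP; split => t //= [e1 e2]; apply: ab; rewrite -e1 -e2.
Qed.

End Law.

End UniformSubsets.

(** * Statistics of random subsets *)

Section SubsetClose.
Context {R : realType}.

Lemma measurable_sqnorm d (T : measurableType d) p (f : T -> 'rV[R]_p) :
  (forall k, measurable_fun setT (fun t => f t 0 k)) -> measurable_fun setT (fun t => sqnorm (f t)).
Proof. by move=> h; rewrite /sqnorm /dotv; apply: measurable_sum => k; exact: measurable_funM. Qed.

Lemma measurable_finite_choice d (T : measurableType d) (I : finType) (c : T -> I) (f : I -> T -> R) :
  (forall i, measurable [set t | c t = i]) -> (forall i, measurable_fun setT (f i)) ->
  measurable_fun setT (fun t => f (c t) t).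
Proof.
move=> hc hf; rewrite (_ : (fun t => _) = fun t => \sum_i \1_[set t | c t = i] t * f i t).
  by apply: measurable_sum => i; apply: measurable_funM => //; exact: measurable_indic.
apply/funext => t; rewrite (bigD1 (c t))//= big1 ?addr0 => [|i ic].
  by rewrite indicE mem_set// mul1r.
by rewrite indicE memNset ?mul0r//= => e; move: ic; rewrite e eqxx.
Qed.

Lemma Rint_indic d (T : measurableType d) (P : probability T R) (D : set T) (u : T -> R) :
  \int[P]_t (\1_D t * u t) = \int[P]_(t in D) u t.
Proof.
rewrite [RHS]Rintegral_mkcond; congr (Rintegral _ _ _); apply/funext => t.
by rewrite /patch indicE; case: ifP => _; rewrite ?mul1r ?mul0r.
Qed.

(* [m] replaces [#|a|] since the sampled subset has size [m] only almost surely. *)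
Definition Rsub (T : Type) p n m (X : nat -> T -> 'rV[R]_p) (Sigma : 'M[R]_p) (a : {set 'I_n}) t : R :=
  scale (ff Sigma) ^+ 2 *
    (m%:R * sqnorm (subset_mean X a t - sample_mean n X t) / (1 - m%:R / n%:R)).

Lemma measurable_Rsub d (T : measurableType d) (P : probability T R) p n m (X : nat -> T -> 'rV[R]_p)
    (Sigma : 'M[R]_p) (a : {set 'I_n}) : iid_sample P n X ->
  measurable_fun setT (Rsub m X Sigma a).
Proof.
move=> hX; apply: measurable_funM => //; apply: measurable_funM => //; apply: measurable_funM => //.
apply: measurable_sqnorm => k.
under eq_fun do rewrite !mxE !summxE.
have mc (i : 'I_n) : measurable_fun setT (fun t => X i t 0 k) by exact: (coord_measurable hX).
apply: measurable_funB; apply: measurable_funM => //; last exact: measurable_sum.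
under eq_fun do rewrite big_mkcond; apply: measurable_sum => i.
by case: (i \in a).
Qed.

(** Conditioning on the values of two sampled subsets reduces to fixed ones. The mean overlap adds
    [D m / n] to every term and the diagonal adds [D / J] to the average; the threshold [nu / (4 D)]
    makes each at most [nu / 4]. *)
Lemma subset_close (eps eta : R) : 0 < eps -> 0 < eta -> exists2 th : R, 0 < th &
  forall d (T : measurableType d) (P : probability T R) p n m J (X : nat -> T -> 'rV[R]_p) mu Sigma
    (S : nat -> T -> {set 'I_n}),
  setting P n X mu Sigma -> (0 < m)%N -> theta_inf P X mu Sigma n%:R < th ->
  theta_inf P X mu Sigma m%:R < th -> m%:R / n%:R < th ->
  iid_uniform_subsets P m J X S -> (0 < J)%N -> J%:R^-1 < th ->
  measurable [set w | exists t : R, eps < `|Fcheck m J X S w t - Ftrue P n X mu t|] /\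
  fine (P [set w | exists t : R, eps < `|Fcheck m J X S w t - Ftrue P n X mu t|]) <= eta.
Proof.
move=> eps0 eta0; have [e [nu [th1 [he nu0 th10 H]]]] := assembly eps0 eta0.
have e0 : 0 < e by case/andP: he.
have nu2 : 0 < nu / 2 by rewrite divr_gt0.
have C0 : 0 < 2 / e ^+ 3 by rewrite divr_gt0// exprn_gt0.
have [th2 [D [th20 D0 H2]]] := pair_limit C0 nu2.
have th30 : 0 < nu / (4 * D) by rewrite divr_gt0// mulr_gt0.
exists (Num.min (Num.min th1 th2) (Num.min (1 / 2) (nu / (4 * D)))).
  by rewrite !lt_min th10 th20 th30 divr_gt0.
move=> d T P p n m J X mu Sigma S hset m0; rewrite !lt_min.
move=> /andP[/andP[q1 _] _] /andP[/andP[_ q2] _] /andP[/andP[_ q3] /andP[q4 q5]] hS J0 /andP[_ /andP[_ q6]].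
have [hX n1 hmc h4 f0] := hset; have n0 : (0 < n)%N := ltnW n1.
have n0' : 0 < n%:R :> R by rewrite ltr0n.
have m0' : 0 < m%:R :> R by rewrite ltr0n.
have J0' : 0 < J%:R :> R by rewrite ltr0n.
have s0 := scale_gt0 f0.
have mn : (m <= n)%N.
  by rewrite -(ler_nat R); move: q4; rewrite ltr_pdivrMr//; lra.
pose Rj (j : 'I_J) t := Rsub m X Sigma (S j t) t.
have [mS _ _] := hS.
have mR j : measurable_fun setT (Rj j).
  apply: (@measurable_finite_choice _ _ _ (S j) (Rsub m X Sigma)) => a.
    exact: (mS j [set a] (ltn_ord j)).
  exact: measurable_Rsub hX.
have nz : 0 < 1 - m%:R / n%:R :> R by move: q4; lra.
have hev : [set w | exists t : R, eps < `|Fcheck m J X S w t - Ftrue P n X mu t|] =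
           dev_event P (Qn n X mu Sigma) Rj eps.
  have s2 : 0 < scale (ff Sigma) ^+ 2 by rewrite exprn_gt0.
  have E w t : Fcheck m J X S w t - Ftrue P n X mu t =
     ecdf Rj w (scale (ff Sigma) ^+ 2 * t) - cdfR P (Qn n X mu Sigma) (scale (ff Sigma) ^+ 2 * t).
    congr (_ - _); last first.
      rewrite /Ftrue /cdfR; congr (fine (P _)); apply/seteqP.
      by split => z /=; rewrite Qn_mean// ler_pM2l.
    rewrite /Fcheck /ecdf; congr (_ * _); apply: eq_bigr => j _; congr ind.
    by rewrite /Rj /Rsub ler_pM2l// ler_pdivrMr.
  apply/seteqP; split => w [t ht]; first by exists (scale (ff Sigma) ^+ 2 * t); rewrite -E.
  exists ((scale (ff Sigma) ^+ 2)^-1 * t); move: ht; rewrite E mulVKf// gt_eqF//.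
rewrite hev; apply: H => // tau.
rewrite dev_step_sq//; set c := \int[P]_t _.
have [dG [ddG hG]] := step_smooth tau he.
pose Y (a : {set 'I_n}) t := step tau e (Rsub m X Sigma a t) - c.
have c01 : 0 <= c <= 1.
  have mQ : measurable_fun setT (Qn n X mu Sigma).
    exact: (measurable_vcontinuous hset (@vcontinuous_qstat R p n)).
  have bQ := bmeas_step tau he mQ.
  rewrite /c; apply/andP; split; [rewrite -[leLHS](Rint_cst P) | rewrite -[leRHS](Rint_cst P)]; apply: le_Rint => //; try exact: bmeas_cst;
    by move=> t; have /andP[] := smooth3_range hG (Qn n X mu Sigma t).
have bY a : bmeas (Y a).
  by apply: bmeasD; [apply: bmeas_step => //; exact: measurable_Rsub hX | exact: bmeas_cst].
have Y1 a t : `|Y a t| <= 1 by apply: range_dist => //; exact: smooth3_range hG _.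
have bYY a b : bmeas (fun t => Y a t * Y b t) by exact: bmeasM.
pose D' (j k : 'I_J) a b := pair_event S j k a b.
have mD (j k : 'I_J) a b : measurable (D' j k a b).
  exact: (measurable_pair_event hS a b (ltn_ord j) (ltn_ord k)).
have bD (j k : 'I_J) a b : bmeas (\1_(D' j k a b) : T -> R).
  split; first exact: measurable_indic.
  by exists 1 => t; rewrite indicE; case: (_ \in _); rewrite ?normr1 ?normr0.
(* Finite disintegration over the pair of values taken by the two subsets. *)
have split (j k : 'I_J) : \int[P]_t ((step tau e (Rj j t) - c) * (step tau e (Rj k t) - c)) =
    \sum_a \sum_b \int[P]_(t in D' j k a b) (Y a t * Y b t).
  transitivity (\int[P]_t (\sum_a \sum_b (\1_(D' j k a b) t * (Y a t * Y b t)))).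
    congr (Rintegral _ _ _); apply/funext => t.
    rewrite (bigD1 (S j t))//= [X in _ = _ + X]big1 ?addr0; last first.
      move=> a ja; rewrite big1// => b _; rewrite indicE memNset ?mul0r//=.
      by move=> [h _]; move: ja; rewrite h eqxx.
    rewrite (bigD1 (S k t))//= [X in _ = _ + X]big1 ?addr0; last first.
      move=> b kb; rewrite indicE memNset ?mul0r//=.
      by move=> [_ h]; move: kb; rewrite h eqxx.
    by rewrite indicE mem_set// mul1r.
  have bt a b : bmeas (fun t => \1_(D' j k a b) t * (Y a t * Y b t)) by exact: bmeasM.
  rewrite Rint_sum; last by move=> a; exact: bmeas_sum.
  by apply: eq_bigr => a _; rewrite Rint_sum//; apply: eq_bigr => b _; rewrite Rint_indic.
pose w (j k : 'I_J) a b := fine (P (D' j k a b)).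
have w0 j k a b : 0 <= w j k a b by exact: fine_ge0.
have wz (j k : 'I_J) (a b : {set 'I_n}) : ~~ ((#|a| == m) && (#|b| == m)) -> w j k a b = 0.
  move=> hab; rewrite /w /D'; case: (eqVneq j k) => [->|jk].
    rewrite (pair_event_eq hS a b (ltn_ord k)); case: eqP => // ab.
    by move: hab; rewrite -ab andbb /upi => /negbTE ->.
  rewrite (pair_event_neq hS a b (ltn_ord j) (ltn_ord k))//.
  by rewrite /upi; move: hab; rewrite negb_and => /orP[] /negbTE ->; rewrite ?mul0r ?mulr0.
have term (j k : 'I_J) (a b : {set 'I_n}) : \int[P]_(t in D' j k a b) (Y a t * Y b t) <=
    w j k a b * (nu / 2 + D * (#|a :&: b|%:R / m%:R)).
  case: (boolP ((#|a| == m) && (#|b| == m))) => [/andP[/eqP am /eqP bm]|hab].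
    have [h1 h2] := H2 _ T P p n X mu Sigma m _ _ _ hset q2 m0 q3 hG a b am bm.
    have YE (x : {set 'I_n}) : #|x| = m -> (fun t => step tau e (Rst x (Zn X mu Sigma t)) - c) = Y x.
      by move=> xm; apply/funext => t; rewrite /Y /Rsub Rst_Zn ?xm.
    have YYE : (fun t => (step tau e (Rst a (Zn X mu Sigma t)) - c) *
        (step tau e (Rst b (Zn X mu Sigma t)) - c)) = (fun t => Y a t * Y b t).
      by rewrite -(YE a am) -(YE b bm).
    rewrite -/(Qn n X mu Sigma) -/c YYE in h1 h2.
    rewrite h2//; last exact: (pair_event_indep hS).
    by apply: ler_wpM2l => //; exact: w0.
  (* Pairs with a wrong size have probability zero, and the integrand is at most 1 in modulus. *)
  rewrite wz// mul0r -(Rint_indic P); rewrite -(wz j k a b hab) /w.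
  have -> : fine (P (D' j k a b)) = \int[P]_t \1_(D' j k a b) t.
    by rewrite /Rintegral integral_indic// setIT.
  apply: le_Rint => //; first exact: bmeasM.
  move=> t; rewrite -[leRHS]mulr1; apply: ler_wpM2l; first by rewrite indicE.
  by apply: le_trans (ler_norm _) _; rewrite normrM mulr_ile1.
have hp (j k : 'I_J) : \int[P]_t ((step tau e (Rj j t) - c) * (step tau e (Rj k t) - c)) <=
   nu / 2 + D * (m%:R / n%:R) + (if j == k then D else 0).
  rewrite split; apply: le_trans (ler_sum _ (fun a _ => ler_sum _ (fun b _ => term j k a b))) _.
  have mn0 : 0 <= m%:R / n%:R :> R by rewrite divr_ge0.
  case: (eqVneq j k) => [->|jk].
    rewrite (eq_bigr (fun a => upi m a * (nu / 2 + D))); last first.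
      move=> a _; rewrite (bigD1 a)//= big1 ?addr0 => [|b ba].
        rewrite /w /D' (pair_event_eq hS _ _ (ltn_ord k)) eqxx finset.setIid /upi.
        by case: eqP => [->|_]; rewrite ?mul0r// divff ?gt_eqF// mulr1.
      by rewrite /w /D' (pair_event_eq hS _ _ (ltn_ord k)) eq_sym (negbTE ba) mul0r.
    rewrite -mulr_suml upi_sum// mul1r -addrA lerD2l lerDr mulr_ge0// ltW//.
  rewrite addr0 (eq_bigr (fun a => upi m a * (nu / 2 + D * (m%:R / n%:R)))); last first.
    move=> a _; rewrite (eq_bigr (fun b => upi m a * (upi m b * (nu / 2) + D / m%:R * (upi m b * #|a :&: b|%:R)))); last first.
      by move=> b _; rewrite /w /D' (pair_event_neq hS _ _ (ltn_ord j) (ltn_ord k))//; ring.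
    rewrite -mulr_sumr big_split -mulr_suml -mulr_sumr/= upi_sum// mul1r upi_overlap ?m0//.
    case: (eqVneq #|a| m) => [->|am]; last by rewrite /upi (negbTE am) !mul0r.
    by congr (_ * (_ + _)); field; rewrite !gt_eqF.
  by rewrite -mulr_suml upi_sum// mul1r.
set A := nu / 2 + D * (m%:R / n%:R) in hp.
apply: (@le_trans _ _ (J%:R^-1 ^+ 2 * (J%:R * (J%:R * A + D)))).
  rewrite ler_wpM2l ?sqr_ge0//.
  apply: (@le_trans _ _ (\sum_(j < J) (J%:R * A + D))); last first.
    by rewrite sumr_const card_ord -[leLHS]mulr_natl.
  apply: ler_sum => j _; apply: le_trans (ler_sum _ (fun k _ => hp j k)) _.
  rewrite big_split sumr_const card_ord -[_ *+ J]mulr_natl lerD2l -big_mkcond/=.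
  by rewrite (big_pred1 j)// => k; rewrite eq_sym.
have -> : J%:R^-1 ^+ 2 * (J%:R * (J%:R * A + D)) = A + D * J%:R^-1 by field; rewrite gt_eqF.
have h1 : D * (m%:R / n%:R) <= nu / 4.
  by move/ltW: q5; rewrite ler_pdivlMr ?mulr_gt0//; move: (m%:R / n%:R) => q; lra.
have h2 : D * J%:R^-1 <= nu / 4.
  by move/ltW: q6; rewrite ler_pdivlMr ?mulr_gt0//; move: (J%:R^-1) => q; lra.
by rewrite /A; move: h1 h2; move: (D * _) (D * _) => q q'; lra.
Qed.

End SubsetClose.

(** * Moment conditions *)

Section PowerBounds.
Context {R : realType}.
Implicit Types a u q : R.

Lemma sqr_le_powR a q : 0 <= a -> 2 <= q -> a ^+ 2 <= 1 + a `^ q.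
Proof.
move=> a0 q2; case: (leP a 1) => a1.
  by apply: le_trans (_ : 1 <= _); [rewrite expr_le1 | rewrite lerDl powR_ge0].
apply: le_trans (_ : a `^ q <= _); last by rewrite lerDr.
by rewrite -powR_mulrn//; apply: ler_powR => //; exact: ltW.
Qed.

Lemma powR_le_sqr a q : 0 <= q <= 2 -> a `^ q <= 1 + a ^+ 2.
Proof.
move=> /andP[q0 q2]; case: (leP 1 a) => a1.
  apply: le_trans (_ : a ^+ 2 <= _); last by rewrite lerDr.
  by rewrite -powR_mulrn ?(le_trans _ a1)//; exact: ler_powR.
apply: le_trans (_ : 1 <= _); last by rewrite lerDl sqr_ge0.
rewrite /powR; case: eqP => [_|]; first by case: eqP.
move=> /eqP an; rewrite -expR0 ler_expR.
(* A negative base has [ln a = 0], hence power 1, so the bound covers a quadratic form of either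
   sign. *)
case: (leP a 0) => a0; first by rewrite ln0// mulr0.
by rewrite mulr_ge0_le0// ln_le0// ltW.
Qed.

(** Links the truncated terms to moments of order [2 + delta]; an exponent above 1 would fail near
    the origin. *)
Lemma cut1_le_powR u a : 0 <= u -> 0 < a <= 1 -> cut1 u <= u `^ a.
Proof.
move=> u0 /andP[a0 a1]; case: (leP u 1) => u1; last first.
  apply: le_trans (cut1_le1 u) _; rewrite -(powRr0 u) ; apply: ler_powR; exact: ltW.
apply: le_trans (cut1_le u) _; rewrite ger0_norm//.
case: (eqVneq u 0) => [->|un]; first by rewrite powR_ge0.
rewrite -{1}(powRr1 u0); apply: ger_powR => //; by rewrite lt_neqAle eq_sym un u0 u1.
Qed.

Lemma powRK a q : 0 <= a -> q != 0 -> (a `^ q^-1) `^ q = a.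
Proof. by move=> a0 q0; rewrite -powRrM mulVf// powRr1. Qed.

Lemma continuous_cut1 : continuous (@cut1 R).
Proof.
move=> x; apply/cvgrPdist_le => e e0.
near=> y; apply: le_trans (cut1_lip _ _) _; rewrite mul1r.
by near: y; apply: cvgr_dist_le => //; exact: cvg_id.
Unshelve. all: by end_near. Qed.

Lemma sqr_powR_half a q : 0 <= a -> (a ^+ 2) `^ (q / 2) = a `^ q.
Proof. by move=> a0; rewrite -powR_mulrn// -powRrM [2 * _]mulrC divfK. Qed.

Lemma sqr_powR2 a : 0 <= a -> (a `^ 2^-1) ^+ 2 = a.
Proof. by move=> a0; rewrite -powR_mulrn ?powR_ge0// powRK. Qed.

End PowerBounds.

(** * From the moment assumptions to the Lyapunov quantity *)

Section Conversion.
Context d (T : measurableType d) (R : realType) (P : probability T R).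
Context {p : nat} (n : nat) (X : nat -> T -> 'rV[R]_p) (mu : 'rV[R]_p) (Sigma : 'M[R]_p) (delta : R).
Hypothesis hX : iid_sample P n X.
Hypothesis n1 : (1 < n)%N.
Hypothesis hS : mean_cov P n X mu Sigma.
Hypothesis S0 : Sigma != 0.
Hypothesis delta0 : 0 < delta.
Hypothesis delta1 : delta <= 1.
Hypothesis hK : (Kpow P X mu Sigma delta < +oo)%E.
Hypothesis hD : (Dpow P X mu Sigma delta < +oo)%E.
Let n0 : (0 < n)%N := ltnW n1.
Local Notation Y i t := (X i t - mu).
Local Notation sq i t := (sqnorm (Y i t)).
Local Notation f := (fk 2 Sigma).
Local Notation f1 := (fk 1 Sigma).

Lemma Sigma_sym k l : Sigma k l = Sigma l k.
Proof.
have [_ _ _ h1] := hS n0 k l; have [_ _ _ h2] := hS n0 l k.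
apply: EFin_inj; rewrite -h1 -h2; apply: eq_integral => t _; by rewrite mulrC.
Qed.

Lemma ff_trace : ff Sigma = \tr (Sigma ^+ 2).
Proof.
rewrite /ff /mxtrace expr2; apply: eq_bigr => k _; rewrite mxE; apply: eq_bigr => j _.
by rewrite expr2 [in X in _ = _ * X]Sigma_sym.
Qed.

Lemma ff_gt0 : 0 < ff Sigma.
Proof.
have [k [j hkj]] : exists k j, Sigma k j != 0.
  apply: contrapT => h; move/eqP: S0; apply; apply/matrixP => k j; rewrite mxE.
  by apply: contrapT => /eqP hkj; apply: h; exists k, j.
rewrite /ff (bigD1 k)//= (bigD1 j)//= -addrA ltr_wpDr//; last by rewrite exprn_even_gt0.
by rewrite addr_ge0// ?sumr_ge0// => i _; rewrite ?sqr_ge0// sumr_ge0// => i' _; rewrite sqr_ge0.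
Qed.

Lemma fE : f = Num.sqrt (ff Sigma).
Proof. by rewrite /fk -ff_trace powR12_sqrt// ltW// ff_gt0. Qed.

Lemma f_gt0 : 0 < f.
Proof. by rewrite fE sqrtr_gt0 ff_gt0. Qed.

Lemma scale_sq : scale (ff Sigma) ^+ 2 = f^-1.
Proof. by rewrite /scale exprVn sqr_sqrtr ?sqrtr_ge0// fE. Qed.

Lemma f1E : f1 = \tr Sigma.
Proof.
rewrite /fk expr1 invr1 powRr1// /mxtrace sumr_ge0// => k _.
have [_ _ _ h] := hS n0 k k; rewrite -lee_fin -h; apply: integral_ge0 => t _.
by rewrite lee_fin -expr2 sqr_ge0.
Qed.

Lemma AmeanE : Amean Sigma = f1 / f.
Proof. by rewrite /Amean scale_sq f1E -mulr_sumr mulrC. Qed.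

Lemma measurable_Y i k : (i < n)%N -> measurable_fun setT (fun t => Y i t 0 k).
Proof.
move=> im; under eq_fun do rewrite !mxE.
by apply: measurable_funB => //; exact: (coord_measurable hX).
Qed.

Lemma measurable_sq i : (i < n)%N -> measurable_fun setT (fun t => sq i t).
Proof. by move=> im; apply: measurable_sqnorm => k; exact: measurable_Y. Qed.

Lemma measurable_dot : measurable_fun setT (fun t => dotv (Y 0%N t) (Y 1%N t)).
Proof.
by rewrite /dotv; apply: measurable_sum => k; apply: measurable_funM; exact: measurable_Y.
Qed.

Let yK t : R := (sq 0%N t - f1) / f.
Let yD t : R := dotv (Y 0%N t) (Y 1%N t) / f.
Let quad t : R := dotv (Y 0%N t) (Y 0%N t *m Sigma).

Lemma integrable_powR (g : T -> R) (q : R) : measurable_fun setT g ->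
  (\int[P]_t (`|g t| `^ q)%:E < +oo)%E -> P.-integrable setT (EFin \o (fun t => `|g t| `^ q)).
Proof.
move=> mg hg; apply/integrableP; split.
  apply/measurable_EFinP; apply: (measurableT_comp (measurable_powR q)).
  exact: measurableT_comp.
by under eq_integral do rewrite gee0_abs ?lee_fin ?powR_ge0//.
Qed.

Lemma integrable_yK : P.-integrable setT (EFin \o (fun t => `|yK t| `^ (2 + delta))).
Proof.
apply: integrable_powR hK; apply: measurable_funM => //; apply: measurable_funB => //.
exact: measurable_sq.
Qed.

Lemma integrable_yD : P.-integrable setT (EFin \o (fun t => `|yD t| `^ (2 + delta))).
Proof. by apply: integrable_powR hD; apply: measurable_funM => //; exact: measurable_dot. Qed.

(** [|Y|^2 = f yK + f_1], and [yK] has a finite moment of order [2 + delta >= 2]. *)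
Lemma integrable_sq4 : P.-integrable setT (fun t => (sq 0%N t ^+ 2)%:E).
Proof.
have f0 := f_gt0.
have ig : P.-integrable setT (EFin \o (fun t => 2 * f ^+ 2 * `|yK t| `^ (2 + delta) + (2 * f ^+ 2 + 2 * f1 ^+ 2))).
  have i1 := integrableZl measurableT (2 * f ^+ 2) integrable_yK.
  have i2 := finite_measure_integrable_cst P (2 * f ^+ 2 + 2 * f1 ^+ 2) (@measurableT _ T).
  exact: (integrableD measurableT i1 i2).
apply: (le_integrable measurableT _ _ ig).
  apply/measurable_EFinP; apply: measurable_funX; exact: measurable_sq.
move=> t _; rewrite /= lee_fin ger0_norm ?sqr_ge0//; apply: le_trans (ler_norm _).
have -> : sq 0%N t = f * yK t + f1 by rewrite /yK mulrC divfK ?subrK// gt_eqF.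
have q2 : 2 <= 2 + delta by rewrite lerDl ltW.
have := sqr_le_powR (normr_ge0 (yK t)) q2; rewrite real_normK ?num_real// => h.
have h2 := ler_wpM2l (sqr_ge0 f) h.
have := sqr_ge0 (f * yK t - f1); move: h2; move: (_ `^ _) => w; rewrite !mulrDr; nra.
Qed.

Lemma has_setting : setting P n X mu Sigma.
Proof. by split => //; [exact: integrable_sq4 | exact: ff_gt0]. Qed.

(** [Kinf] is exactly [K_0^2], and [Ktilde] exceeds [K_0] by the nonnegative [c_0]. *)
Lemma Kinf_le : Kinf P X mu Sigma <= Ktilde P X mu Sigma 0 ^+ 2.
Proof.
have E : Kinf P X mu Sigma = fine (Kpow P X mu Sigma 0).
  rewrite /Kinf /Kpow /Rintegral; congr fine; apply: eq_integral => t _; congr EFin.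
  rewrite addr0 powR_mulrn// real_normK ?num_real// sqnormZ scale_sq AmeanE.
  by rewrite [in RHS]mulrBl mulrC.
have K0 : 0 <= fine (Kpow P X mu Sigma 0).
  by apply: fine_ge0; apply: integral_ge0 => t _; rewrite lee_fin powR_ge0.
rewrite E -[leLHS](sqr_powR2 K0) /Ktilde /Kd addr0 ler_pXn2r ?nnegrE ?addr_ge0 ?powR_ge0//.
  by rewrite lerDl /c_delta mulr_ge0 ?sqrtr_ge0// powR_ge0.
by rewrite /c_delta mulr_ge0 ?sqrtr_ge0// powR_ge0.
Qed.

(** Pointwise, [y^2 cut1 (y / m) <= |y|^(2 + delta) m^-delta]; integrating gives
    [D_delta^q / m^delta]. *)
Lemma L2inf_le (m : R) : 0 < m ->
  L2inf P X mu Sigma m <= Dtilde P X mu Sigma delta `^ (2 + delta) / m `^ delta.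
Proof.
move=> m0; have q0 : 0 < 2 + delta by rewrite addr_gt0.
have D0 : 0 <= fine (Dpow P X mu Sigma delta).
  by apply: fine_ge0; apply: integral_ge0 => t _; rewrite lee_fin powR_ge0.
have md : 0 < m `^ delta by exact: powR_gt0.
apply: (@le_trans _ _ (fine (Dpow P X mu Sigma delta) / m `^ delta)); last first.
  rewrite ler_wpM2r ?invr_ge0 ?(ltW md)// -[leLHS](powRK D0 (lt0r_neq0 q0)).
  have dd : 0 <= @d_delta R delta by rewrite /d_delta mulr_ge0 ?sqrtr_ge0// sqr_ge0.
  have hpw : 0 <= fine (Dpow P X mu Sigma delta) `^ (2 + delta)^-1 by exact: powR_ge0.
  apply: ge0_ler_powR; rewrite ?nnegrE ?(ltW q0)// /Dtilde /Dd ?lerDl//.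
  exact: addr_ge0.
have E t : dotv (scale (ff Sigma) *: Y 0%N t) (scale (ff Sigma) *: Y 1%N t) = yD t.
  by rewrite dotvZl dotvZr mulrA -expr2 scale_sq mulrC.
have -> : fine (Dpow P X mu Sigma delta) / m `^ delta = \int[P]_t ((m `^ delta)^-1 * `|yD t| `^ (2 + delta)).
  by rewrite RintegralZl//; [rewrite mulrC | exact: integrable_yD].
rewrite /L2inf; under eq_Rintegral do rewrite E.
have myD : measurable_fun setT yD by apply: measurable_funM => //; exact: measurable_dot.
have ib : P.-integrable setT (EFin \o (fun t => (m `^ delta)^-1 * `|yD t| `^ (2 + delta))).
  exact: (integrableZl measurableT _ integrable_yD).
have hle t : yD t ^+ 2 * cut1 (yD t / m) <= (m `^ delta)^-1 * `|yD t| `^ (2 + delta).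
  rewrite -cut1_norm normrM [`|m^-1|]ger0_norm ?invr_ge0 ?(ltW m0)//.
  have h : cut1 (`|yD t| / m) <= (`|yD t| / m) `^ delta.
    by apply: cut1_le_powR; rewrite ?delta0// mulr_ge0 ?invr_ge0 ?(ltW m0).
  apply: le_trans (ler_wpM2l (sqr_ge0 _) h) _.
  rewrite powRM ?invr_ge0 ?(ltW m0)// -[m^-1](powR_inv1 (ltW m0)) -powRrM mulN1r powRN.
  have -> : `|yD t| `^ (2 + delta) = yD t ^+ 2 * `|yD t| `^ delta.
    rewrite powRD; last by rewrite gt_eqF.
    by rewrite (powR_mulrn 2 (normr_ge0 _)) real_normK ?num_real.
  by rewrite mulrA [leRHS]mulrC.
apply: le_Rintegral => //.
apply: (le_integrable measurableT _ _ ib).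
  apply/measurable_EFinP; apply: measurable_funM; first exact: measurable_funX.
  apply: (measurableT_comp (f := @cut1 R)); last exact: measurable_funM.
  exact: continuous_measurable_fun continuous_cut1.
move=> t _; rewrite /= lee_fin ger0_norm; last by apply: mulr_ge0; [exact: sqr_ge0 | exact: cut1_ge0].
by apply: le_trans (ler_norm _); exact: hle.
Qed.

Let g t : R := Sform Sigma (scale (ff Sigma) *: Y 0%N t).

Lemma quadE t : quad t = f ^+ 2 * g t.
Proof.
have f0 : f != 0 by rewrite gt_eqF// f_gt0.
rewrite /quad /g /Sform /dotv mulr_sumr.
under [RHS]eq_bigr do rewrite mulr_sumr.
under [LHS]eq_bigr do rewrite [X in _ * X]mxE mulr_sumr.
rewrite exchange_big/=; apply: eq_bigr => k _; apply: eq_bigr => j _.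
rewrite [in RHS]mxE [in X in _ * X * _]mxE scale_sq.
have -> : forall a b c, f ^+ 2 * (scale (ff Sigma) * a * (scale (ff Sigma) * b) * (f^-1 * c)) =
   scale (ff Sigma) ^+ 2 * f * (a * b * c).
  by move=> a b c; field.
by rewrite scale_sq mulVf// mul1r; ring.
Qed.

Lemma measurable_quad : measurable_fun setT quad.
Proof.
rewrite /quad /dotv; apply: measurable_sum => k; apply: measurable_funM; first exact: measurable_Y.
under eq_fun do rewrite mxE; apply: measurable_sum => j; apply: measurable_funM => //.
exact: measurable_Y.
Qed.

Lemma quad_sqr_le t : quad t ^+ 2 <= ff Sigma * sq 0%N t ^+ 2.
Proof.
have h : sqnorm (Y 0%N t *m Sigma) <= ff Sigma * sq 0%N t.
  rewrite /ff exchange_big mulr_suml; apply: ler_sum => j _; rewrite -expr2 mxE.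
  have := dotv_CS (Y 0%N t) (\row_k Sigma k j).
  have -> : dotv (Y 0%N t) (\row_k Sigma k j) = \sum_k Y 0%N t 0 k * Sigma k j.
    by apply: eq_bigr => k _; congr (_ * _); rewrite mxE.
  have -> : sqnorm (\row_k Sigma k j) = \sum_k Sigma k j ^+ 2.
    by apply: eq_bigr => k _; rewrite mxE expr2.
  by rewrite mulrC.
apply: le_trans (dotv_CS _ _) _.
by rewrite expr2 mulrCA; apply: ler_wpM2l; rewrite ?sqnorm_ge0.
Qed.

(** [quad_moment] is defined through [fine], so its finiteness has to be proved: the exponent
    [q / 2] is at most 2, and the square of the form is dominated by the fourth moment of [|Y|]. *)
Lemma integrable_quad : P.-integrable setT (EFin \o (fun t => quad t `^ ((2 + delta) / 2))).
Proof.
have i1 := finite_measure_integrable_cst P 1 (@measurableT _ T).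
have i2 := integrableZl measurableT (ff Sigma) integrable_sq4.
have i3 := integrableD measurableT i1 i2.
apply: (le_integrable measurableT _ _ i3).
  by apply/measurable_EFinP; apply: (measurableT_comp (measurable_powR _)); exact: measurable_quad.
move=> t _; rewrite /= lee_fin ger0_norm ?powR_ge0//.
have hq : 0 <= (2 + delta) / 2 <= 2 by have := delta0; have := delta1; lra.
apply: le_trans (powR_le_sqr (quad t) hq) _.
apply: le_trans (ler_norm _); rewrite lerD2l; exact: quad_sqr_le.
Qed.

(** For [g = quad / f^2 > 0] the pointwise bound is [g cut1 (sqrt (g / m)) <= g (g / m)^(delta /
    2)]; the power [f^q] is [(f^2)^(q / 2)]. *)
Lemma L1inf_le (m : R) : 0 < m ->
  L1inf P X mu Sigma m <= quad_moment P X mu Sigma (2 + delta) / (m `^ (delta / 2) * f `^ (2 + delta)).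
Proof.
move=> m0; have f0 := f_gt0; have md : 0 < m `^ (delta / 2) by exact: powR_gt0.
have fd : 0 < f `^ (2 + delta) by exact: powR_gt0.
set c := (m `^ (delta / 2) * f `^ (2 + delta))^-1.
have c0 : 0 <= c by rewrite invr_ge0 mulr_ge0 ?ltW.
have -> : quad_moment P X mu Sigma (2 + delta) * c = \int[P]_t (c * quad t `^ ((2 + delta) / 2)).
  by rewrite RintegralZl//; [rewrite mulrC | exact: integrable_quad].
have ib : P.-integrable setT (EFin \o (fun t => c * quad t `^ ((2 + delta) / 2))).
  exact: (integrableZl measurableT _ integrable_quad).
have mg : measurable_fun setT g.
  rewrite (_ : g = fun t => (f ^+ 2)^-1 * quad t).
    by apply: measurable_funM => //; exact: measurable_quad.
  by apply/funext => t; rewrite quadE mulKf// expf_neq0// gt_eqF.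
have hle t : `|g t * cut1 (Num.sqrt (g t / m))| <= c * quad t `^ ((2 + delta) / 2).
  (* For nonpositive [g] the square root is 0 and the left-hand side vanishes. *)
  case: (leP (g t) 0) => g0.
    rewrite ler0_sqrtr; last by rewrite mulr_le0_ge0// invr_ge0 ltW.
    by rewrite /cut1 normr0 min_r// mulr0 normr0 mulr_ge0// powR_ge0.
  rewrite ger0_norm; last by rewrite mulr_ge0 ?cut1_ge0// ltW.
  have gm0 : 0 <= g t / m by rewrite divr_ge0// ltW.
  have h : cut1 (Num.sqrt (g t / m)) <= (g t / m) `^ (delta / 2).
    apply: le_trans (@cut1_le_powR _ _ delta (sqrtr_ge0 _) _) _; first by rewrite delta0 delta1.
    by rewrite -powR12_sqrt// -powRrM [2^-1 * _]mulrC.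
  apply: le_trans (ler_wpM2l (ltW g0) h) _.
  rewrite quadE [X in _ <= c * X]powRM ?sqr_ge0 ?(ltW g0)//.
  have -> : (f ^+ 2) `^ ((2 + delta) / 2) = f `^ (2 + delta).
    exact: sqr_powR_half (ltW f0).
  rewrite powRM ?invr_ge0 ?(ltW g0) ?(ltW m0)// -[m^-1](powR_inv1 (ltW m0)) -powRrM mulN1r powRN.
  have -> : g t `^ ((2 + delta) / 2) = g t * g t `^ (delta / 2).
    rewrite mulrDl divff// powRD; last by rewrite (gt_eqF g0) implybT.
    by rewrite powRr1// ltW.
  rewrite /c (_ : _ * _ = (m `^ (delta / 2) * f `^ (2 + delta))^-1 * (f `^ (2 + delta) * (g t * g t `^ (delta / 2)))) //.
  by field; rewrite !gt_eqF.
apply: le_Rintegral => //; last by move=> t _; apply: le_trans (ler_norm _) (hle t).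
apply: (le_integrable measurableT _ _ ib).
  apply/measurable_EFinP; apply: measurable_funM => //.
  apply: (measurableT_comp (f := @cut1 R)); first exact: continuous_measurable_fun continuous_cut1.
  apply: (measurableT_comp (f := @Num.sqrt R)); last exact: measurable_funM.
  by apply: continuous_measurable_fun; exact: sqrt_continuous.
by move=> t _; rewrite /= lee_fin; apply: le_trans (ler_norm _); exact: hle.
Qed.

(** Inherited in the limit from the discretised laws, where second moments are visibly
    nonnegative. *)
Lemma theta_inf_mono (a b : R) : 0 < a -> a <= b ->
  theta_inf P X mu Sigma b <= theta_inf P X mu Sigma a.
Proof.
move=> a0 ab; have b0 := lt_le_trans a0 ab.
have [r0 [hm _]] := approx_model hX n1 hS integrable_sq4 ff_gt0.
have ca := theta_cvg hX n1 hS integrable_sq4 ff_gt0 a0.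
have cb := theta_cvg hX n1 hS integrable_sq4 ff_gt0 b0.
apply: (ler_cvg_to cb ca); exists r0 => // r /= hr.
by apply: le_theta => //; have [] := hm r hr.
Qed.

Lemma theta_inf_le (m : R) : 0 < m -> theta_inf P X mu Sigma m <=
  Ktilde P X mu Sigma 0 ^+ 2 / m + Ktilde P X mu Sigma delta `^ (2 + delta) / m `^ (2 + delta - 1)
  + quad_moment P X mu Sigma (2 + delta) / (m `^ (delta / 2) * f `^ (2 + delta))
  + Dtilde P X mu Sigma delta `^ (2 + delta) / m `^ delta + m^-1.
Proof.
move=> m0; rewrite /theta_inf lerD2r.
apply: lerD; last exact: L2inf_le.
apply: lerD; last exact: L1inf_le.
apply: le_trans (_ : Ktilde P X mu Sigma 0 ^+ 2 / m <= _).
  by rewrite ler_wpM2r ?Kinf_le// invr_ge0 ltW.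
by rewrite lerDl divr_ge0 ?powR_ge0.
Qed.

End Conversion.

(** * Convergence in probability *)

Section Limits.
Context {R : realType}.

(** Measurability is asked eventually only, since it is established together with the bound for
    large [n]. *)
Lemma cvg_prob0 (d : nat -> measure_display) (T : forall n, measurableType (d n))
  (P : forall n, probability (T n) R) (E : forall n, set (T n)) :
  (forall eta : R, 0 < eta -> \forall n \near \oo, measurable (E n) /\ fine (P n (E n)) <= eta) ->
  (fun n => P n (E n)) @ \oo --> 0%E.
Proof.
move=> h; apply/fine_cvgP; split.
  by apply: filterS (h 1 ltr01) => n [mE _]; exact: fin_num_measure.
apply/cvgrPdist_le => e e0; apply: filterS (h e e0) => n [_ hn].
by rewrite sub0r normrN /= ger0_norm ?fine_ge0.
Qed.

Lemma near_inv_lt (m : nat -> nat) (th : R) : 0 < th ->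
  (forall N, exists n0, forall n, (n0 <= n)%N -> (N <= m n)%N) ->
  \forall n \near \oo, (0 < m n)%N /\ (m n)%:R^-1 < th.
Proof.
move=> th0 /(_ (Num.truncn th^-1).+1) [n0 h]; exists n0 => // n /= /h hm.
have m0 : (0 < m n)%N by apply: leq_trans hm.
split => //; rewrite invf_plt ?posrE ?ltr0n//.
by apply: lt_le_trans (truncnS_gt _) _; rewrite ler_nat.
Qed.

End Limits.

Theorem mainTheorem8 (R : realType)
  (d : nat -> measure_display) (T : forall n, measurableType (d n))
  (P : forall n, probability (T n) R)
  (p : nat -> nat)
  (X : forall n, nat -> T n -> 'rV[R]_(p n))
  (mu : forall n, 'rV[R]_(p n)) (Sigma : forall n, 'M[R]_(p n))
  (delta : R) (m : nat -> nat) :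
  (* X_1, ..., X_n i.i.d. with mean mu and covariance Sigma <> 0 *)
  (forall n, iid_sample (P n) n (X n)) ->
  (forall n, mean_cov (P n) n (X n) (mu n) (Sigma n)) ->
  (forall n, Sigma n != 0) ->
  0 < delta -> delta <= 1 ->
  (* K_delta, D_delta < oo *)
  (forall n, (2 <= n)%N ->
     (Kpow (P n) (X n) (mu n) (Sigma n) delta < +oo)%E /\
     (Dpow (P n) (X n) (mu n) (Sigma n) delta < +oo)%E) ->
  (* m -> oo, m = o(n) *)
  (forall N, exists n0, forall n, (n0 <= n)%N -> (N <= m n)%N) ->
  ((fun n => (m n)%:R / n%:R : R) @ \oo --> (0 : R)) ->
  (fun n =>
     let q := 2 + delta in
     let mm : R := (m n)%:R in
     (Ktilde (P n) (X n) (mu n) (Sigma n) 0) ^+ 2 / mm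
     + (Ktilde (P n) (X n) (mu n) (Sigma n) delta) `^ q / mm `^ (q - 1)
     + quad_moment (P n) (X n) (mu n) (Sigma n) q
         / (mm `^ (delta / 2) * (fk 2 (Sigma n)) `^ q)
     + (Dtilde (P n) (X n) (mu n) (Sigma n) delta) `^ q / mm `^ delta)
    @ \oo --> (0 : R) ->
  (* (i) *)
  (forall eps : R, 0 < eps ->
     (fun n => P n [set w | exists t : R,
         eps < `| Fhat n (m n) (X n) w t - Ftrue (P n) n (X n) (mu n) t | ])
     @ \oo --> 0%E)
  /\
  (* (ii) *)
  (forall (J : nat -> nat) (S : forall n, nat -> T n -> {set 'I_n}),
     (forall n, iid_uniform_subsets (P n) (m n) (J n) (X n) (S n)) ->
     (forall N, exists n0, forall n, (n0 <= n)%N -> (N <= J n)%N) ->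
     forall eps : R, 0 < eps ->
     (fun n => P n [set w | exists t : R,
         eps < `| Fcheck (m n) (J n) (X n) (S n) w t - Ftrue (P n) n (X n) (mu n) t | ])
     @ \oo --> 0%E).
Proof.
move=> hX hS S0 d0 d1 hKD hm hmn hlim.
(* All smallness conditions hold eventually. The one on [theta_inf] at [n] follows from the one at
   [m], because [m <= n] and [theta_inf] is nonincreasing. *)
have key th : 0 < th -> \forall n \near \oo,
    [/\ setting (P n) n (X n) (mu n) (Sigma n), (0 < m n)%N,
        theta_inf (P n) (X n) (mu n) (Sigma n) n%:R < th,
        theta_inf (P n) (X n) (mu n) (Sigma n) (m n)%:R < th & (m n)%:R / n%:R < th].
  (* Half of [th] is for the assumed limit, half for the extra summand [1 / m]. *)
  move=> th0; have th2 : 0 < th / 2 by rewrite divr_gt0.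
  have h1 := near_inv_lt th2 hm.
  have h2 := cvgr_lt _ hlim _ th2.
  have h3 := cvgr_lt _ hmn _ th0.
  have h4 := cvgr_lt _ hmn _ (@ltr01 R).
  have h5 : \forall n \near \oo, (1 < n)%N by exists 2.
  near=> n.
  have n1 : (1 < n)%N by near: n.
  have [m0 hm'] : (0 < m n)%N /\ (m n)%:R^-1 < th / 2 by near: n.
  have [hK hD] := hKD n n1.
  have n0' : 0 < n%:R :> R by rewrite ltr0n ltnW.
  have m0' : 0 < (m n)%:R :> R by rewrite ltr0n.
  have hth : theta_inf (P n) (X n) (mu n) (Sigma n) (m n)%:R < th.
    apply: le_lt_trans (theta_inf_le (hX n) n1 (hS n) (S0 n) d0 d1 hK hD m0') _.
    by rewrite [ltRHS]splitr; apply: ltrD => //; near: n; exact: h2.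
  have hmn' : (m n)%:R <= n%:R :> R.
    have : (m n)%:R / n%:R < 1 :> R by near: n; exact: h4.
    by rewrite ltr_pdivrMr// mul1r => /ltW.
  split => //; last by near: n; exact: h3.
    exact: has_setting (hX n) n1 (hS n) (S0 n) d0 hK.
  apply: le_lt_trans hth.
  exact: (theta_inf_mono (hX n) n1 (hS n) (S0 n) d0 hK m0' hmn').
split=> [eps eps0|J S hJS hJ eps eps0]; apply: cvg_prob0 => eta eta0.
  have [th th0 H] := block_close eps0 eta0.
  by apply: filterS (key th th0) => n [h1 h2 h3 h4 h5]; exact: (H _ _ _ _ _ _ _ _ _ h1 h2 h3 h4 h5).
have [th th0 H] := subset_close eps0 eta0.
apply: filterS2 (key th th0) (near_inv_lt th0 hJ) => n [h1 h2 h3 h4 h5] [h6 h7].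
exact: (H _ _ _ _ _ _ _ _ _ _ _ h1 h2 h3 h4 h5 (hJS n) h6 h7).
Unshelve. all: by end_near. Qed.
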